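(* Let $m,q,r\in\mathbb{N}$ and let $\mathcal{B}$ be an arbitrary real $(m+q)\times(m+r)$ matrix. For $p\in[1,\infty)$ let $\boldsymbol{X}_p=(L^p(0,1))^m\times(L^p(0,\infty))^{q+r}$ and let $(A_p,D(A_p))$ be the operator in $\boldsymbol{X}_p$ defined by $$A_p(\boldsymbol{u},\boldsymbol{v},\boldsymbol{w})^T=(-\partial_x\boldsymbol{u},\,-\partial_x\boldsymbol{v},\,\partial_x\boldsymbol{w})^T,$$ $$D(A_p)=\left\{(\boldsymbol{u},\boldsymbol{v},\boldsymbol{w})^T\in (W^{1,p}(0,1))^m\times(W^{1,p}(0,\infty))^{q+r}:\ \binom{\boldsymbol{u}(0)}{\boldsymbol{v}(0)}=\mathcal{B}\binom{\boldsymbol{u}(1)}{\boldsymbol{w}(0)}\right\}.$$ Then for any $p\in[1,\infty)$ the operator $(A_p,D(A_p))$ generates a strongly continuous semigroup of operators in the space $\boldsymbol{X}_p$.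
   Context: Elements of $\boldsymbol{X}_p$ are written $(\boldsymbol{u},\boldsymbol{v},\boldsymbol{w})^T$ with $\boldsymbol{u}\in(L^p(0,1))^m$, $\boldsymbol{v}\in(L^p(0,\infty))^q$, $\boldsymbol{w}\in(L^p(0,\infty))^r$. Derivatives $\partial_x$ are taken componentwise in the weak sense, and the boundary values $\boldsymbol{u}(0),\boldsymbol{u}(1),\boldsymbol{v}(0),\boldsymbol{w}(0)$ of $W^{1,p}$ functions are those of their continuous representatives. *)

(* Defs.v *)
From HB Require Import structures.
From mathcomp Require Import all_boot all_order all_algebra.
From mathcomp Require Import all_classical all_reals all_analysis.
From mathcomp Require Import measurable_realfun ess_sup_inf.

Set Implicit Arguments.
Unset Strict Implicit.
Unset Printing Implicit Defensive.

Import Order.TTheory GRing.Theory Num.Theory.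
Import numFieldNormedType.Exports.

Local Open Scope classical_set_scope.
Local Open Scope ring_scope.

(* The library's [LspaceType mu p1] (classes of p-integrable functions modulo
   equality mu-a.e.) comes without any algebraic structure; it is made here a
   normed space for the L^p norm. *)
Section Lspace_normed_module.
Context d (T : measurableType d) (R : realType).
Variables (mu : {measure set T -> \bar R}) (p : \bar R) (p1 : (1 <= p)%E).

Local Notation Lp := (LspaceType mu p1).
Local Notation LF := (LfunType mu p1).
Implicit Types f g h : Lp.

HB.instance Definition _ := gen_eqMixin Lp.
HB.instance Definition _ := gen_choiceMixin Lp.

Lemma ae_eq_Lnorm (f g : T -> R) :
  measurable_fun setT f -> measurable_fun setT g -> f = g %[ae mu] ->
  'N[mu]_p[EFin \o f]%E = 'N[mu]_p[EFin \o g]%E.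
Proof.
move=> mf mg fg; rewrite unlock /Lnorm; case: p p1 => [r r1|_|//].
- congr (_ `^ _)%E; apply: ae_eq_integral => //.
  + apply/measurable_EFinP.
    apply: (measurableT_comp (measurable_powR _)) => //.
    exact: measurableT_comp.
  + apply/measurable_EFinP.
    apply: (measurableT_comp (measurable_powR _)) => //.
    exact: measurableT_comp.
  + by apply: filterS fg => x fgx _; rewrite /= fgx.
- case: ifPn => // _; apply: eq_ess_sup.
  by apply: filterS fg => x fgx; rewrite /= fgx.
Qed.

Lemma Lspace_repr_Lfun f : (f : T -> R) \in Lfun mu p.
Proof.
rewrite inE; apply/andP; split; rewrite inE/=.
  exact: (measurable_funPT (repr (LebesgueSpace.sort f))).
by case: f => f [[]].
Qed.

Definition Lspace_repr f : LF := Lfun_Sub p1 (Lspace_repr_Lfun f).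

(* [LfunType] and [LspaceType] use two copies of the Borel sigma-algebra of [R]
   that differ only in their display. *)
Definition Lfun_fun (f : LF) : T -> measurableTypeR R := f.

Lemma Lfun_fun_measurable (f : LF) : measurable_fun setT (Lfun_fun f).
Proof. exact: (measurable_funPT f). Qed.

HB.instance Definition _ (f : LF) :=
  isMeasurableFun.Build d _ T (measurableTypeR R) (Lfun_fun f)
    (Lfun_fun_measurable f).

Definition mfun_class (f : LF) : {mfun_ mu, T >-> measurableTypeR R} :=
  (\pi_({mfun_ mu, T >-> measurableTypeR R}) (Lfun_fun f))%qT.

Lemma repr_mfun_class (f : LF) : (mfun_class f : T -> R) = f %[ae mu].
Proof.
have : (repr (mfun_class f) == Lfun_fun f
          %[mod {mfun_ mu, T >-> measurableTypeR R}])%qT by rewrite reprK.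
by rewrite eqmodE => /asboolP.
Qed.

Lemma mfun_class_finite (f : LF) : finite_norm mu p (mfun_class f).
Proof.
rewrite /finite_norm (@ae_eq_Lnorm _ f).
- exact: Lfunction_finite.
- exact: (measurable_funPT (repr (mfun_class f))).
- exact: (measurable_funPT f).
- exact: repr_mfun_class.
Qed.

Definition Lspace_class (f : LF) : Lp :=
  LebesgueSpace.Pack (LebesgueSpace.Class
    (isFinLebesgue.phant_Build p1 (mfun_class_finite f))).

Lemma Lspace_classK (f : LF) : Lspace_repr (Lspace_class f) = f %[ae mu].
Proof. exact: repr_mfun_class. Qed.

Lemma Lspace_eq f g : Lspace_repr f = Lspace_repr g %[ae mu] -> f = g.
Proof.
move=> fg; have : LebesgueSpace.sort f = LebesgueSpace.sort g.
  rewrite -[LHS]reprK -[RHS]reprK; apply/eqP.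
  by rewrite eqmodE; apply/asboolP.
case: f g fg => [f [[mf]]] [g [[mg]]] _ /= fg.
by move: mf mg; rewrite fg => mf mg; rewrite (Prop_irrelevance mf mg).
Qed.

Lemma Lspace_reprK : cancel Lspace_repr Lspace_class.
Proof. by move=> f; apply: Lspace_eq; exact: Lspace_classK. Qed.

Lemma Lspace_class_eq (f g : LF) :
  f = g %[ae mu] -> Lspace_class f = Lspace_class g.
Proof.
move=> fg; apply: Lspace_eq.
apply: ae_eq_trans (Lspace_classK f) _; apply: ae_eq_trans fg _.
exact/ae_eq_sym/Lspace_classK.
Qed.

Definition Lspace_zero : Lp := Lspace_class 0.
Definition Lspace_opp f : Lp := Lspace_class (- Lspace_repr f).
Definition Lspace_add f g : Lp := Lspace_class (Lspace_repr f + Lspace_repr g).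
Definition Lspace_scale (a : R) f : Lp := Lspace_class (a *: Lspace_repr f).
Definition Lspace_norm f : R := fine 'N[mu]_p[EFin \o f]%E.

Lemma Lspace_class_opp (f : LF) :
  Lspace_opp (Lspace_class f) = Lspace_class (- f).
Proof.
apply: Lspace_class_eq.
apply: filterS (Lspace_classK f) => x /(_ I) fx _.
exact: (congr1 -%R fx).
Qed.

Lemma Lspace_class_add (f g : LF) :
  Lspace_add (Lspace_class f) (Lspace_class g) = Lspace_class (f + g).
Proof.
apply: Lspace_class_eq.
apply: filterS2 (Lspace_classK f) (Lspace_classK g) => x /(_ I) fx /(_ I) gx _.
exact: (congr2 +%R fx gx).
Qed.

Lemma Lspace_class_scale a (f : LF) :
  Lspace_scale a (Lspace_class f) = Lspace_class (a *: f).
Proof.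
apply: Lspace_class_eq.
apply: filterS (Lspace_classK f) => x /(_ I) fx _.
exact: (congr1 ( *%R a) fx).
Qed.

Lemma Lspace_class_ind (P : Lp -> Prop) :
  (forall f : LF, P (Lspace_class f)) -> forall f, P f.
Proof. by move=> Pc f; rewrite -[f]Lspace_reprK. Qed.

Lemma Lspace_addA : associative Lspace_add.
Proof.
elim/Lspace_class_ind => f; elim/Lspace_class_ind => g.
by elim/Lspace_class_ind => h; rewrite !Lspace_class_add addrA.
Qed.

Lemma Lspace_addC : commutative Lspace_add.
Proof. by move=> f g; rewrite /Lspace_add addrC. Qed.

Lemma Lspace_add0 : left_id Lspace_zero Lspace_add.
Proof.
by elim/Lspace_class_ind => f; rewrite Lspace_class_add add0r.
Qed.

Lemma Lspace_addN : left_inverse Lspace_zero Lspace_opp Lspace_add.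
Proof.
by elim/Lspace_class_ind => f; rewrite Lspace_class_opp Lspace_class_add addNr.
Qed.

HB.instance Definition _ := GRing.isZmodule.Build Lp
  Lspace_addA Lspace_addC Lspace_add0 Lspace_addN.

Lemma Lspace_scaleA a b f :
  Lspace_scale a (Lspace_scale b f) = Lspace_scale (a * b) f.
Proof.
by elim/Lspace_class_ind: f => f; rewrite !Lspace_class_scale scalerA.
Qed.

Lemma Lspace_scale1 : left_id 1 Lspace_scale.
Proof.
by elim/Lspace_class_ind => f; rewrite Lspace_class_scale scale1r.
Qed.

Lemma Lspace_scaleDr : right_distributive Lspace_scale +%R.
Proof.
move=> a; elim/Lspace_class_ind => f; elim/Lspace_class_ind => g.
rewrite [X in Lspace_scale a X]Lspace_class_add !Lspace_class_scale.
by rewrite [RHS]Lspace_class_add scalerDr.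
Qed.

Lemma Lspace_scaleDl f : {morph Lspace_scale^~ f : a b / a + b}.
Proof.
elim/Lspace_class_ind: f => f a b.
by rewrite !Lspace_class_scale [RHS]Lspace_class_add scalerDl.
Qed.

HB.instance Definition _ := GRing.Zmodule_isLmodule.Build R Lp
  Lspace_scaleA Lspace_scale1 Lspace_scaleDr Lspace_scaleDl.

Lemma Lspace_norm_class (f : LF) :
  Lspace_norm (Lspace_class f) = fine 'N[mu]_p[EFin \o f]%E.
Proof.
congr fine; apply: ae_eq_Lnorm; last exact: repr_mfun_class.
- exact: (measurable_funPT (repr (mfun_class f))).
- exact: (measurable_funPT f).
Qed.

Lemma Lspace_ler_normD f g :
  Lspace_norm (f + g) <= Lspace_norm f + Lspace_norm g.
Proof.
elim/Lspace_class_ind: f => f; elim/Lspace_class_ind: g => g.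
by rewrite [_ + _]Lspace_class_add !Lspace_norm_class ler_LnormD.
Qed.

Lemma Lspace_normZ a f : Lspace_norm (a *: f) = `|a| * Lspace_norm f.
Proof.
elim/Lspace_class_ind: f => f.
rewrite [_ *: _]Lspace_class_scale !Lspace_norm_class LnormZ fineM//.
by rewrite -finite_norm_fine.
Qed.

Lemma Lspace_norm0_eq0 f : Lspace_norm f = 0 -> f = 0.
Proof.
elim/Lspace_class_ind: f => f; rewrite Lspace_norm_class.
by move=> /fine_Lnormr_eq0 f0; exact: Lspace_class_eq.
Qed.

HB.instance Definition _ := Lmodule_isNormed.Build R Lp
  Lspace_ler_normD Lspace_normZ Lspace_norm0_eq0.

End Lspace_normed_module.

Section finite_power.
Context (R : realType) (I : finType) (V : normedModType R).
Implicit Types f g : {ffun I -> V}.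

(* Maximum norm, as in the library's product [U * V] of normed spaces. *)
Definition ffun_norm f : R := \big[Num.max/0]_i `|f i|.

Lemma ler_ffun_normD f g : ffun_norm (f + g) <= ffun_norm f + ffun_norm g.
Proof.
apply: bigmax_le => [|i _]; first by rewrite addr_ge0 ?bigmax_ge_id.
by rewrite ffunE (le_trans (ler_normD _ _))// lerD// le_bigmax.
Qed.

Lemma ffun_normZ a f : ffun_norm (a *: f) = `|a| * ffun_norm f.
Proof.
rewrite /ffun_norm.
rewrite (big_morph _ (fun x y => maxr_pMr x y (normr_ge0 a)) (mulr0 _)).
by apply: eq_bigr => i _; rewrite ffunE normrZ.
Qed.

Lemma ffun_norm0_eq0 f : ffun_norm f = 0 -> f = 0.
Proof.
move=> f0; apply/ffunP => i; rewrite ffunE; apply/eqP.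
by rewrite -normr_le0 -f0 le_bigmax.
Qed.

HB.instance Definition _ := Lmodule_isNormed.Build R {ffun I -> V}
  ler_ffun_normD ffun_normZ ffun_norm0_eq0.

End finite_power.

Section semigroup.
Context (R : realType) (X : normedModType R).

(* An operator (A, D(A)) in X is given by a function A : X -> X, of which only
   the restriction to D : set X matters. A semigroup (T(t))_{t >= 0} is given by
   a function of t : R, of which only the values at t >= 0 matter. *)
Implicit Types (S : R -> X -> X) (A : X -> X) (D : set X) (x : X).

Definition bounded_operator (L : X -> X) :=
  linear L /\ exists M : R, forall x, `|L x| <= M * `|x|.

Definition strongly_continuous_semigroup S :=
  [/\ forall t, 0 <= t -> bounded_operator (S t),
      forall x, S 0 x = x,
      forall s t, 0 <= s -> 0 <= t -> forall x, S (s + t) x = S s (S t x) &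
      forall x, {within `[0, +oo[, continuous (S ^~ x)}].

Definition is_generator A D S :=
  (forall x, D x <-> cvg (h^-1 *: (S h x - x) @[h --> 0^'+])) /\
  (forall x, D x -> h^-1 *: (S h x - x) @[h --> 0^'+] --> A x).

Definition generates_strongly_continuous_semigroup A D :=
  exists S, strongly_continuous_semigroup S /\ is_generator A D S.

End semigroup.

Section sobolev.
Context (R : realType).
Implicit Types (i : interval R) (p : R).

Definition lebesgue_on i : {measure set (measurableTypeR R) -> \bar R} :=
  mrestr lebesgue_measure (measurable_itv i).

Definition Lp i p (p1 : (1 <= p%:E)%E) := LspaceType (lebesgue_on i) p1.

(* C_c^oo(i), for an open interval i *)
Definition test_function i (phi : R -> R) :=
  (forall n x, derivable (phi^`(n))%classic x 1) /\
  exists K : set R, [/\ compact K, K `<=` [set` i] &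
    forall x, ~ K x -> phi x = 0].

Variables (i : interval R) (p : R) (p1 : (1 <= p%:E)%E).
Implicit Types u g : Lp i p1.

Definition is_weak_derivative u g :=
  forall phi, test_function i phi ->
    \int[lebesgue_measure]_(x in [set` i]) (u x * (phi^`())%classic x) =
    - \int[lebesgue_measure]_(x in [set` i]) (g x * phi x).

(* W^{1,p}(i) *)
Definition sobolev : set (Lp i p1) :=
  [set u | exists g, is_weak_derivative u g].

(* The weak derivative of u when u is in W^{1,p}(i), and a junk value
   otherwise. *)
Definition weak_derivative u : Lp i p1 := xget 0 (is_weak_derivative u).

Definition is_continuous_representative u (c : R -> R) :=
  {within closure [set` i], continuous c} /\ c = u %[ae lebesgue_on i].

(* The value at x, which may be an end point of i, of the representative of u
   that is continuous on the closure of i; junk if there is none. *)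
Definition trace u (x : R) : R :=
  xget (cst 0) (is_continuous_representative u) x.

End sobolev.

Section transport_operator.
Context (R : realType) (m q r : nat) (p : R) (p1 : (1 <= p%:E)%E).

Definition Xp : normedModType R :=
  ({ffun 'I_m -> Lp `]0, 1[ p1} * {ffun 'I_q -> Lp `]0, +oo[ p1} *
   {ffun 'I_r -> Lp `]0, +oo[ p1})%type.

Definition Ap (z : Xp) : Xp :=
  let: (u, v, w) := z in
  ([ffun j => - weak_derivative (u j)], [ffun j => - weak_derivative (v j)],
   [ffun j => weak_derivative (w j)]).

Definition Ap_domain (B : 'M[R]_(m + q, m + r)) : set Xp :=
  [set z : Xp | let: (u, v, w) := z in
    [/\ forall j, sobolev (u j), forall j, sobolev (v j),
        forall j, sobolev (w j) &
        col_mx (\col_j trace (u j) 0) (\col_j trace (v j) 0) =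
        B *m col_mx (\col_j trace (u j) 1) (\col_j trace (w j) 0)]].

End transport_operator.

(* Main.v *)
Require Import Defs.
From HB Require Import structures.
From mathcomp Require Import all_boot all_order all_algebra.
From mathcomp Require Import all_classical all_reals all_analysis.
From mathcomp Require Import measurable_realfun.
From mathcomp Require Import ring lra.

Set Implicit Arguments.
Unset Strict Implicit.
Unset Printing Implicit Defensive.

Import Order.TTheory GRing.Theory Num.Theory.
Import numFieldNormedType.Exports.

Local Open Scope classical_set_scope.
Local Open Scope ring_scope.

(* Right-moving data u and v are transported by translation; what enters at 0 in
   row rho is the combination given by B of the mass that leaves u at 1 and w at 0.
   Since u needs a unit of time to cross ]0, 1[, for times t <= 1 the inflow only
   depends on the initial data and the solution is explicit: translate by t the
   datum extended to the left of 0 by its future inflow (the profile), and translate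
   w to the left. These operators are bounded, satisfy the semigroup law as long as
   s + t <= 1, and are continuous at 0+ because translations are continuous in L^p,
   so that they extend to a strongly continuous semigroup.

   For the generator, difference quotients of the solution are difference quotients
   of the profile. If the data are in W^{1,p} and satisfy the boundary condition, the
   profile is an antiderivative of an L^p function across 0, and Jensen's inequality
   with the continuity of translations gives the limit. Conversely, if the quotients
   converge, testing against smooth functions shows that the limit is a weak
   derivative up to sign, and a violated boundary condition would be a jump of the
   profile at 0, for which the quotients blow up. *)

(** * Extending a semigroup from [0, 1] *)

(** Nothing is assumed on B and p may be 1, so the semigroup need not be contractive; an explicit
    formula replaces resolvent estimates, and short times keep it free of iterates of the boundary
    condition. Elements of L^p are classes, whereas translations, reflections and traces concern
    points. The analysis is therefore done with functions on the whole line, obtained by extending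
    the data by 0. This makes the formulas uniform: the inflow vanishes by itself to the right of 0,
    so that the profile is a plain sum, and an antiderivative of an extended weak derivative is
    constant beyond the end points, where it keeps the value of the trace. Smallness is measured by
    the integral of |f|^p and not by its root. Crude constants such as 2^p then stand in for the
    sharp inequalities of Minkowski, Hölder and Jensen, since only limits matter. *)

Section local_semigroup.
Context (R : realType) (X : normedModType R) (S : R -> X -> X) (M : R).
Hypothesis S_linear : forall t : R, 0 <= t <= 1 -> linear (S t).
Hypothesis S_bounded : forall (t : R) x, 0 <= t <= 1 -> `|S t x| <= M * `|x|.
Hypothesis S0 : forall x, S 0 x = x.
Hypothesis SD : forall (s t : R) x,
  0 <= s -> 0 <= t -> s + t <= 1 -> S (s + t) x = S s (S t x).
Hypothesis S_right_continuous : forall x, S h x @[h --> 0^'+] --> x.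

Local Notation truncn := Num.truncn.
Definition semigroup_extension t x := S (t - (truncn t)%:R) (iter (truncn t) (S 1) x).
Local Notation T := semigroup_extension.

(** Although the semigroup law is only known up to total time 1, [S 1] factors through [S c] on
    either side, as S c S(1 - c) and as S(1 - c) S c. *)
Let S1_comm (c : R) n x : 0 <= c <= 1 ->
  iter n (S 1) (S c x) = S c (iter n (S 1) x).
Proof.
move=> /andP[c0 c1]; elim: n => //= n ->; set y := iter _ _ _.
have S1R z : S 1 z = S c (S (1 - c) z) by rewrite -SD ?subr_ge0 ?subrKC.
have S1L z : S 1 z = S (1 - c) (S c z) by rewrite -SD ?subr_ge0 ?subrK.
by rewrite S1R -S1L.
Qed.

Let TE n (a : R) x : 0 <= a < 1 -> T (n%:R + a) x = S a (iter n (S 1) x).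
Proof.
move=> /andP[a0 a1]; have tE : truncn (n%:R + a) = n.
  by apply/truncn_def; rewrite lerDl a0 /= -natr1 ltrD2l.
by rewrite /T tE addrAC subrr add0r.
Qed.

Let T_local (t : R) x : 0 <= t < 1 -> T t x = S t x.
Proof. by move=> t01; rewrite -[t]add0r (TE 0)// add0r. Qed.

Let split_real (t : R) : 0 <= t -> exists n (a : R), t = n%:R + a /\ 0 <= a < 1.
Proof.
move=> t0; exists (truncn t), (t - (truncn t)%:R); rewrite subrKC; split => //.
have /andP[h1 h2] := truncn_itv t0.
by rewrite subr_ge0 h1 /= ltrBlDl natr1.
Qed.

Let TD (s t : R) x : 0 <= s -> 0 <= t -> T (s + t) x = T s (T t x).
Proof.
move=> /split_real[n [a [-> a01]]] /split_real[k [b [-> b01]]].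
have [/andP[a0 a1] /andP[b0 b1]] := (a01, b01).
rewrite !TE// S1_comm ?b0 ?(ltW b1)// -iterD.
have -> : n%:R + a + (k%:R + b) = (n + k)%:R + (a + b) :> R by rewrite natrD; ring.
have [ab|ab] := ltP (a + b) 1.
  by rewrite TE ?addr_ge0 ?ab// SD// ltW.
(* Carry case a + b >= 1: writing [S 1] as S(1 - b) S b turns S(a + b - 1) S 1 into S a S b, with no
   time beyond 1. *)
have -> : (n + k)%:R + (a + b) = (n + k).+1%:R + (a + b - 1) :> R.
  by rewrite -natr1; ring.
rewrite TE; last by apply/andP; split; lra.
rewrite [iter _ _ _]/=.
have -> z : S 1 z = S (1 - b) (S b z).
  by rewrite -SD ?subrK ?subr_ge0 ?(ltW b1).
rewrite -SD; [|lra..].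
by congr (S _ _); ring.
Qed.

(** At least 1, so that its powers increase and the bound at time t also serves at all earlier
    times. *)
Let M1 := Num.max M 1.

Let S_bounded1 t x : 0 <= t <= 1 -> `|S t x| <= M1 * `|x|.
Proof.
move=> t01; apply: (le_trans (S_bounded x t01)).
by rewrite ler_wpM2r// le_max lexx.
Qed.

Let iter_bounded n x : `|iter n (S 1) x| <= M1 ^+ n * `|x|.
Proof.
elim: n => [|n IH] /=; first by rewrite expr0 mul1r.
apply: (le_trans (S_bounded1 _ _)); first by rewrite lexx ler01.
by rewrite exprS -mulrA ler_wpM2l// le_max ler01 orbT.
Qed.

Let T_bounded t x : 0 <= t -> `|T t x| <= M1 ^+ (truncn t).+1 * `|x|.
Proof.
move=> t0; have /andP[h1 h2] := truncn_itv t0.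
have ? : t < (truncn t)%:R + 1 by rewrite natr1.
apply: (le_trans (S_bounded1 _ _)); first by apply/andP; split; lra.
by rewrite exprS -mulrA ler_wpM2l ?iter_bounded// le_max ler01 orbT.
Qed.

Let iter_linear n : linear (iter n (S 1)).
Proof.
elim: n => [|n IH] c x y //=.
by rewrite IH S_linear ?lexx ?ler01.
Qed.

Let T_linear t : 0 <= t -> linear (T t).
Proof.
move=> /split_real[n [a [-> a01]]] c x y; rewrite !TE// iter_linear S_linear//.
by case/andP: a01 => -> /ltW.
Qed.

Let TB t x y : 0 <= t -> T t x - T t y = T t (x - y).
Proof.
move=> t0; have := T_linear t0 (-1) y x.
by rewrite !scaleN1r addrC => <-; rewrite addrC.
Qed.

Let T_right (x : X) (e : R) : 0 < e ->
  exists2 d, 0 < d & forall h, 0 <= h -> h < d -> `|T h x - x| < e.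
Proof.
move=> e0; have /cvgr_distC_lt/(_ e e0) := S_right_continuous (x := x).
case=> /= d d0 dP; exists (Num.min d 1); first by rewrite lt_min d0 ltr01.
move=> h h0; rewrite lt_min => /andP[hd h1].
rewrite T_local ?h0//; have [->|hn0] := eqVneq h 0.
  by rewrite S0 subrr normr0.
have hp : 0 < h by rewrite lt_def hn0.
by apply: dP => //=; rewrite sub0r normrN gtr0_norm.
Qed.

Let T_continuous x : {within `[0, +oo[, continuous (T ^~ x)}.
Proof.
apply/subspace_continuousP => t; rewrite /= in_itv /= andbT => t0.
apply/cvgrPdistC_lt => e e0.
have [d1 d10 H1] := T_right (T t x) e0.
pose C := M1 ^+ (truncn t).+1.
have C1 : 1 <= C by rewrite exprn_ege1// le_max lexx orbT.
have C0 : 0 < C by rewrite (lt_le_trans ltr01).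
have [d2 d20 H2] := T_right x (divr_gt0 e0 C0).
rewrite near_withinE; near=> s; rewrite /from_subspace /= in_itv /= andbT => s0.
have [ts|st] := leP t s.
  rewrite -(subrK t s) TD ?subr_ge0//; apply: H1; first by rewrite subr_ge0.
  have : `|t - s| < d1 by near: s; exact: cvgr_dist_lt.
  by rewrite distrC ger0_norm ?subr_ge0.
(* Continuity from the left: with [T s] factored out, only right continuity at 0 and the bound C,
   valid for every s < t, are used. *)
have -> : T t x = T s (T (t - s) x) by rewrite -TD ?subrKC// subr_ge0 ltW.
rewrite TB// (le_lt_trans (T_bounded _ s0))//.
apply: (@le_lt_trans _ _ (C * `|x - T (t - s) x|)).
  rewrite ler_wpM2r// /C ler_weXn2l ?le_max ?lexx ?orbT// ltnS.
  by rewrite le_truncn// ltW.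
rewrite mulrC -ltr_pdivlMr// distrC H2 ?subr_ge0 ?(ltW st)//.
have : `|t - s| < d2 by near: s; exact: cvgr_dist_lt.
by rewrite gtr0_norm ?subr_gt0.
Unshelve. all: by end_near. Qed.

Lemma semigroup_extension_local t x : 0 <= t < 1 -> T t x = S t x.
Proof. exact: T_local. Qed.

Lemma semigroup_extension_strongly_continuous : strongly_continuous_semigroup T.
Proof.
split => [t t0|x|s t s0 t0 x|x].
- split; first exact: T_linear.
  by exists (M1 ^+ (truncn t).+1) => x; exact: T_bounded.
- by rewrite T_local ?lexx ?ltr01.
- exact: TD.
- exact: T_continuous.
Qed.

End local_semigroup.

(** * A smooth step *)

Section smooth_functions.
Context {R : realType}.
Implicit Types (f g : R -> R) (n : nat) (x : R).

(** The derivative is existentially quantified, so that closure under sums, products and inverses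
    follows by induction on n without computing iterated derivatives. *)
Fixpoint diff_upto n f : Prop :=
  if n is n'.+1 then
    exists f', (forall x, is_derive x 1 f (f' x)) /\ diff_upto n' f'
  else True.

Lemma diff_uptoW n f : diff_upto n.+1 f -> diff_upto n f.
Proof.
by elim: n f => //= n IH f [f' [df /IH df']]; exists f'.
Qed.

Lemma diff_upto_derivable n f x : diff_upto n.+1 f ->
  derivable (f^`(n))%classic x 1.
Proof.
elim: n f => [|n IH] f [f' [df ff']]; first exact: (@ex_derive _ _ _ _ _ _ _ (df x)).
rewrite derive1Sn (_ : (f^`())%classic = f'); first exact: IH.
by apply/funext => y; rewrite derive1E (@derive_val _ _ _ _ _ _ _ (df y)).
Qed.

Lemma diff_upto_cst n (c : R) : diff_upto n (cst c).
Proof.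
elim: n c => //= n IH c; exists (cst 0); split => // x.
exact: is_derive_cst.
Qed.

Lemma diff_uptoD n f g : diff_upto n f -> diff_upto n g -> diff_upto n (f \+ g).
Proof.
elim: n f g => //= n IH f g [f' [df ff']] [g' [dg gg']].
exists (f' \+ g'); split; last exact: IH.
by move=> x; apply: is_deriveD.
Qed.

Lemma diff_uptoM n f g : diff_upto n f -> diff_upto n g -> diff_upto n (f \* g).
Proof.
elim: n f g => // n IH f g df dg.
have [df1 dg1] := (diff_uptoW df, diff_uptoW dg).
move: df dg => [f' [df ff']] [g' [dg gg']].
exists ((f' \* g) \+ (f \* g')); split; last by apply: diff_uptoD; exact: IH.
move=> x; apply: is_derive_eq; rewrite /= /GRing.scale /=; ring.
Qed.

(** The derivative - f' / f^2 contains 1 / f again, of which the induction hypothesis already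
    provides n derivatives. *)
Lemma diff_uptoV n f : (forall x, f x != 0) -> diff_upto n f ->
  diff_upto n (fun x => (f x)^-1).
Proof.
move=> f0; elim: n => // n IH df; have := IH (diff_uptoW df).
case: df => f' [df ff'] dVf.
exists ((cst (-1) \* f') \* ((fun x => (f x)^-1) \* (fun x => (f x)^-1))); split.
  move=> x; have := is_deriveV (f0 x) (df x).
  by move/is_derive_eq; apply; rewrite /GRing.scale /= -exprVn expr2; ring.
by repeat apply: diff_uptoM => //; exact: diff_upto_cst.
Qed.

Lemma diff_upto_affine n f (a b : R) :
  diff_upto n f -> diff_upto n (fun x => f (a * x + b)).
Proof.
elim: n f => //= n IH f [f' [df ff']].
exists (cst a \* (fun x => f' (a * x + b))); split; last first.
  by apply: diff_uptoM; [exact: diff_upto_cst|exact: IH].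
move=> x.
have da : is_derive x 1 (fun x => a * x + b) a.
  by apply: is_derive_eq; rewrite /GRing.scale /= !mulr1 ?addr0.
have := @is_derive1_comp _ f (fun x => a * x + b) x _ _ (df _) da.
by move/is_derive_eq; apply; rewrite /= mulrC.
Qed.

(* The functions x^-k exp (-1/x), extended by 0 to x <= 0: up to scaling and sums
   this family is stable under differentiation. *)
Definition flat k x : R := if 0 < x then x^-1 ^+ k * expR (- x^-1) else 0.

(** With y = 1 / x this reads y^(k+2) <= (k+2)! exp y, a single term of the exponential series. It
    forces every [flat k] to tend to 0 at 0. *)
Lemma flat_le k x : `|flat k x| <= k.+2`!%:R * x ^+ 2.
Proof.
rewrite /flat; case: ifPn => [x0|_]; last first.
  by rewrite normr0 mulr_ge0// sqr_ge0.
rewrite ger0_norm ?mulr_ge0 ?exprn_ge0 ?expR_ge0 ?invr_ge0 ?(ltW x0)// expRN.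
suff le_expR (y : R) : 0 < y -> y ^+ k / expR y <= k.+2`!%:R * y^-1 ^+ 2.
  by rewrite -[leRHS]/(k.+2`!%:R * x ^+ 2) -[in leRHS](invrK x) le_expR// invr_gt0.
move=> y0; rewrite ler_pdivrMr ?expR_gt0// mulrAC exprVn.
rewrite ler_pdivlMr ?exprn_gt0// -exprD addn2 -ler_pdivrMl ?ltr0n ?fact_gt0// mulrC.
by apply: le_trans (expR_ge1Dxn k.+1 (ltW y0)); rewrite lerDr.
Qed.

Lemma is_derive_flat k x :
  is_derive x 1 (flat k) (- k%:R * flat k.+1 x + flat k.+2 x).
Proof.
have flat_le0 j y : y <= 0 -> flat j y = 0 by move=> y0; rewrite /flat ltNge y0.
have [x0|x0|->] := ltgtP x 0.
- rewrite !flat_le0 ?(ltW x0)// mulr0 addr0.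
  apply: (@near_eq_is_derive _ _ _ (cst 0)).
    by near=> y; rewrite /= flat_le0// ltW//; near: y; exact: lt_nbhsl.
- have xn0 : x != 0 by rewrite gt_eqF.
  have dV : is_derive x 1 (@GRing.inv R) (- x ^- 2).
    have := @is_deriveV _ id x 1 1 xn0 (is_derive_id _ _).
    by move/is_derive_eq; apply; rewrite /GRing.scale /= mulr1.
  have dX : is_derive x 1 (fun y : R => y^-1 ^+ k) (- k%:R * x^-1 ^+ k.+1).
    have := @is_deriveX _ _ (@GRing.inv R) k x 1 _ dV.
    rewrite exprfctE; move/is_derive_eq; apply; rewrite /GRing.scale /= -exprVn.
    by case: k => [|k]; rewrite ?mul0r ?oppr0 ?mul0r //= !exprS expr0; ring.
  have dE : is_derive x 1 (fun y : R => expR (- y^-1)) (expR (- x^-1) * x ^- 2).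
    have dN := is_deriveN dV; rewrite opprK in dN.
    exact: (@is_derive1_comp _ expR (fun y => - y^-1)).
  have := is_deriveM dX dE => dXE.
  have near_flat :
      \near x, ((fun y : R => y^-1 ^+ k) * (fun y : R => expR (- y^-1))) x = flat k x.
    by near=> y; rewrite /flat ifT//; near: y; exact: lt_nbhsr.
  apply: is_derive_eq (near_eq_is_derive near_flat dXE) _.
  rewrite /flat x0 /GRing.scale /= -exprVn !exprS expr0.
  by ring.
(* The slope of [flat k] between 0 and z is exactly [flat k.+1 z], which the quadratic bound sends
   to 0. *)
- apply/is_derive1_caratheodory; exists (flat k.+1); split.
  + move=> z; rewrite (flat_le0 k 0)// !subr0 /flat; case: ifPn => z0.
      by rewrite exprSr [RHS]mulrAC mulfVK ?gt_eqF.
    by rewrite mul0r.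
  + rewrite /prop_for/continuous_at (flat_le0 k.+1 0)//.
    apply: norm_cvg0.
    apply: (@squeeze_cvgr _ _ _ _ (cst 0) (fun z => k.+3`!%:R * z ^+ 2)).
    * by near=> z; rewrite normr_ge0 flat_le.
    * exact: cvg_cst.
    * rewrite -[X in _ --> X](mulr0 k.+3`!%:R); apply: cvgM; first exact: cvg_cst.
      rewrite -[X in _ --> X](expr0n _ 2); exact: exprn_continuous.
  + by rewrite !flat_le0// mulr0 addr0.
Unshelve. all: by end_near. Qed.

Lemma diff_upto_flat n k : diff_upto n (flat k).
Proof.
elim: n k => // n IH k.
exists ((cst (- k%:R) \* flat k.+1) \+ flat k.+2); split; first exact: is_derive_flat.
by apply: diff_uptoD => //; apply: diff_uptoM => //; exact: diff_upto_cst.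
Qed.

(** The usual quotient e(1 + x) / (e(1 + x) + e(1 - x)), where e(y) is exp(-1/y) for y > 0 and 0
    otherwise. The arguments are spelled as affine maps to match [diff_upto_affine]. *)
Definition smooth_step x : R :=
  flat 0 (1 * x + 1) * (flat 0 (1 * x + 1) + flat 0 (- 1 * x + 1))^-1.

Let flat0_ge0 x : 0 <= flat 0 x.
Proof. by rewrite /flat; case: ifPn => // _; rewrite expr0 mul1r expR_ge0. Qed.

Let flat0_gt0 x : 0 < x -> 0 < flat 0 x.
Proof. by move=> x0; rewrite /flat x0 expr0 mul1r expR_gt0. Qed.

Let flat0_eq0 x : x <= 0 -> flat 0 x = 0.
Proof. by move=> x0; rewrite /flat ltNge x0. Qed.

Let denominator_gt0 x : 0 < flat 0 (1 * x + 1) + flat 0 (- 1 * x + 1).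
Proof.
have [x0|x0] := leP 0 x.
  by rewrite ltr_pwDl//; apply: flat0_gt0; lra.
by rewrite ltr_wpDl//; apply: flat0_gt0; lra.
Qed.

Lemma diff_upto_smooth_step n : diff_upto n smooth_step.
Proof.
apply: (@diff_uptoM n (fun x => flat 0 (1 * x + 1))).
  by apply: diff_upto_affine; exact: diff_upto_flat.
apply: diff_uptoV => [x|]; first by rewrite gt_eqF.
by apply: diff_uptoD; apply: diff_upto_affine; exact: diff_upto_flat.
Qed.

Lemma smooth_step_left x : x <= -1 -> smooth_step x = 0.
Proof. by move=> x1; rewrite /smooth_step flat0_eq0 ?mul0r//; lra. Qed.

Lemma smooth_step_right x : 1 <= x -> smooth_step x = 1.
Proof.
move=> x1; rewrite /smooth_step [flat 0 (-1 * x + 1)]flat0_eq0; last lra.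
by rewrite addr0 divff// gt_eqF//; apply: flat0_gt0; lra.
Qed.

Lemma smooth_step_ge0 x : 0 <= smooth_step x.
Proof. by rewrite mulr_ge0 ?invr_ge0 ?(ltW (denominator_gt0 x)). Qed.

Lemma smooth_step_le1 x : smooth_step x <= 1.
Proof. by rewrite /smooth_step ler_pdivrMr// [1 * (_ + _)]mul1r lerDl. Qed.

End smooth_functions.

(** * Translations in L^p *)

Section affine_invariance.
Context {R : realType}.
Local Notation mu := (@lebesgue_measure R).
Variables (s c : R).
Hypothesis s1 : `|s| = 1.

Let aff (x : measurableTypeR R) : measurableTypeR R := s * x + c.

Lemma measurable_affine : measurable_fun [set: measurableTypeR R] aff.
Proof. by apply: measurable_funD => //; apply: measurable_funM. Qed.

HB.instance Definition _ := isMeasurableFun.Build _ _ _ _ aff measurable_affine.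

(** By uniqueness of Lebesgue measure it suffices to compare intervals []a, b]]; a reflection turns
    one into an interval of the same length, closed at the other end. *)
Lemma lebesgue_measure_affine A : measurable A -> mu (aff @^-1` A) = mu A.
Proof.
move=> mA; apply/esym.
apply: (@lebesgue_measure_unique R (pushforward mu aff)) => //.
move=> _ [[a b] _ <-] /=; rewrite /pushforward.
have [s_eq|s_eq] : s = 1 \/ s = -1.
  have := s1; have [s0|s0] := ger0P s; first by left.
  by move/(congr1 -%R); rewrite opprK; right.
- rewrite (_ : aff @^-1` _ = `]a - c, b - c]%classic).
    rewrite !lebesgue_measure_itv/= !lte_fin ltrD2r.
    by case: ifPn => // _; rewrite -!EFinD; congr EFin; ring.
  by apply/seteqP; split => x /=; rewrite /aff s_eq !in_itv/= mul1r ltrBlDr lerBrDr.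
- rewrite (_ : aff @^-1` _ = `[c - b, c - a[%classic).
    rewrite !lebesgue_measure_itv/= !lte_fin ltrD2l ltrN2.
    by case: ifPn => // _; rewrite -!EFinD; congr EFin; ring.
  apply/seteqP; split => x /=; rewrite /aff s_eq !in_itv/= mulN1r => /andP[? ?];
    by apply/andP; split; lra.
Qed.

Lemma integral_affine (f : R -> \bar R) :
  measurable_fun [set: measurableTypeR R] f ->
  (\int[mu]_x f (s * x + c)%R = \int[mu]_x f x)%E.
Proof.
move=> mf; rewrite [RHS](eq_measure_integral (pushforward mu aff)) => [|A mA _]; last first.
  by apply/esym; exact: lebesgue_measure_affine.
rewrite [LHS]integralE [RHS]integralE !ge0_integral_pushforward//.
- by rewrite preimage_setT -funepos_comp -funeneg_comp.
- exact: measurable_funeneg.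
- exact: measurable_funepos.
Qed.

Lemma ae_affine (P : R -> Prop) :
  {ae mu, forall x, P x} -> {ae mu, forall x, P (s * x + c)}.
Proof.
move=> [N [mN N0 PN]]; exists (aff @^-1` N); split.
- by rewrite -[_ @^-1` _]setTI; exact: measurable_affine.
- by rewrite [LHS]lebesgue_measure_affine.
- by move=> x /= Px; exact: PN.
Qed.

End affine_invariance.

(** * Integrals of p-th powers *)

Section p_integral.
Context {R : realType}.
Local Notation mu := (@lebesgue_measure R).
Local Notation T := (measurableTypeR R).
Variable p : R.
Hypothesis p1 : 1 <= p.
Implicit Types (D : set T) (f g : R -> R).

(** The p-th power of the L^p norm, in the extended reals: there is no root to take, and it can be
    written before integrability is known. *)
Definition pint D f : \bar R := (\int[mu]_(x in D) (`|f x| `^ p)%:E)%E.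

Let p0 : 0 < p. Proof. exact: lt_le_trans p1. Qed.

Lemma measurable_fun_pint D f : measurable_fun D f ->
  measurable_fun D (fun x => (`|f x| `^ p)%:E).
Proof.
move=> mf; apply/measurable_EFinP.
by apply: (measurableT_comp (measurable_powR _)); exact: measurableT_comp.
Qed.

Lemma pint_ge0 D f : (0 <= pint D f)%E.
Proof. by apply: integral_ge0 => x _; rewrite lee_fin powR_ge0. Qed.

Lemma pint_mkcond D f : pint D f = pint setT (f \_ D).
Proof.
rewrite /pint integral_mkcond; apply: eq_integral => x _.
by rewrite /patch; case: ifPn => //; rewrite normr0 powR0// gt_eqF.
Qed.

Lemma pint_subset D D' f : measurable D -> measurable D' -> D `<=` D' ->
  measurable_fun D' f -> (pint D f <= pint D' f)%E.
Proof.
move=> mD mD' DD' mf; apply: ge0_subset_integral => //.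
exact: measurable_fun_pint.
Qed.

Lemma eq_pint D f g : {in D, f =1 g} -> pint D f = pint D g.
Proof. by move=> fg; apply: eq_integral => x xD; rewrite fg. Qed.

Lemma ae_eq_pint D f g : measurable D -> measurable_fun D f ->
  measurable_fun D g -> {ae mu, forall x, D x -> f x = g x} ->
  pint D f = pint D g.
Proof.
move=> mD mf mg fg; apply: ae_eq_integral => //; [exact: measurable_fun_pint..|].
by apply: filterS fg => x fgx Dx; rewrite fgx.
Qed.

Lemma pint_affine (s c : R) f : `|s| = 1 -> measurable_fun [set: T] f ->
  pint setT (fun x => f (s * x + c)) = pint setT f.
Proof.
move=> s1 mf.
by rewrite /pint (integral_affine c s1 (measurable_fun_pint mf)).
Qed.

Lemma le_pint D f g : measurable D -> measurable_fun D f -> measurable_fun D g ->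
  (forall x, D x -> `|f x| <= `|g x|) -> (pint D f <= pint D g)%E.
Proof.
move=> mD mf mg fg; apply: ge0_le_integral => //; [exact: measurable_fun_pint..|].
by move=> x Dx; rewrite lee_fin ge0_ler_powR ?nnegrE ?(ltW p0)// fg.
Qed.

(** The sum is at most twice the larger of |a| and |b|, whose p-th power is one of the two terms on
    the right. *)
Lemma powR_norm_le_add (a b : R) :
  `|a + b| `^ p <= 2 `^ p * (`|a| `^ p + `|b| `^ p).
Proof.
have ab : `|a + b| <= 2 * Num.max `|a| `|b|.
  apply: (le_trans (ler_normD _ _)); rewrite mulr2n mulrDl mul1r.
  by rewrite lerD// le_max lexx ?orbT.
apply: (@le_trans _ _ ((2 * Num.max `|a| `|b|) `^ p)).
  by rewrite ge0_ler_powR ?nnegrE ?(ltW p0)// mulr_ge0// le_max normr_ge0.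
rewrite powRM// ?le_max ?normr_ge0// ler_wpM2l ?powR_ge0//.
by rewrite /Num.max; case: ifPn => _; rewrite ?lerDr ?lerDl powR_ge0.
Qed.

Lemma pintD D f g : measurable D -> measurable_fun D f -> measurable_fun D g ->
  (pint D (f \+ g)%R <= (2 `^ p)%:E * (pint D f + pint D g))%E.
Proof.
move=> mD mf mg; rewrite /pint -ge0_integralD//; [|exact: measurable_fun_pint..].
rewrite -ge0_integralZl_EFin ?powR_ge0//; last 2 first.
- by move=> x _; rewrite -EFinD lee_fin addr_ge0 ?powR_ge0.
- by apply: emeasurable_funD; exact: measurable_fun_pint.
apply: ge0_le_integral => //.
- by apply: measurable_fun_pint; exact: measurable_funD.
- apply: measurable_funeM.
  by apply: emeasurable_funD; exact: measurable_fun_pint.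
- by move=> x _; rewrite -EFinD -EFinM lee_fin powR_norm_le_add.
Qed.

Lemma pintZ D (a : R) f : measurable D -> measurable_fun D f ->
  pint D (fun x => a * f x) = ((`|a| `^ p)%:E * pint D f)%E.
Proof.
move=> mD mf; rewrite /pint -ge0_integralZl_EFin ?powR_ge0//; last first.
  exact: measurable_fun_pint.
by apply: eq_integral => x _; rewrite normrM powRM.
Qed.

(** Either |y| <= e, or (|y| / e)^(p - 1) >= 1 and the second term alone is enough. *)
Lemma le_powR_norm (e y : R) : 0 < e -> `|y| <= e + e `^ (1 - p) * `|y| `^ p.
Proof.
move=> e0; have [ye|ye] := leP `|y| e.
  by rewrite (le_trans ye)// lerDl mulr_ge0 ?powR_ge0.
rewrite (@le_trans _ _ (e `^ (1 - p) * `|y| `^ p))//; last by rewrite lerDr ltW.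
have y0 : 0 < `|y| by rewrite (lt_trans e0).
have -> : e `^ (1 - p) = (e `^ (p - 1))^-1 by rewrite -powRN opprB.
rewrite mulrC ler_pdivlMr ?powR_gt0//.
rewrite -{2}(subrK 1 p) [in leRHS]powRD; last by rewrite subrK gt_eqF.
rewrite powRr1// mulrC ler_wpM2r//.
by rewrite ge0_ler_powR ?subr_ge0 ?nnegrE// ltW.
Qed.

(** A substitute for Hölder's inequality on sets of finite measure. The free parameter e is later
    taken equal to 1, to half of a mean value, or small. *)
Lemma le_integral_pint D f (e : R) : 0 < e -> measurable D ->
  measurable_fun D f ->
  (\int[mu]_(x in D) `|(f x)%:E| <= e%:E * mu D + (e `^ (1 - p))%:E * pint D f)%E.
Proof.
move=> e0 mD mf; rewrite -integral_cst// /pint -ge0_integralZl_EFin ?powR_ge0//; last first.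
  exact: measurable_fun_pint.
rewrite -ge0_integralD//; last 3 first.
- by move=> x _; rewrite lee_fin ltW.
- by move=> x _; rewrite mule_ge0 ?lee_fin ?powR_ge0.
- apply: measurable_funeM; exact: measurable_fun_pint.
apply: ge0_le_integral => //.
- by apply: measurableT_comp => //; exact/measurable_EFinP.
- by apply: emeasurable_funD => //; apply: measurable_funeM; exact: measurable_fun_pint.
- by move=> x _; rewrite -EFinM -EFinD lee_fin le_powR_norm.
Qed.

End p_integral.

Lemma continuous_unif_translation (R : realType) (g : R -> R) (K : set R) (e : R) :
  continuous g -> compact K -> 0 < e ->
  \forall h \near (0 : R), forall x, K x -> `|g (x + h) - g x| < e.
Proof.
move=> cg /compact_near_coveringP cK e0.
apply: (cK R (nbhs (0:R)) (fun h x => `|g (x + h) - g x| < e) _) => x Kx.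
have : (fun z : R * R => g (z.1 + z.2) - g z.1) z @[z --> (x, 0 : R)] --> (0 : R).
  rewrite -[X in _ --> X](subrr (g x)) -[in X in _ --> X - _](addr0 x).
  apply: cvgB.
    apply: (@cvg_comp _ _ _ (fun z : R * R => z.1 + z.2) g).
      by apply: cvgD; [exact: cvg_fst|exact: cvg_snd].
    exact: cg.
  by apply: (@cvg_comp _ _ _ fst g); [exact: cvg_fst|exact: cg].
by move/cvgr0_norm_lt => /(_ e e0).
Qed.

(** * Continuity of translations in L^1 for bounded functions of bounded support *)

Section translation_continuity.
Context {R : realType}.
Local Notation mu := (@lebesgue_measure R).
Local Notation T := (measurableTypeR R).
Implicit Types (f g : R -> R).

Lemma measurable_shift f (h : R) : measurable_fun [set: T] f ->
  measurable_fun [set: T] (fun x => f (x + h)).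
Proof.
move=> mf; apply: (measurableT_comp mf).
exact: measurable_funD.
Qed.

Lemma translation_integral_continuous f (N e : R) : 0 < N -> 0 < e ->
  measurable_fun [set: T] f -> (forall x, `|f x| <= N) ->
  (forall x, N < `|x| -> f x = 0) ->
  \forall h \near (0 : R), (\int[mu]_x `|(f (x + h) - f x)%:E| <= e%:E)%E.
Proof.
move=> N0 e0 mf fN f0.
(* For |h| < 1, both f x and f (x + h) vanish when |x| > N + 1; one more unit of room keeps x + h in
   E, where g approximates f, for all remaining x. *)
pose E : set T := `[- (N + 2), N + 2]%classic.
have mE : measurable E by exact: measurable_itv.
have muE : (mu E = (2 * (N + 2))%:E)%E.
  rewrite lebesgue_measure_itv/= lte_fin ifT; last lra.
  by rewrite -EFinD; congr EFin; ring.
have muEy : (mu E < +oo)%E by rewrite muE ltry.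
have intf : mu.-integrable E (EFin \o f).
  apply: measurable_bounded_integrable => //; first exact: measurable_funS mf.
  by exists N; split; rewrite ?num_real// => M NM x _; apply: (le_trans (fN x)); exact: ltW.
have [g_ [cg_ ig_ cvg_g]] := approximation_continuous_integrable mE muEy intf.
have e40 : 0 < e / 4 by rewrite divr_gt0.
have [n gn] : exists n, (\int[mu]_(z in E) `|(f z - g_ n z)%:E| <= (e / 4)%:E)%E.
  move/fine_cvgP : cvg_g => -[[n1 _ fin]] /cvgr0_norm_le /(_ _ e40) [n2 _ small].
  exists (maxn n1 n2); move: (fin _ (leq_maxl n1 n2)) (small _ (leq_maxr n1 n2)) => /=.
  by move=> /fineK <-; rewrite lee_fin; apply: le_trans; exact: ler_norm.
pose g := g_ n; have cg : continuous g by exact: cg_.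
have mg : measurable_fun [set: T] g by exact: continuous_measurable_fun.
(* Chosen so that eta times the measure of E is e / 2; the two approximation errors contribute e / 4
   each. *)
pose eta := e / (4 * (N + 2)).
have eta0 : 0 < eta by rewrite divr_gt0// mulr_gt0// addr_gt0.
pose K : set R := `[- (N + 1), N + 1]%classic.
near=> h.
have h1 : `|h| < 1 by near: h; exists 1 => //= z; rewrite /= sub0r normrN.
have gK x : K x -> `|g (x + h) - g x| < eta.
  move: x; near: h; apply: continuous_unif_translation => //.
  exact: segment_compact.
pose G x := `|f x - g x| * \1_E x : R.
have mG : measurable_fun [set: T] G.
  apply: measurable_funM => //; apply: measurableT_comp => //; exact: measurable_funB.
have G0 x : 0 <= G x by rewrite mulr_ge0.
have pointwise x : `|f (x + h) - f x| <= G (x + h) + G x + eta * \1_E x.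
  have [|] := pselect (K x).
    rewrite /K /= in_itv /= => /andP[x1 x2].
    have /andP[h2 h3] : - 1 < h < 1 by rewrite -ltr_norml.
    have xE : \1_E x = 1 :> R.
      by rewrite indicE mem_set// /E /= in_itv /=; apply/andP; split; lra.
    have xhE : \1_E (x + h) = 1 :> R.
      by rewrite indicE mem_set// /E /= in_itv /=; apply/andP; split; lra.
    rewrite /G xE xhE !mulr1.
    have -> : f (x + h) - f x =
        (f (x + h) - g (x + h)) + (g x - f x) + (g (x + h) - g x) by ring.
    rewrite (le_trans (ler_normD _ _))// lerD//; last first.
      by apply/ltW/gK; rewrite /K /= in_itv /= x1 x2.
    by rewrite (le_trans (ler_normD _ _))// lerD// distrC.
  move=> Kx; have xN : N + 1 < `|x|.
    by rewrite ltNge; apply/negP => xN; apply: Kx; rewrite /K /= in_itv /= -ler_norml.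
  have xhN : N < `|x + h|.
    have : `|x| - `|h| <= `|x + h| by exact: lerB_normD.
    lra.
  rewrite !f0//; last lra.
  by rewrite subrr normr0 addr_ge0// ?addr_ge0// mulr_ge0// ltW.
have intG : (\int[mu]_x (G x)%:E <= (e / 4)%:E)%E.
  apply: le_trans gn; rewrite [leRHS]integral_mkcond; apply: ge0_le_integral => //.
  - by move=> x _; rewrite lee_fin.
  - exact/measurable_EFinP.
  - apply/(measurable_restrictT _ _).1 => //.
    apply: measurableT_comp => //; apply/measurable_EFinP.
    by apply: measurable_funS (measurable_funB mf mg).
  - move=> x _; rewrite /G /patch indicE; case: ifPn => xE; first by rewrite mulr1.
    by rewrite mulr0.
have mGh := measurable_shift h mG.
apply: (@le_trans _ _ (\int[mu]_x (G (x + h) + G x + eta * \1_E x)%:E)%E).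
  apply: ge0_le_integral => //.
  - apply: measurableT_comp => //; apply/measurable_EFinP.
    by apply: measurable_funB => //; exact: measurable_shift.
  - apply/measurable_EFinP; apply: measurable_funD; first exact: measurable_funD.
    exact: measurable_funM.
  - by move=> x _; rewrite lee_fin.
under eq_integral do rewrite !EFinD.
rewrite ge0_integralD//; last 4 first.
- by move=> x _; rewrite -EFinD lee_fin addr_ge0.
- by apply: emeasurable_funD; exact/measurable_EFinP.
- by move=> x _; rewrite lee_fin mulr_ge0// ltW.
- by apply/measurable_EFinP; exact: measurable_funM.
rewrite ge0_integralD//; last 4 first.
- by move=> x _; rewrite lee_fin.
- exact/measurable_EFinP.
- by move=> x _; rewrite lee_fin.
- exact/measurable_EFinP.
have -> : (\int[mu]_x (G (x + h))%:E = \int[mu]_x (G x)%:E)%E.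
  have := @integral_affine R 1 h (normr1 _) (EFin \o G).
  by under eq_integral do rewrite mul1r; apply; exact/measurable_EFinP.
have -> : (\int[mu]_x (eta * \1_E x)%:E = (e / 2)%:E)%E.
  under eq_integral do rewrite EFinM.
  rewrite ge0_integralZl_EFin ?(ltW eta0)//; last first.
    by apply/measurable_EFinP.
  rewrite integral_indic// setIT [X in (_ * X)%E]muE -EFinM /eta; congr EFin.
  by field; rewrite gt_eqF// addr_gt0.
have -> : e%:E = ((e / 4)%:E + (e / 4)%:E + (e / 2)%:E)%E.
  by rewrite -!EFinD; congr EFin; field.
by rewrite leeD// leeD.
Unshelve. all: by end_near. Qed.

End translation_continuity.

(** * Continuity of translations in L^p *)

Section translation_continuity_p.
Context {R : realType}.
Local Notation mu := (@lebesgue_measure R).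
Local Notation T := (measurableTypeR R).
Variable p : R.
Hypothesis p1 : 1 <= p.
Implicit Types (f g : R -> R).

Let p0 : 0 < p. Proof. exact: lt_le_trans p1. Qed.

(** Differences of values of f are at most 2 N, so their p-th power is at most (2 N)^(p - 1) times
    their absolute value: the claim reduces to L^1. *)
Let translation_pint_bounded f (N e : R) : 0 < N -> 0 < e ->
  measurable_fun [set: T] f -> (forall x, `|f x| <= N) ->
  (forall x, N < `|x| -> f x = 0) ->
  \forall h \near (0 : R), (pint p setT (fun x => (f (x + h) - f x)%R) <= e%:E)%E.
Proof.
move=> N0 e0 mf fN f0; pose C := (2 * N) `^ (p - 1).
have C0 : 0 < C by rewrite powR_gt0// mulr_gt0.
have := translation_integral_continuous N0 (divr_gt0 e0 C0) mf fN f0.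
apply: filter_app; near=> h => fh.
have mfh : measurable_fun [set: T] (fun x => f (x + h) - f x).
  by apply: measurable_funB => //; exact: measurable_shift.
apply: (@le_trans _ _ (\int[mu]_x (C%:E * `|(f (x + h) - f x)%:E|))%E).
  apply: ge0_le_integral => //.
  - exact: measurable_fun_pint.
  - by apply: measurable_funeM; apply: measurableT_comp => //; exact/measurable_EFinP.
  - move=> x _; rewrite /= -EFinM lee_fin; set a := f (x + h) - f x.
    have aN : `|a| <= 2 * N.
      by rewrite (le_trans (ler_normB _ _))// mulr2n mulrDl mul1r lerD.
    rewrite -(mulr_powRB1 (normr_ge0 a) p0) mulrC ler_wpM2r//.
    by rewrite ge0_ler_powR ?subr_ge0 ?nnegrE// mulr_ge0// ltW.
rewrite ge0_integralZl_EFin ?(ltW C0)//; last first.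
  by apply: measurableT_comp => //; exact/measurable_EFinP.
by rewrite muleC -lee_pdivlMr.
Unshelve. all: by end_near. Qed.

(** Cuts off both the argument and the value, at n + 1 so that the bound is positive even for n =
    0. *)
Definition truncation (n : nat) f x : R :=
  if (`|x| <= n.+1%:R) && (`|f x| <= n.+1%:R) then f x else 0.

Lemma measurable_truncation n f : measurable_fun [set: T] f ->
  measurable_fun [set: T] (truncation n f).
Proof.
move=> mf; apply: measurable_fun_ifT => //; apply: measurable_and.
  by apply: measurable_fun_ler => //; exact: measurableT_comp.
by apply: measurable_fun_ler => //; exact: measurableT_comp.
Qed.

Lemma pint_truncation f : measurable_fun [set: T] f -> (pint p setT f < +oo)%E ->
  pint p setT (fun x => f x - truncation n f x)%R @[n --> \oo] --> 0%E.
Proof.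
move=> mf foo.
rewrite -[X in _ --> X](integral0 mu setT).
apply: (@dominated_cvg _ _ _ mu setT measurableT _ _ (fun x => (`|f x| `^ p)%:E)).
- move=> n; apply: measurable_fun_pint => //.
  by apply: measurable_funB => //; exact: measurable_truncation.
- move=> x _; apply: cvg_near_cst; near=> n.
  rewrite /truncation ifT ?subrr ?normr0 ?powR0 ?gt_eqF//.
  apply/andP; split.
    apply: (@le_trans _ _ n%:R); last by rewrite ler_nat.
    by near: n; exact: nbhs_infty_ger.
  apply: (@le_trans _ _ n%:R); last by rewrite ler_nat.
  by near: n; exact: nbhs_infty_ger.
- by [].
- apply/integrableP; split; first exact: measurable_fun_pint.
  by under eq_integral do rewrite gee0_abs ?lee_fin ?powR_ge0//.
- move=> n x _; rewrite gee0_abs ?lee_fin ?powR_ge0//.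
  rewrite ge0_ler_powR ?nnegrE ?(ltW p0)// /truncation.
  by case: ifPn => _; rewrite ?subrr ?normr0 ?subr0.
Unshelve. all: by end_near. Qed.

Lemma translation_pint_continuous f (e : R) : 0 < e ->
  measurable_fun [set: T] f -> (pint p setT f < +oo)%E ->
  \forall h \near (0 : R), (pint p setT (fun x => (f (x + h) - f x)%R) <= e%:E)%E.
Proof.
(* With D = 2^p and y = e / C, splitting the difference into three terms and applying [pintD] twice
   gives D (y + D (y + y)), which is at most 4 D^2 y = e because D >= 1. *)
move=> e0 mf foo; pose C : R := 2 `^ p * 2 `^ p * 4.
have C0 : 0 < C by rewrite !mulr_gt0 ?powR_gt0.
have eC0 : 0 < e / C by rewrite divr_gt0.
have [n fn] : exists n, (pint p setT (fun x => (f x - truncation n f x)%R) <= (e / C)%:E)%E.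
  have /fine_cvgP[[n1 _ fin] /cvgr0_norm_le /(_ _ eC0) [n2 _ small]] := pint_truncation mf foo.
  exists (maxn n1 n2); move: (fin _ (leq_maxl n1 n2)) (small _ (leq_maxr n1 n2)) => /=.
  by move=> /fineK <-; rewrite lee_fin; apply: le_trans; exact: ler_norm.
pose g := truncation n f; have mg : measurable_fun [set: T] g by exact: measurable_truncation.
have n0 : 0 < n.+1%:R :> R by rewrite ltr0n.
have gn x : `|g x| <= n.+1%:R.
  by rewrite /g /truncation; case: ifPn => [/andP[]//|_]; rewrite normr0 ltW.
have g0 x : n.+1%:R < `|x| -> g x = 0.
  by move=> nx; rewrite /g /truncation leNgt nx.
have := translation_pint_bounded n0 eC0 mg gn g0.
apply: filter_app; near=> h => gh.
pose k x := f x - g x; have mk : measurable_fun [set: T] k by exact: measurable_funB.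
have mkh := measurable_shift h mk.
have mgh : measurable_fun [set: T] (fun x => g (x + h) - g x).
  by apply: measurable_funB => //; exact: measurable_shift.
have mNk : measurable_fun [set: T] (fun x => - 1 * k x) by exact: measurable_funM.
rewrite (_ : (fun x => _) = (fun x => k (x + h)) \+
    ((fun x => g (x + h) - g x) \+ (fun x => - 1 * k x))); last first.
  by apply/funext => x; rewrite /k /=; ring.
apply: (le_trans (pintD _ _ _ _)) => //; first exact: measurable_funD.
have -> : pint p setT (fun x => k (x + h)) = pint p setT k.
  have := pint_affine p h (normr1 _) mk.
  by under eq_fun do rewrite mul1r.
have H2 := pintD p1 measurableT mgh mNk.
rewrite [X in (_ <= _ * (_ + X))%E]pintZ// normrN normr1 powR1 mul1e in H2.
have {}H2 : (pint p setT ((fun x => g (x + h) - g x) \+ (fun x => - 1 * k x))%R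
    <= (2 `^ p * (e / C + e / C))%:E)%E.
  apply: (le_trans H2); rewrite EFinM lee_wpmul2l ?lee_fin ?powR_ge0//.
  rewrite EFinD; apply: leeD; [exact: gh|exact: fn].
apply: (@le_trans _ _ (2 `^ p * (e / C + 2 `^ p * (e / C + e / C)))%:E).
  rewrite [leRHS]EFinM; apply: lee_wpmul2l; first by rewrite lee_fin powR_ge0.
  rewrite EFinD; apply: leeD; [exact: fn|exact: H2].
rewrite lee_fin.
have D1 : 1 <= 2 `^ p :> R 
  by have := @ler_powR _ 2 (ler1n _ 2) 0 p (ltW p0); rewrite powRr0.
have : e / C * C = e by rewrite divfK// gt_eqF.
rewrite {2}/C; set D := 2 `^ p in D1 *; set y := e / C => <-.
have y0 : 0 <= y by rewrite ltW.
rewrite -subr_ge0 (_ : _ - _ = y * D * (2 * D - 1)); last by ring.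
have D0 : 0 <= D by lra.
apply: mulr_ge0; first exact: mulr_ge0.
by rewrite subr_ge0; lra.
Unshelve. all: by end_near. Qed.

End translation_continuity_p.

(** * Averages of translates *)

Section averages.
Context {R : realType}.
Local Notation mu := (@lebesgue_measure R).
Local Notation T := (measurableTypeR R).
Variable p : R.
Hypothesis p1 : 1 <= p.
Implicit Types (f g G : R -> R).

Let p0 : 0 < p. Proof. exact: lt_le_trans p1. Qed.

Lemma pint_integrable (D : set T) f : measurable D -> (mu D < +oo)%E ->
  measurable_fun [set: T] f -> (pint p setT f < +oo)%E ->
  mu.-integrable D (EFin \o f).
Proof.
move=> mD muD mf foo; apply/integrableP; split.
  by apply/measurable_EFinP; exact: measurable_funS mf.
apply: le_lt_trans (le_integral_pint p1 ltr01 mD (measurable_funS _ _ mf)) _ => //.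
rewrite mul1e powR1 mul1e lte_add_pinfty//.
by apply: le_lt_trans foo; exact: pint_subset.
Qed.

(* Jensen's inequality, with a constant that is not sharp but easier to get. *)
Lemma powR_average_le (h : R) f : 0 < h -> measurable_fun `[0, h] f ->
  mu.-integrable `[0, h] (EFin \o f) ->
  ((`|h^-1 * \int[mu]_(s in `[0, h]) f s| `^ p)%:E <=
    (2 `^ p * h^-1)%:E * pint p `[0%R, h] f)%E.
Proof.
move=> h0 mf intf; pose D : set T := `[0, h]%classic.
have mD : measurable D by exact: measurable_itv.
have muD : (mu D = h%:E)%E by rewrite lebesgue_measure_itv/= lte_fin h0 oppr0 adde0.
have absf : (\int[mu]_(s in D) `|(f s)%:E| < +oo)%E by case/integrableP : intf.
pose I := (\int[mu]_(s in D) `|f s|)%R.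
have IE : (\int[mu]_(s in D) `|(f s)%:E| = I%:E)%E.
  by rewrite /I /Rintegral fineK// ge0_fin_numE// integral_ge0.
have I0 : 0 <= I by rewrite -lee_fin -IE integral_ge0.
apply: (@le_trans _ _ ((h^-1 * I) `^ p)%:E).
  rewrite lee_fin ge0_ler_powR ?nnegrE ?(ltW p0)//.
    by rewrite mulr_ge0// invr_ge0 ltW.
  rewrite normrM ger0_norm ?invr_ge0 ?(ltW h0)// ler_wpM2l ?invr_ge0 ?(ltW h0)//.
  exact: le_normr_Rintegral.
have [->|I_neq0] := eqVneq I 0.
  rewrite mulr0 powR0 ?gt_eqF// mule_ge0 ?pint_ge0//.
  by rewrite lee_fin mulr_ge0 ?powR_ge0// invr_ge0 ltW.
have {I_neq0}Ip : 0 < I by rewrite lt_def I_neq0.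
(* Half the mean value of |f|: the term e * h is then I / 2 and is absorbed by the left-hand side
   I. *)
pose e := h^-1 * I / 2.
have e0 : 0 < e by rewrite divr_gt0// mulr_gt0// invr_gt0.
have := le_integral_pint p1 e0 mD mf.
rewrite IE muD; case: (pint p D f) (pint_ge0 p D f) => [P| |//]; last first.
  by move=> _ _; rewrite gt0_muley ?leey// lte_fin mulr_gt0 ?powR_gt0// invr_gt0.
rewrite !lee_fin => P0.
have -> : e * h = I / 2 by rewrite /e; field; rewrite gt_eqF.
have -> : h^-1 * I = 2 * e by rewrite /e; field; rewrite gt_eqF.
rewrite -lerBlDl (_ : I - I / 2 = e * h); last by rewrite /e; field; rewrite gt_eqF.
rewrite [(2 * e) `^ p]powRM ?(ltW e0)// => H.
rewrite -mulrA ler_wpM2l ?powR_ge0//.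
rewrite ler_pdivlMl// mulrC -(mulr_powRB1 (ltW e0) p0).
rewrite -[p - 1]opprB powRN -mulrA [_^-1 * h]mulrC mulrA ler_pdivrMr ?powR_gt0//.
by rewrite [leRHS]mulrC.
Qed.

(** F is the average over t of the translation differences of G. Jensen's inequality moves the p-th
    power inside the average, and Tonelli's theorem exchanges x and t, so that F is controlled by
    the worst translation. *)
Lemma pint_average_le (D : set T) (s h e : R) F G : `|s| = 1 -> 0 < h -> 0 <= e ->
  measurable D -> measurable_fun [set: T] F -> measurable_fun [set: T] G ->
  (pint p setT G < +oo)%E ->
  (forall t, 0 <= t <= h -> (pint p setT (fun x => G (x + s * t) - G x)%R <= e%:E)%E) ->
  {ae mu, forall x, D x ->
    F x = h^-1 * (\int[mu]_(t in `[0, h]) G (x + s * t)) - G x} ->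
  (pint p D F <= (2 `^ p * e)%:E)%E.
Proof.
move=> s1 h0 e0 mD mF mG Goo He FE.
pose I : set T := `[0, h]%classic.
have mI : measurable I by exact: measurable_itv.
have muI : (mu I = h%:E)%E by rewrite lebesgue_measure_itv/= lte_fin h0 oppr0 adde0.
pose K (z : T * T) : \bar R := ((`|G (z.1 + s * z.2)%R - G z.1| `^ p)%R * \1_I z.2)%:E.
have mK : measurable_fun setT K.
  apply/measurable_EFinP; apply: measurable_funM; last first.
    by apply: measurableT_comp; [exact: measurable_indic|exact: measurable_snd].
  apply: (measurableT_comp (measurable_powR _)); apply: measurableT_comp => //.
  apply: measurable_funB; last by apply: measurableT_comp => //; exact: measurable_fst.
  apply: (measurableT_comp mG); apply: measurable_funD; first exact: measurable_fst.
  by apply: measurable_funM => //; exact: measurable_snd.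
have K0 z : (0 <= K z)%E by rewrite lee_fin mulr_ge0 ?powR_ge0.
have mGx x : measurable_fun [set: T] (fun t => G (x + s * t)).
  by apply: (measurableT_comp mG); apply: measurable_funD.
have intK x : (\int[mu]_t K (x, t) = pint p I (fun t => G (x + s * t) - G x)%R)%E.
  rewrite /pint [RHS]integral_mkcond; apply: eq_integral => t _.
  by rewrite /K /= /patch indicE; case: ifPn => _; rewrite ?mulr1 ?mulr0.
have c0 : 0 <= 2 `^ p * h^-1 by rewrite mulr_ge0 ?powR_ge0// invr_ge0 ltW.
have mKF : measurable_fun setT (fun x => \int[mu]_t K (x, t))%E.
  exact: measurable_fun_fubini_tonelli_F.
apply: (@le_trans _ _ (\int[mu]_(x in D) ((2 `^ p * h^-1)%:E * \int[mu]_t K (x, t)))%E).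
  apply: ae_ge0_le_integral => //.
  - by apply: measurable_fun_pint => //; exact: measurable_funS mF.
  - by move=> x _; rewrite mule_ge0 ?lee_fin ?integral_ge0.
  - by apply: measurable_funeM; exact: measurable_funS mKF.
  apply: filterS FE => x /[apply] ->; rewrite intK.
  have intG : mu.-integrable I (EFin \o (fun t => G (x + s * t))).
    apply: (@pint_integrable I (fun t => G (x + s * t)) mI); [by rewrite muI ltry|exact: mGx|].
    have := pint_affine p x s1 mG.
    by under eq_fun do rewrite addrC; move=> ->.
  have intc : mu.-integrable I (EFin \o cst (G x)).
    apply/integrableP; split; first exact/measurable_EFinP.
    rewrite /= integral_cst// [X in (_ * X)%E]muI.
    by rewrite lte_mul_pinfty ?ltry.
  have intk : mu.-integrable I (EFin \o (fun t => G (x + s * t) - G x)).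
    rewrite (_ : _ \o _ = (EFin \o (fun t => G (x + s * t)%R)) \- (EFin \o cst (G x)))%E//.
    exact: integrableB.
  have mk : measurable_fun I (fun t => G (x + s * t) - G x).
    by apply: measurable_funB => //; exact: measurable_funS (mGx x).
  have := powR_average_le h0 mk intk.
  rewrite RintegralB// Rintegral_cst// [fine _](congr1 fine muI) /= mulrBr.
  by rewrite [_ * (G x * h)]mulrCA mulVf ?gt_eqF// mulr1.
rewrite ge0_integralZl_EFin//; last 2 first.
- by move=> x _; exact: integral_ge0.
- exact: measurable_funS mKF.
apply: (@le_trans _ _ ((2 `^ p * h^-1)%:E * (\int[mu]_x \int[mu]_t K (x, t)))%E).
  by rewrite lee_wpmul2l//; apply: ge0_subset_integral => // x _; exact: integral_ge0.
rewrite fubini_tonelli//.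
apply: (@le_trans _ _ ((2 `^ p * h^-1)%:E * (\int[mu]_(t in I) e%:E))%E).
  rewrite lee_wpmul2l// [leRHS]integral_mkcond; apply: ge0_le_integral => //.
  - by move=> t _; exact: integral_ge0.
  - exact: measurable_fun_fubini_tonelli_G.
  - by apply/(measurable_restrictT _ _).1.
  - move=> t _; rewrite /patch; case: ifPn => tI.
      apply: le_trans (He t _); last by move: tI; rewrite inE /I /= in_itv.
      apply: ge0_le_integral => //.
      + exact: (measurableT_comp mK).
      + apply: measurable_fun_pint => //; apply: measurable_funB => //.
        exact: measurable_shift.
      + by move=> x _; rewrite /K /= indicE tI mulr1.
    rewrite integral0_eq// => x _; rewrite /K /= indicE.
    by rewrite (negbTE tI) mulr0.
rewrite integral_cst// [X in (_ * (_ * X))%E]muI -!EFinM lee_fin.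
by rewrite [e * h]mulrC mulrA divfK ?gt_eqF.
Qed.

End averages.

(** * Weak derivatives are almost everywhere derivatives of primitives *)

Section mollifier.
Context {R : realType}.
Local Notation mu := (@lebesgue_measure R).
Local Notation H := (@smooth_step R).
Local Notation rho := ((@smooth_step R)^`())%classic.
Implicit Types (a x : R).

Lemma is_derive_smooth_step x : is_derive x 1 H (rho x).
Proof.
rewrite derive1E; apply/derivableP; apply: (diff_upto_derivable (n := 0)).
exact: diff_upto_smooth_step.
Qed.

Lemma continuous_rho : continuous rho.
Proof.
move=> x; apply: differentiable_continuous; apply/derivable1_diffP.
by rewrite -derive1n1; exact/diff_upto_derivable/diff_upto_smooth_step.
Qed.

Lemma rho_eq0 x : 1 < `|x| -> rho x = 0.
Proof.
move=> x1; rewrite derive1E; have [x0|x0] := leP 0 x.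
  rewrite ger0_norm// in x1.
  rewrite (@near_eq_derive _ _ _ H (cst 1)) ?oner_neq0//; first exact: derive_cst.
  near=> y; apply: smooth_step_right; apply/ltW; near: y.
  exact: lt_nbhsr.
rewrite ltr0_norm// in x1.
rewrite (@near_eq_derive _ _ _ H (cst 0)) ?oner_neq0//; first exact: derive_cst.
near=> y; apply: smooth_step_left; apply/ltW; near: y.
by apply: lt_nbhsl; rewrite ltrNr.
Unshelve. all: by end_near. Qed.

Lemma rho_bounded : exists2 M, 0 < M & forall x, `|rho x| <= M.
Proof.
have ab : -1 <= 1 :> R by lra.
have [|c _ cP] := @EVT_max R (fun x => `|rho x|) _ _ ab.
  apply: continuous_subspaceT => x.
  by apply: (continuous_comp (@continuous_rho x)); exact: norm_continuous.
exists (`|rho c| + 1); first by rewrite ltr_wpDl.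
move=> x; have [x1|x1] := leP `|x| 1; last first.
  by rewrite rho_eq0// normr0 addr_ge0.
apply: (@le_trans _ _ `|rho c|); last by rewrite lerDl.
by apply: cP; rewrite in_itv /= -ler_norml.
Qed.

Lemma is_derive_smooth_step_affine a (e : R) x :
  is_derive x 1 (fun x => H (e^-1 * x + - (e^-1 * a))) (e^-1 * rho (e^-1 * (x - a))).
Proof.
have da : is_derive x 1 (fun x => e^-1 * x + - (e^-1 * a)) e^-1.
  move: (- _) => b; apply: is_derive_eq.
  by rewrite /GRing.scale /= !mulr1 ?addr0.
have dH := is_derive_smooth_step (e^-1 * x + - (e^-1 * a)).
have := @is_derive1_comp _ H (fun x => e^-1 * x + - (e^-1 * a)) x _ _ dH da.
by move/is_derive_eq; apply; rewrite mulrC mulrBr.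
Qed.

(** The derivative of a smooth step rescaled to [a - e, a + e]: its integral is 1 by the fundamental
    theorem of calculus, with no normalizing constant. *)
Definition mollifier a (e : R) x := e^-1 * rho (e^-1 * (x - a)).

Lemma continuous_mollifier a e : continuous (mollifier a e).
Proof.
move=> x; apply: cvgM; first exact: cvg_cst.
apply: (@cvg_comp _ _ _ (fun x => e^-1 * (x - a)) rho); last exact: continuous_rho.
by apply: cvgM; [exact: cvg_cst|apply: cvgB; [exact: cvg_id|exact: cvg_cst]].
Qed.

Lemma mollifier_eq0 a (e x : R) : 0 < e -> e < `|x - a| -> mollifier a e x = 0.
Proof.
move=> e0 ex; rewrite /mollifier rho_eq0 ?mulr0//.
by rewrite normrM gtr0_norm ?invr_gt0// mulrC ltr_pdivlMr// mul1r.
Qed.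

Lemma Rintegral_mollifier a (e : R) : 0 < e ->
  \int[mu]_(x in `[a - 2 * e, a + 2 * e]) mollifier a e x = 1.
Proof.
move=> e0; rewrite /Rintegral.
have ab : a - 2 * e < a + 2 * e by lra.
rewrite (@continuous_FTC2 _ (mollifier a e) (fun x => H (e^-1 * x + - (e^-1 * a))) _ _ ab).
- rewrite /= smooth_step_right; last first.
    by rewrite -mulrBr addrAC subrr add0r mulrCA mulVf ?gt_eqF//; lra.
  rewrite smooth_step_left ?subr0//.
  rewrite -mulrBr (_ : a - 2 * e - a = - (2 * e)); last ring.
  by rewrite mulrN mulrCA mulVf ?gt_eqF//; lra.
- exact/continuous_subspaceT/continuous_mollifier.
- have cH : continuous (fun x => H (e^-1 * x + - (e^-1 * a))).
    move=> x; apply: differentiable_continuous; apply/derivable1_diffP.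
    by have [] := is_derive_smooth_step_affine a e x.
  split; first by move=> x _; have [] := is_derive_smooth_step_affine a e x.
  + exact/cvg_at_right_filter/cH.
  + exact/cvg_at_left_filter/cH.
- move=> x _; rewrite derive1E.
  by rewrite (@derive_val _ _ _ _ _ _ _ (is_derive_smooth_step_affine a e x)).
Qed.

Lemma ballR_itv a (r : R) : ball a r = `]a - r, a + r[%classic :> set R.
Proof.
apply/seteqP; split => y; rewrite /ball /= in_itv /= distrC ltr_distl//.
Qed.

End mollifier.

(** * Mollification at Lebesgue points *)

Section lebesgue_points.
Context {R : realType}.
Local Notation mu := (@lebesgue_measure R).
Local Notation T := (measurableTypeR R).
Local Notation rho := ((@smooth_step R)^`())%classic.
Implicit Types (f : R -> R) (a e : R).

Lemma lebesgue_measure_cc_lty a b : (mu `[a, b] < +oo)%E.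
Proof.
by rewrite lebesgue_measure_itv /=; case: ifPn => _ //; rewrite -EFinD ltry.
Qed.

(** A Lebesgue point with the division cleared: the ball has measure 2 r, so the mean deviation has
    to be at most eta / 2. *)
Lemma lebesgue_pt_small f a (eta : R) : lebesgue_pt f a -> 0 < eta ->
  \forall r \near (0 : R)^'+,
    (\int[mu]_(y in ball a r) `|(f y - f a)%:E| <= (eta * r)%:E)%E.
Proof.
move=> /fine_cvgP[fin /cvgr0_norm_le] small eta0.
have eta20 : 0 < eta / 2 by rewrite divr_gt0.
have := small _ eta20.
apply: filter_app; move: fin; apply: filter_app; near=> r => fin /= small_r.
have r0 : 0 < r by near: r; exact: nbhs_right_gt.
have {small_r} : (davg f a r <= (eta / 2)%:E)%E.
  by rewrite -(fineK fin) lee_fin (le_trans (ler_norm _)).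
rewrite /davg /iavg lebesgue_measure_ball ?(ltW r0)//.
rewrite inver mulrn_eq0 /= gt_eqF// lee_pdivrMl ?mulrn_wgt0//.
have rE : (r *+ 2) * (eta / 2) = eta * r by rewrite -mulr_natr; field.
by rewrite -EFinM rE.
Unshelve. all: by end_near. Qed.

Lemma integrable_mulr (D : set T) f (g : R -> R) (M : R) : measurable D ->
  measurable_fun D g -> (forall x, D x -> `|g x| <= M) ->
  mu.-integrable D (EFin \o f) -> mu.-integrable D (EFin \o (fun x => f x * g x)).
Proof.
move=> mD mg gM intf; have mf : measurable_fun D f.
  by case/integrableP : intf => /measurable_EFinP.
apply: (le_integrable mD _ _ (integrableZl mD M intf)).
  by apply/measurable_EFinP; exact: measurable_funM.
move=> x Dx /=; rewrite lee_fin !normrM mulrC ler_wpM2r//.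
apply: (le_trans (gM x Dx)); exact: ler_norm.
Qed.

(** The kernel has integral 1 and size at most M / e, while the deviation of f is integrated over a
    ball of radius 3 e, so that the scale e cancels. The radii 2 e and 3 e leave room around the
    support and place a closed interval inside an open ball. *)
Lemma mollifier_approx f a (M eta e : R) : 0 < e -> 0 <= M ->
  (forall x, `|rho x| <= M) ->
  measurable_fun [set: T] f ->
  mu.-integrable `[a - 2 * e, a + 2 * e] (EFin \o f) ->
  (\int[mu]_(y in ball a (3 * e)) `|(f y - f a)%:E| <= (eta * (3 * e))%:E)%E ->
  `|\int[mu]_(x in `[a - 2 * e, a + 2 * e]) (f x * mollifier a e x) - f a| <=
  3 * M * eta.
Proof.
move=> e0 M0 rhoM mf intf small; set J : set T := `[_, _]%classic.
have mJ : measurable J by exact: measurable_itv.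
have Jfin : (mu J < +oo)%E by exact: lebesgue_measure_cc_lty.
have mmol : measurable_fun [set: T] (mollifier a e).
  by apply: continuous_measurable_fun; exact: continuous_mollifier.
have molM x : J x -> `|mollifier a e x| <= M / e.
  by move=> _; rewrite normrM gtr0_norm ?invr_gt0// mulrC ler_wpM2r// invr_ge0 ltW.
have intc : mu.-integrable J (EFin \o cst (f a)).
  apply: measurable_bounded_integrable => //.
  by exists `|f a|; split; rewrite ?num_real// => N /ltW NM x _.
have intmol (g : R -> R) : mu.-integrable J (EFin \o g) ->
    mu.-integrable J (EFin \o (fun x => g x * mollifier a e x)).
  by apply: (@integrable_mulr _ _ _ (M / e)) => //; exact: measurable_funS mmol.
have intfa : mu.-integrable J (EFin \o (fun x => f x - f a)).
  by rewrite (_ : _ \o _ = (EFin \o f) \- (EFin \o cst (f a)))%E//; exact: integrableB.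
have -> : f a = \int[mu]_(x in J) (f a * mollifier a e x).
  rewrite RintegralZl// ?Rintegral_mollifier ?mulr1//.
  have := intmol (cst 1); under eq_fun do rewrite /= mul1r.
  apply; apply: measurable_bounded_integrable => //.
  by exists 1; split; rewrite ?num_real// => N /ltW NM x _; rewrite /= normr1.
rewrite -RintegralB//; [|exact: intmol|exact: (intmol (cst (f a)))].
under eq_Rintegral do rewrite -mulrBl.
apply: (le_trans (le_normr_Rintegral mJ (intmol _ intfa))).
rewrite -lee_fin /Rintegral fineK; last first.
  by apply: integrable_fin_num => //; exact/integrable_norm/intmol.
apply: (@le_trans _ _ (\int[mu]_(x in J) ((M / e)%:E * `|(f x - f a)%:E|))%E).
  apply: ge0_le_integral => //.
  - apply/measurable_EFinP/measurableT_comp => //.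
    apply: measurable_funM; last exact: measurable_funS mmol.
    by apply: measurable_funB => //; exact: measurable_funS mf.
  - apply: measurable_funeM; apply: measurableT_comp => //; apply/measurable_EFinP.
    by apply: measurable_funB => //; exact: measurable_funS mf.
  - by move=> x Jx; rewrite -EFinM lee_fin normrM mulrC ler_wpM2r// molM.
have mfa : measurable_fun [set: T] (fun x => `|(f x - f a)%:E|%E).
  by apply: measurableT_comp => //; apply/measurable_EFinP; exact: measurable_funB.
rewrite ge0_integralZl_EFin//; last 2 first.
- by apply: measurable_funS mfa.
- by rewrite mulr_ge0// invr_ge0 ltW.
apply: (@le_trans _ _ ((M / e)%:E * (eta * (3 * e))%:E)%E); last first.
  have ME : M / e * (eta * (3 * e)) = 3 * M * eta by field; rewrite gt_eqF.
  by rewrite -EFinM ME.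
rewrite lee_wpmul2l ?lee_fin ?mulr_ge0 ?invr_ge0 ?(ltW e0)//.
apply: le_trans small; apply: ge0_subset_integral => //.
- exact: measurable_ball.
- exact: measurable_funS mfa.
- by move=> x; rewrite ballR_itv /J /= !in_itv /= => /andP[? ?]; apply/andP; split; lra.
Qed.

End lebesgue_points.

(** * Smooth approximations of the indicator of an interval *)

Section weak_derivative_lebesgue_points.
Context {R : realType}.
Local Notation mu := (@lebesgue_measure R).
Local Notation T := (measurableTypeR R).
Local Notation H := (@smooth_step R).
Implicit Types (f U V : R -> R) (a b e : R).

Lemma Rintegral_support (D D' : set T) f : D' `<=` D ->
  (forall x, D x -> ~ D' x -> f x = 0) ->
  \int[mu]_(x in D) f x = \int[mu]_(x in D') f x.
Proof.
move=> DD' f0; rewrite Rintegral_mkcond [RHS]Rintegral_mkcond; congr fine.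
apply: eq_integral => x _; congr EFin; rewrite /patch.
case: ifPn => xD; case: ifPn => xD' //.
- by apply: f0; [rewrite inE in xD|rewrite notin_setE in xD'].
- by move: xD'; rewrite inE => /DD'; rewrite notin_setE in xD.
Qed.

(** A step up at a minus a step up at b: its derivative is a difference of two mollifiers, which
    evaluates a function near a and near b. *)
Definition smooth_plateau a b e x : R :=
  H (e^-1 * x + - (e^-1 * a)) + - 1 * H (e^-1 * x + - (e^-1 * b)).

Lemma diff_upto_smooth_plateau a b e n : diff_upto n (smooth_plateau a b e).
Proof.
apply: diff_uptoD; first by apply: diff_upto_affine; exact: diff_upto_smooth_step.
apply: diff_uptoM; first exact: diff_upto_cst.
by apply: diff_upto_affine; exact: diff_upto_smooth_step.
Qed.

Lemma derive1_smooth_plateau a b e x :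
  ((smooth_plateau a b e)^`())%classic x = mollifier a e x - mollifier b e x.
Proof.
rewrite derive1E; have da := is_derive_smooth_step_affine a e x.
have db := is_derive_smooth_step_affine b e x.
have D : is_derive x 1 (smooth_plateau a b e) (mollifier a e x - mollifier b e x).
  have := is_deriveD da (is_deriveM (is_derive_cst (- 1 : R) x 1) db).
  by move/is_derive_eq; apply; rewrite /GRing.scale /= mulr0 addr0 mulN1r.
exact: (@derive_val _ _ _ _ _ _ _ D).
Qed.

Let smooth_step_affineE a e x :
  H (e^-1 * x + - (e^-1 * a)) = H (e^-1 * (x - a)).
Proof. by rewrite mulrBr. Qed.

Let smooth_step_affine_left a e x : 0 < e -> x <= a - e ->
  H (e^-1 * x + - (e^-1 * a)) = 0.
Proof.
move=> e0 xa; rewrite smooth_step_affineE smooth_step_left//.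
by rewrite ler_pdivrMl// mulrN1; lra.
Qed.

Let smooth_step_affine_right a e x : 0 < e -> a + e <= x ->
  H (e^-1 * x + - (e^-1 * a)) = 1.
Proof.
move=> e0 xa; rewrite smooth_step_affineE smooth_step_right//.
by rewrite ler_pdivlMl// mulr1; lra.
Qed.

Lemma smooth_plateau_eq0 a b e x : 0 < e -> a < b ->
  x <= a - e \/ b + e <= x -> smooth_plateau a b e x = 0.
Proof.
move=> e0 ab [xa|xb]; rewrite /smooth_plateau.
  by rewrite !smooth_step_affine_left//; [ring|lra].
by rewrite !smooth_step_affine_right//; [ring|lra].
Qed.

(** Both functions take values in [0, 1] and differ only in the transition zones around a and b,
    which are kept apart by 4 * e < b - a. *)
Lemma smooth_plateau_indic a b e x : 0 < e -> 4 * e < b - a ->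
  `|smooth_plateau a b e x - \1_`[a, b] x| <=
  \1_(ball a (3 * e)) x + \1_(ball b (3 * e)) x.
Proof.
move=> e0 eab.
have near_le c y : c - e < x -> x < c + e -> 0 <= y <= 1 ->
    `|y - \1_`[a, b] x| <= (\1_(ball c (3 * e)) x : R).
  move=> h1 h2 /andP[y0 y1]; rewrite [leRHS]indicE mem_set; last first.
    by rewrite ballR_itv /= in_itv /=; apply/andP; split; lra.
  by rewrite indicE ler_norml; case: (_ \in _) => /=; lra.
have [xa|xa] := leP x (a - e).
  rewrite smooth_plateau_eq0//; [|lra|by left].
  by rewrite sub0r normrN indicE memNset ?normr0 ?addr_ge0//= in_itv /=; lra.
have [xb|xb] := leP (b + e) x.
  rewrite smooth_plateau_eq0//; [|lra|by right].
  by rewrite sub0r normrN indicE memNset ?normr0 ?addr_ge0//= in_itv /=; lra.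
rewrite /smooth_plateau; have [xa2|xa2] := ltP x (a + e).
  rewrite (@smooth_step_affine_left b e x)//; last lra.
  rewrite mulr0 addr0 (le_trans (near_le a _ _ _ _))// ?lerDl//.
  by rewrite smooth_step_ge0 smooth_step_le1.
have [xb2|xb2] := ltP (b - e) x.
  rewrite (@smooth_step_affine_right a e x)//.
  rewrite (le_trans (near_le b _ _ _ _))// ?lerDr//.
  have := smooth_step_ge0 (e^-1 * x + - (e^-1 * b)).
  by have := smooth_step_le1 (e^-1 * x + - (e^-1 * b)); lra.
rewrite smooth_step_affine_right// smooth_step_affine_left//.
rewrite indicE mem_set /=; last by rewrite in_itv /=; apply/andP; split; lra.
by rewrite mulr0 addr0 subrr normr0 addr_ge0.
Qed.

Lemma test_function_smooth_plateau (i : interval R) a b e : 0 < e -> a < b ->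
  `[a - 2 * e, b + 2 * e] `<=` [set` i] ->
  test_function i (smooth_plateau a b e).
Proof.
move=> e0 ab abi; split.
  by move=> n x; apply: diff_upto_derivable; exact: diff_upto_smooth_plateau.
exists `[a - 2 * e, b + 2 * e]%classic; split => //; first exact: segment_compact.
move=> x xab; apply: smooth_plateau_eq0 => //.
have [xa|xa] := leP x (a - e); first by left.
right; rewrite leNgt; apply/negP => xb; apply: xab.
by rewrite /= in_itv /=; apply/andP; split; lra.
Qed.

Lemma integral_ball_norm_le f a (r eta : R) : 0 < r -> measurable_fun [set: T] f ->
  (\int[mu]_(y in ball a r) `|(f y - f a)%:E| <= (eta * r)%:E)%E ->
  (\int[mu]_(y in ball a r) `|(f y)%:E| <= ((eta + 2 * `|f a|) * r)%:E)%E.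
Proof.
move=> r0 mf small; have mB := measurable_ball (a : T) r.
have mfa : measurable_fun (ball a r : set T) (fun x => `|(f x - f a)%:E|%E).
  apply: measurableT_comp => //; apply/measurable_EFinP.
  by apply: measurable_funB => //; exact: measurable_funS mf.
apply: (@le_trans _ _ (\int[mu]_(y in ball a r) (`|(f y - f a)%:E| + `|f a|%:E))%E).
  apply: ge0_le_integral => //.
  - apply: measurableT_comp => //; apply/measurable_EFinP.
    exact: measurable_funS mf.
  - exact: emeasurable_funD.
  - move=> x _; rewrite -EFinD lee_fin -{1}(subrK (f a) (f x)).
    exact: ler_normD.
rewrite ge0_integralD// integral_cst// mulrDl EFinD leeD//.
rewrite [X in (_ * X)%E](lebesgue_measure_ball a (ltW r0)) -EFinM lee_fin.
by rewrite -mulr_natl; lra.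
Qed.

End weak_derivative_lebesgue_points.

(** * The fundamental theorem for weak derivatives, between Lebesgue points *)

Section du_bois_reymond.
Context {R : realType}.
Local Notation mu := (@lebesgue_measure R).
Local Notation T := (measurableTypeR R).
Implicit Types (U V : R -> R) (a b e : R).

Definition interval_integrable f :=
  measurable_fun [set: T] f /\ forall a b : R, mu.-integrable `[a, b] (EFin \o f).

Definition weak_derivative_on (i : interval R) U V := forall phi, test_function i phi ->
  \int[mu]_(x in [set` i]) (U x * (phi^`())%classic x) =
  - \int[mu]_(x in [set` i]) (V x * phi x).

Lemma measurable_patch d (Y : measurableType d) (D : set T) (f : T -> Y) :
  measurable D -> measurable_fun [set: T] f -> measurable_fun [set: T] (f \_ D).
Proof.
move=> mD mf; apply/(measurable_restrictT _ mD).
exact: (@measurable_funS _ _ _ _ setT _ _ measurableT _ mf).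
Qed.

Lemma subset_itv_ccS (a a' b b' : R) : a' <= a -> b <= b' ->
  (`[a, b] `<=` `[a', b'])%classic.
Proof.
move=> aa bb x; rewrite /= !in_itv /= => /andP[ax xb].
by rewrite (le_trans aa) ?(le_trans xb).
Qed.

Lemma smooth_plateau_norm_le1 a b e x : `|smooth_plateau a b e x| <= 1.
Proof.
rewrite /smooth_plateau ler_norml.
have := smooth_step_ge0 (e^-1 * x + - (e^-1 * b)).
have := smooth_step_le1 (e^-1 * x + - (e^-1 * b)).
have := smooth_step_ge0 (e^-1 * x + - (e^-1 * a)).
have := smooth_step_le1 (e^-1 * x + - (e^-1 * a)).
move: (smooth_step _) (smooth_step _) => y z *.
by apply/andP; split; lra.
Qed.

Let telescope_bound (A B C I u v X Y : R) :
  `|A - u| <= X -> `|B - v| <= X -> `|C - I| <= Y -> A - B = - C ->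
  `|v - u - I| <= 2 * X + Y.
Proof.
rewrite !ler_norml => /andP[A1 A2] /andP[B1 B2] /andP[C1 C2] ABC.
by apply/andP; split; lra.
Qed.

(** Tested against a smoothed indicator of [[a, b]], U contributes U a - U b up to 3 * M * eta at
    each end. On the side of V, replacing the indicator costs the integral of |V| over the two
    transition zones, which is of order e because a and b are Lebesgue points of V. *)
Let weak_derivative_lebesgue_pt_bound (i : interval R) U V a b (M eta e : R) :
  (forall x, `|((@smooth_step R)^`())%classic x| <= M) ->
  interval_integrable U -> interval_integrable V -> weak_derivative_on i U V ->
  0 < e -> 4 * e < b - a -> `[a - 2 * e, b + 2 * e] `<=` [set` i] ->
  (\int[mu]_(y in ball a (3 * e)) `|(U y - U a)%:E| <= (eta * (3 * e))%:E)%E ->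
  (\int[mu]_(y in ball b (3 * e)) `|(U y - U b)%:E| <= (eta * (3 * e))%:E)%E ->
  (\int[mu]_(y in ball a (3 * e)) `|(V y - V a)%:E| <= (eta * (3 * e))%:E)%E ->
  (\int[mu]_(y in ball b (3 * e)) `|(V y - V b)%:E| <= (eta * (3 * e))%:E)%E ->
  `|U b - U a - \int[mu]_(x in `[a, b]) V x| <=
    6 * M * eta + (2 * eta + 2 * (`|V a| + `|V b|)) * (3 * e).
Proof.
move=> rhoM [mU intU] [mV intV] UV e0 eab Ji Ua Ub Va Vb.
have ab : a < b by lra.
have M0 : 0 <= M by exact: le_trans (rhoM 0).
have subJa : (`[a - 2 * e, a + 2 * e] `<=` `[a - 2 * e, b + 2 * e])%classic.
  by apply: subset_itv_ccS; clear -e0 ab; lra.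
have subJb : (`[b - 2 * e, b + 2 * e] `<=` `[a - 2 * e, b + 2 * e])%classic.
  by apply: subset_itv_ccS; clear -e0 ab; lra.
have subJ : (`[a, b] `<=` `[a - 2 * e, b + 2 * e])%classic.
  by apply: subset_itv_ccS; clear -e0 ab; lra.
pose J : set T := `[a - 2 * e, b + 2 * e]%classic.
have mJ : measurable J by exact: measurable_itv.
pose phi := smooth_plateau a b e.
have mphi : measurable_fun [set: T] phi.
  apply: continuous_measurable_fun => x; apply: differentiable_continuous.
  apply/derivable1_diffP; rewrite -[phi]derive1n0.
  exact/diff_upto_derivable/diff_upto_smooth_plateau.
have mmol c : measurable_fun [set: T] (mollifier c e).
  by apply: continuous_measurable_fun; exact: continuous_mollifier.
have molM c x : `|mollifier c e x| <= M / e.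
  by rewrite normrM gtr0_norm ?invr_gt0// mulrC ler_wpM2r// invr_ge0 ltW.
have intUmol c : mu.-integrable J (EFin \o (fun x => U x * mollifier c e x)).
  apply: (@integrable_mulr _ J U _ (M / e)) => //; first exact: measurable_funS (mmol c).
  exact: intU.
have LHS : \int[mu]_(x in [set` i]) (U x * (phi^`())%classic x) =
    \int[mu]_(x in `[a - 2 * e, a + 2 * e]) (U x * mollifier a e x) -
    \int[mu]_(x in `[b - 2 * e, b + 2 * e]) (U x * mollifier b e x).
  under eq_Rintegral do rewrite derive1_smooth_plateau.
  have mol0 c x : ~ `[c - 2 * e, c + 2 * e]%classic x -> mollifier c e x = 0.
    move=> xc; apply: mollifier_eq0 => //; rewrite ltNge; apply/negP => xce; apply: xc.
    rewrite /= in_itv /=; move: xce; rewrite ler_distl => /andP[? ?].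
    by apply/andP; split; lra.
  rewrite (@Rintegral_support _ _ J); [|exact: Ji|]; last first.
    move=> x _ Jx; rewrite !mol0 ?subrr ?mulr0//; first by move=> /subJb.
    by move=> /subJa.
  under eq_Rintegral do rewrite mulrBr.
  rewrite RintegralB//; congr (_ - _); apply: Rintegral_support.
  - exact: subJa.
  - by move=> x _ /mol0 ->; rewrite mulr0.
  - exact: subJb.
  - by move=> x _ /mol0 ->; rewrite mulr0.
have intVphi : mu.-integrable J (EFin \o (fun x => V x * phi x)).
  apply: (@integrable_mulr _ J V _ 1) => //; first exact: measurable_funS mphi.
    by move=> x _; exact: smooth_plateau_norm_le1.
  exact: intV.
have intVind : mu.-integrable J (EFin \o (fun x => V x * \1_`[a, b] x)).
  apply: (@integrable_mulr _ J V _ 1) => //; last exact: intV.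
  move=> x _; rewrite indicE; case: (_ \in _) => /=; by rewrite ?normr1 ?normr0.
have RHS : `|\int[mu]_(x in [set` i]) (V x * phi x) - \int[mu]_(x in `[a, b]) V x| <=
    (2 * eta + 2 * (`|V a| + `|V b|)) * (3 * e).
  have -> : \int[mu]_(x in `[a, b]) V x = \int[mu]_(x in J) (V x * \1_`[a, b] x).
    rewrite [RHS](@Rintegral_support _ J `[a, b]%classic).
    - by apply: eq_Rintegral => x xab; rewrite indicE xab mulr1.
    - exact: subJ.
    - by move=> x _ xab; rewrite indicE memNset// mulr0.
  rewrite (@Rintegral_support _ [set` i] J); [|exact: Ji|]; last first.
    move=> x _ Jx; rewrite /phi smooth_plateau_eq0 ?mulr0//.
    have [xa|xa] := leP x (a - e); first by left.
    right; rewrite leNgt; apply/negP => xb; apply: Jx.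
    by rewrite /J /= in_itv /=; apply/andP; split; clear -xa xb e0; lra.
  rewrite -RintegralB//; under eq_Rintegral do rewrite -mulrBr.
  have intd : mu.-integrable J (EFin \o (fun x => V x * (phi x - \1_`[a, b] x))).
    rewrite (_ : _ \o _ = (fun x => (V x * phi x)%:E - (V x * \1_`[a, b] x)%:E)%E).
      exact: integrableB.
    by apply/funext => x; rewrite /= mulrBr.
  apply: (le_trans (le_normr_Rintegral mJ intd)).
  rewrite -lee_fin /Rintegral fineK; last first.
    by apply: integrable_fin_num => //; exact: integrable_norm.
  have e30 : 0 < 3 * e by rewrite mulr_gt0.
  pose Bl (c : R) : set T := ball c (3 * e).
  pose Vn : T -> \bar R := fun x => `|(V x)%:E|%E.
  have mVn : measurable_fun [set: T] Vn.
    by apply: measurableT_comp => //; exact/measurable_EFinP.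
  have mB c : measurable (Bl c) by exact: measurable_ball.
  have mpatch c : measurable_fun [set: T] (Vn \_ (Bl c)).
    exact: measurable_patch.
  have patch_ge0 c x : (0 <= (Vn \_ (Bl c)) x)%E.
    by rewrite /patch; case: ifPn => // _; exact: abse_ge0.
  apply: (@le_trans _ _ (\int[mu]_x ((Vn \_ (Bl a)) x + (Vn \_ (Bl b)) x))%E).
    rewrite [leLHS]integral_mkcond; apply: ge0_le_integral => //.
    - by move=> x _; rewrite /patch; case: ifPn => // _; rewrite lee_fin.
    - apply: measurable_patch => //; apply/measurable_EFinP.
      apply: measurableT_comp => //; apply: measurable_funM => //.
      exact: measurable_funB.
    - exact: emeasurable_funD.
    - move=> x _; rewrite [leLHS]/patch; case: ifPn => _; last exact: adde_ge0.
      have := smooth_plateau_indic x e0 eab; rewrite !indicE /patch -/phi normrM => phix.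
      have {phix} := ler_wpM2l (normr_ge0 (V x)) phix.
      rewrite -lee_fin => /le_trans; apply; rewrite mulrDr EFinD.
      by apply: leeD; case: ifPn => _; rewrite ?mulr1 ?mulr0.
  rewrite ge0_integralD// -!integral_mkcond.
  have := integral_ball_norm_le e30 mV Va; have := integral_ball_norm_le e30 mV Vb.
  move=> HVb HVa; apply: (le_trans (leeD HVa HVb)); rewrite -EFinD lee_fin.
  by move: (`|V a|) (`|V b|) => y z; clear; lra.
have e20 : 0 < 2 * e by rewrite mulr_gt0.
have Ja : mu.-integrable `[a - 2 * e, a + 2 * e] (EFin \o U) by exact: intU.
have Jb : mu.-integrable `[b - 2 * e, b + 2 * e] (EFin \o U) by exact: intU.
have Ea := mollifier_approx e0 M0 rhoM mU Ja Ua.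
have Eb := mollifier_approx e0 M0 rhoM mU Jb Ub.
have tphi : test_function i phi by exact: test_function_smooth_plateau.
have -> : 6 * M * eta = 2 * (3 * M * eta) by ring.
apply: (telescope_bound Ea Eb RHS); rewrite -LHS; exact: UV.
Qed.

Lemma weak_derivative_lebesgue_pt (i : interval R) U V a b (d : R) :
  interval_integrable U -> interval_integrable V -> weak_derivative_on i U V ->
  a < b -> 0 < d -> `[a - d, b + d] `<=` [set` i] ->
  lebesgue_pt U a -> lebesgue_pt U b -> lebesgue_pt V a -> lebesgue_pt V b ->
  U b - U a = \int[mu]_(x in `[a, b]) V x.
Proof.
move=> intU intV UV ab d0 abi Ua Ub Va Vb; have [M M0 rhoM] := @rho_bounded R.
apply/eqP; rewrite -subr_eq0 -normr_le0; apply/ler_addgt0Pl => k k0; rewrite addr0.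
(* The error at radius r = 3 * e is 6 * M * eta + (2 * eta + 2 * W) * r with W = |V a| + |V b|.
   Since r < 1 and W * r <= eta, it is at most (6 * M + 2 + 2) * eta. *)
pose N := 6 * M + 2 + 2; have N0 : 0 < N by rewrite /N; lra.
pose eta := k / N; have eta0 : 0 < eta by rewrite divr_gt0.
pose S := `|V a| + `|V b| + 1; have S0 : 0 < S by rewrite ltr_wpDl// addr_ge0.
near (0 : R)^'+ => r.
have r0 : 0 < r by near: r; exact: nbhs_right_gt.
have rd : r < d by near: r; exact: nbhs_right_lt.
have rab : r < (b - a) / 2 by near: r; apply: nbhs_right_lt; rewrite divr_gt0// subr_gt0.
have r1 : r < 1 by near: r; exact: nbhs_right_lt.
have rS : r < eta / S by near: r; apply: nbhs_right_lt; rewrite divr_gt0.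
pose e := r / 3; have e0 : 0 < e by rewrite divr_gt0.
have e4 : 4 * e < b - a by rewrite /e; clear -rab r0; lra.
have esub : (`[a - 2 * e, b + 2 * e] `<=` `[a - d, b + d])%classic.
  by apply: subset_itv_ccS; rewrite /e; clear -rd r0; lra.
have rE : r = 3 * e by rewrite /e mulrCA divff ?mulr1// pnatr_eq0.
have := @weak_derivative_lebesgue_pt_bound i U V a b M eta e rhoM intU intV UV e0.
rewrite -rE => H.
apply: (le_trans (H _ _ _ _ _ _)) => //.
- exact: subset_trans abi.
- by near: r; exact: lebesgue_pt_small.
- by near: r; exact: lebesgue_pt_small.
- by near: r; exact: lebesgue_pt_small.
- by near: r; exact: lebesgue_pt_small.
rewrite ltr_pdivlMr// in rS.
have -> : k = eta * N by rewrite /eta divfK// gt_eqF.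
set W := `|V a| + `|V b|.
have etar : eta * r <= eta by rewrite ler_piMr ?(ltW eta0) ?(ltW r1).
have Wr : W * r <= eta.
  by apply: le_trans (ltW rS); rewrite mulrC ler_wpM2l ?(ltW r0)// lerDl.
have -> : eta * N = 6 * M * eta + 2 * eta + 2 * eta by rewrite /N; ring.
have -> : (2 * eta + 2 * W) * r = 2 * (eta * r) + 2 * (W * r) by ring.
by rewrite addrA !lerD// ler_wpM2l.
Unshelve. all: by end_near. Qed.

End du_bois_reymond.

(** * Weakly differentiable functions as primitives *)

Section primitives.
Context {R : realType}.
Local Notation mu := (@lebesgue_measure R).
Local Notation T := (measurableTypeR R).
Implicit Types (f U V : R -> R) (a b x y : R).

Lemma lebesgue_aeS (P S : R -> Prop) : (forall x, P x -> S x) ->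
  {ae mu, forall x, P x} -> {ae mu, forall x, S x}.
Proof. by move=> PS; exact: (@filterS _ _ (ae_filter_ringOfSetsType mu)). Qed.

Lemma lebesgue_ae2 (P Q S : R -> Prop) : (forall x, P x -> Q x -> S x) ->
  {ae mu, forall x, P x} -> {ae mu, forall x, Q x} -> {ae mu, forall x, S x}.
Proof. by move=> PQS; exact: (@filterS2 _ _ (ae_filter_ringOfSetsType mu)). Qed.

(** A nonempty open set contains a ball, which has positive measure and so does not lie in a null
    set. *)
Lemma ae_open (O : set R) (P : R -> Prop) : open O -> O !=set0 ->
  {ae mu, forall x, P x} -> exists2 x, O x & P x.
Proof.
move=> oO [x Ox] [N [mN N0 PN]]; apply: contrapT => noP.
have /nbhs_ballP[r /= r0 rO] : nbhs x O by exact: open_nbhs_nbhs.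
have rN : (ball x r : set T) `<=` N.
  by move=> y /rO Oy; apply: PN => Py; apply: noP; exists y.
have mB : measurable (ball x r : set T) by exact: measurable_ball.
have : (mu (ball x r) <= 0)%E by rewrite -N0; apply: le_measure; rewrite ?inE.
by rewrite lebesgue_measure_ball ?(ltW r0)// lee_fin leNgt mulrn_wgt0.
Qed.

(** Makes [trace] independent of the representative picked by [xget], end points included: a nonzero
    difference would persist on a nonempty open part of O. *)
Lemma within_continuous_ae_eq (O : set R) f g : open O ->
  {within closure O, continuous f} -> {within closure O, continuous g} ->
  {ae mu, forall x, O x -> f x = g x} -> forall x, closure O x -> f x = g x.
Proof.
move=> oO cf cg fg x Ox; apply: contrapT => /eqP fgx.
have /= cfg : (f y - g y) @[y --> within (closure O) (nbhs x)] --> f x - g x.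
  apply: cvgB.
  - by have /subspace_continuousP/(_ x Ox) := cf.
  - by have /subspace_continuousP/(_ x Ox) := cg.
have fgx0 : f x - g x != 0 by rewrite subr_eq0.
have : \forall y \near within (closure O) (nbhs x), f y - g y != 0.
  exact: cvgr_neq0 cfg fgx0.
rewrite near_withinE => /nbhs_ballP[r /= r0 rP].
have Oball : O `&` ball x r !=set0 by apply: Ox; exact: nbhsx_ballx.
have oOball : open (O `&` ball x r) by apply: openI => //; exact: ball_open.
have [z [Oz xz] fgz] := ae_open oOball Oball fg.
have := rP z xz (subset_closure Oz).
by rewrite fgz// subrr eqxx.
Qed.

Lemma Rintegral_chasles f x y : interval_integrable f -> 0 <= x -> x <= y ->
  \int[mu]_(t in `[0, y]) f t - \int[mu]_(t in `[0, x]) f t =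
  \int[mu]_(t in `[x, y]) f t.
Proof.
move=> [_ intf] x0 xy; rewrite (@Rintegral_itvB _ f (BLeft 0) (BRight y)) ?bnd_simp//.
apply: Rintegral_itv_obnd_cbnd; apply: integrableS (intf x y) => //.
by apply: subset_itvr; rewrite bnd_simp.
Qed.

Lemma primitive_continuous f (C : R) : interval_integrable f ->
  {within `[0, +oo[, continuous (fun x => C + \int[mu]_(t in `[0, x]) f t)}.
Proof.
move=> [_ intf]; apply/continuous_within_itvcyP.
have cI b : 0 < b -> {within `[0, b], continuous (fun x => C + \int[mu]_(t in `[0, x]) f t)}.
  move=> b0 x; apply: cvgD; first exact: cvg_cst.
  exact: (@parameterized_integral_continuous R 0 b f (ltW b0) (intf 0 b) x).
split.
- move=> x; rewrite in_itv /= andbT => x0.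
  have x10 : 0 < x + 1 by rewrite addr_gt0.
  have /(continuous_within_itvP _ x10)[+ _ _] := cI _ x10.
  by apply; rewrite in_itv /= x0 ltrDl ltr01.
- by have /(continuous_within_itvP _ (@ltr01 R))[_ + _] := cI 1 ltr01.
Qed.

(** Describes both spatial domains by their right bound, so that the components of u, v and w share
    the same lemmas. *)
Definition unit_or_halfline (b : itv_bound R) := b = BLeft 1 \/ b = +oo%O.

Variable b : itv_bound R.
Hypothesis b_eq : unit_or_halfline b.
Local Notation i := (Interval (BRight 0) b).

Lemma unit_or_halfline_open : open [set` i].
Proof. by case: b_eq => ->; exact: interval_open. Qed.

Lemma unit_or_halfline_nonempty : [set` i] !=set0.
Proof. by exists (1 / 2); case: b_eq => ->; rewrite /= in_itv /=; lra. Qed.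

Lemma unit_or_halfline_gt0 x : [set` i] x -> 0 < x.
Proof. by rewrite /= in_itv /= => /andP[]. Qed.

Lemma unit_or_halfline_margin x y : [set` i] x -> [set` i] y ->
  exists2 d : R, 0 < d & `[x - d, y + d] `<=` [set` i].
Proof.
case: b_eq => -> /=; rewrite !in_itv /= => /andP[x0 x1] /andP[y0 y1].
- have [xy|xy] := leP (x / 2) ((1 - y) / 2).
    exists (x / 2); first by rewrite divr_gt0.
    by move=> z; rewrite /= !in_itv /= => /andP[? ?]; apply/andP; split; lra.
  exists ((1 - y) / 2); first by rewrite divr_gt0// subr_gt0.
  by move=> z; rewrite /= !in_itv /= => /andP[? ?]; apply/andP; split; lra.
- exists (x / 2); first by rewrite divr_gt0.
  by move=> z; rewrite /= !in_itv /= => /andP[? ?]; rewrite andbT; lra.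
Qed.

Lemma interval_integrable_locally f : interval_integrable f ->
  locally_integrable [set: R] f.
Proof.
move=> [mf intf]; split => //; first exact: openT.
move=> K _ cK; have [M [_ KM]] := compact_bounded cK.
have KI : K `<=` `[- (`|M| + 1), `|M| + 1].
  move=> x Kx; rewrite /= in_itv /= -ler_norml; apply: KM => //.
  by rewrite (le_lt_trans (ler_norm M))// ltrDl.
have mK : measurable (K : set T) by exact: compact_measurable.
have /integrableP[_] := intf (- (`|M| + 1)) (`|M| + 1).
apply: le_lt_trans; apply: ge0_subset_integral => //.
by do 2 apply: measurableT_comp => //; exact: measurable_funS mf.
Qed.

(** Almost every point is a Lebesgue point of both U and V; a single one, x0, determines the
    constant. *)
Lemma weak_derivative_primitive U V :
  interval_integrable U -> interval_integrable V -> weak_derivative_on i U V ->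
  exists C : R, {ae mu, forall x, [set` i] x ->
    U x = C + \int[mu]_(t in `[0, x]) V t}.
Proof.
move=> intU intV UV.
have aeU := lebesgue_differentiation (interval_integrable_locally intU).
have aeV := lebesgue_differentiation (interval_integrable_locally intV).
have aeUV : {ae mu, forall x, lebesgue_pt U x /\ lebesgue_pt V x}.
  by apply: lebesgue_ae2 aeU aeV => x.
have [x0 ix0 [Ux0 Vx0]] := ae_open unit_or_halfline_open unit_or_halfline_nonempty aeUV.
exists (U x0 - \int[mu]_(t in `[0, x0]) V t).
apply: lebesgue_aeS aeUV => x [Ux Vx] ix.
have [x00 x_0] := (unit_or_halfline_gt0 ix0, unit_or_halfline_gt0 ix).
have [xx0|xx0|->] := ltgtP x x0; last by rewrite subrK.
- have [d d0 dI] := unit_or_halfline_margin ix ix0.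
  have := weak_derivative_lebesgue_pt intU intV UV xx0 d0 dI Ux Ux0 Vx Vx0.
  rewrite -(Rintegral_chasles intV (ltW x_0) (ltW xx0)).
  by move: (Rintegral _ _ _) (Rintegral _ _ _) => A B; lra.
- have [d d0 dI] := unit_or_halfline_margin ix0 ix.
  have := weak_derivative_lebesgue_pt intU intV UV xx0 d0 dI Ux0 Ux Vx0 Vx.
  rewrite -(Rintegral_chasles intV (ltW x00) (ltW xx0)).
  by move: (Rintegral _ _ _) (Rintegral _ _ _) => A B; lra.
Qed.

End primitives.

(** * Limits of difference quotients *)

Section difference_quotients.
Context {R : realType}.
Local Notation mu := (@lebesgue_measure R).
Local Notation T := (measurableTypeR R).
Implicit Types (f g U E phi : R -> R) (x y : R).

Lemma derivable1_continuous f : (forall x, derivable f x 1) -> continuous f.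
Proof.
by move=> df x; apply: differentiable_continuous; exact/derivable1_diffP.
Qed.

Lemma derive1_lipschitz f (M : R) : (forall x, derivable f x 1) ->
  (forall x, `|(f^`())%classic x| <= M) -> forall x y, `|f y - f x| <= M * `|y - x|.
Proof.
move=> df fM; suff H x y : x <= y -> `|f y - f x| <= M * `|y - x|.
  by move=> x y; have [/H//|/ltW/H] := leP x y; rewrite distrC (distrC x).
move=> xy; have [||c _ ->] := @MVT_segment R f (f^`())%classic x y xy.
- by move=> z _; rewrite derive1E; exact/derivableP.
- exact/continuous_subspaceT/derivable1_continuous.
- by rewrite normrM ler_wpM2r.
Qed.

(** The mean value theorem is used for f and then for its derivative; accepting M instead of M / 2
    avoids a second-order expansion. *)
Lemma derive1_taylor f (M : R) : (forall x, derivable f x 1) ->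
  (forall x, derivable (f^`())%classic x 1) ->
  (forall x, `|(f^`(2))%classic x| <= M) ->
  forall x y, `|f y - f x - (y - x) * (f^`())%classic x| <= M * `|y - x| ^+ 2.
Proof.
move=> df df1 f2M x y; have M0 : 0 <= M by exact: le_trans (f2M 0).
have lip := derive1_lipschitz df1 f2M.
have key c : `|c - x| <= `|y - x| ->
    f y - f x = (f^`())%classic c * (y - x) ->
    `|f y - f x - (y - x) * (f^`())%classic x| <= M * `|y - x| ^+ 2.
  move=> cx ->; rewrite [_ * (y - x)]mulrC -mulrBr normrM mulrC.
  rewrite expr2 mulrA ler_wpM2r//; apply: (le_trans (lip _ _)).
  exact: ler_wpM2l.
have cf : forall A : set R, {within A, continuous f}.
  by move=> A; exact/continuous_subspaceT/derivable1_continuous.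
have df' (z : R) : is_derive z 1 f ((f^`())%classic z).
  by rewrite derive1E; exact/derivableP.
have [xy|yx] := leP x y.
- have [c] := @MVT_segment R f (f^`())%classic x y xy (fun z _ => df' z) (cf _).
  rewrite in_itv /= => /andP[xc cy] fE.
  apply: key fE.
  by rewrite !ger0_norm ?subr_ge0// lerD2r.
- have [c] := @MVT_segment R f (f^`())%classic y x (ltW yx) (fun z _ => df' z) (cf _).
  rewrite in_itv /= => /andP[yc cx] fE.
  apply: (key c).
    by rewrite !ler0_norm ?subr_le0// ?(ltW yx)// lerN2 lerD2r.
  by rewrite -[LHS]opprB fE -mulrN opprB.
Qed.

Lemma continuous_support_bounded f (K : set R) : continuous f -> compact K ->
  (forall x, ~ K x -> f x = 0) -> exists2 M, 0 <= M & forall x, `|f x| <= M.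
Proof.
move=> cf cK f0.
have [N [_ NP]] := compact_bounded (continuous_compact (continuous_subspaceT cf) cK).
exists (`|N| + 1) => [|x]; first by rewrite addr_ge0.
have [Kx|/f0 ->] := pselect (K x); last by rewrite normr0 addr_ge0.
by apply: NP; [rewrite (le_lt_trans (ler_norm _))// ltrDl|exists x].
Qed.

Lemma derive1_support f (K : set R) : closed K -> (forall x, ~ K x -> f x = 0) ->
  forall x, ~ K x -> (f^`())%classic x = 0.
Proof.
move=> cK f0 x Kx; rewrite derive1E (@near_eq_derive _ _ _ f (cst 0)) ?oner_neq0//.
  exact: derive_cst.
have : nbhs x (~` K) by apply: open_nbhs_nbhs; split => //; exact: closed_openC.
by apply: filterS => y /= /f0.
Qed.

Lemma integrable_support f g (B M : R) : interval_integrable f ->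
  measurable_fun [set: T] g -> (forall x, `|g x| <= M) ->
  (forall x, B < `|x| -> g x = 0) ->
  mu.-integrable [set: T] (EFin \o (fun x => f x * g x)).
Proof.
move=> [mf intf] mg gM g0; pose J : set T := `[- B, B]%classic.
have mJ : measurable J by exact: measurable_itv.
pose fg : T -> \bar R := EFin \o (fun x => f x * g x).
have intJ : mu.-integrable J fg.
  apply: (@integrable_mulr _ J f g M) => //; last exact: intf.
  exact: measurable_funS mg.
have := (integrable_mkcond fg mJ).1 intJ.
rewrite (_ : _ \_ J = fg)//.
apply/funext => x; rewrite /patch; case: ifPn => //.
rewrite notin_setE /J /= in_itv /= -ler_norml => /negP; rewrite -ltNge => /g0 gx0.
by rewrite /fg /= gx0 mulr0.
Qed.

End difference_quotients.

(** * Limits of difference quotients are weak derivatives *)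

Section difference_quotient_limit.
Context {R : realType}.
Local Notation mu := (@lebesgue_measure R).
Local Notation T := (measurableTypeR R).
Implicit Types (f g U E a phi : R -> R) (x y : R).
Variable p : R.
Hypothesis p1 : 1 <= p.

Lemma integrable_realB (D : set T) f g : measurable D -> mu.-integrable D (EFin \o f) ->
  mu.-integrable D (EFin \o g) -> mu.-integrable D (EFin \o (fun x => f x - g x)).
Proof.
move=> mD intf intg.
rewrite (_ : _ \o _ = (fun x => (f x)%:E - (g x)%:E)%E)//.
exact: integrableB.
Qed.

Definition in_Lp f := measurable_fun [set: T] f /\ (pint p setT f < +oo)%E.

Lemma in_Lp_interval_integrable f : in_Lp f -> interval_integrable f.
Proof.
move=> [mf foo]; split => // c d; apply: (pint_integrable p1) => //.
exact: lebesgue_measure_cc_lty.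
Qed.

Lemma in_Lp_affine f (s c : R) : `|s| = 1 -> in_Lp f -> in_Lp (fun x => f (s * x + c)).
Proof.
move=> s1 [mf foo]; split; last by rewrite pint_affine.
exact: (measurableT_comp mf (@measurable_affine R s c)).
Qed.

Lemma in_LpD f g : in_Lp f -> in_Lp g -> in_Lp (fun x => f x + g x).
Proof.
move=> [mf foo] [mg goo]; split; first exact: measurable_funD.
apply: le_lt_trans (pintD p1 measurableT mf mg) _.
move: (pint _ _ _) (pint _ _ _) foo goo => A B Aoo Boo.
by rewrite lte_mul_pinfty ?lee_fin ?powR_ge0// lte_add_pinfty.
Qed.

Lemma in_LpZ f (c : R) : in_Lp f -> in_Lp (fun x => c * f x).
Proof.
move=> [mf foo]; split; first exact: measurable_funM.
by rewrite pintZ// lte_mul_pinfty ?lee_fin ?powR_ge0.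
Qed.

Lemma in_Lp_shift f (c : R) : in_Lp f -> in_Lp (fun x => f (x + c)).
Proof.
move=> /(@in_Lp_affine f 1 c (normr1 _)).
by under eq_fun do rewrite mul1r.
Qed.

Lemma in_LpB f g : in_Lp f -> in_Lp g -> in_Lp (fun x => f x - g x).
Proof.
move=> Lf /(@in_LpZ _ (-1)) Lg; have := in_LpD Lf Lg.
by under eq_fun do rewrite mulN1r.
Qed.

Lemma le_normr_Rintegral_support (A : set T) f g (N : R) : measurable A ->
  measurable_fun [set: T] f -> measurable_fun [set: T] g ->
  mu.-integrable [set: T] (EFin \o (fun x => f x * g x)) ->
  (forall x, ~ A x -> g x = 0) -> (forall x, `|g x| <= N) ->
  (`|\int[mu]_x (f x * g x)|%:E <= N%:E * \int[mu]_(x in A) `|(f x)%:E|)%E.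
Proof.
move=> mA mf mg ifg g0 gN; have N0 : 0 <= N by exact: le_trans (gN 0).
apply: (@le_trans _ _ (\int[mu]_x `|f x * g x|)%:E).
  by rewrite lee_fin; exact: le_normr_Rintegral.
rewrite /Rintegral fineK; last first.
  by apply: integrable_fin_num => //; exact: integrable_norm ifg.
pose fA : T -> \bar R := (fun x => `|(f x)%:E|%E) \_ A.
have mfA : measurable_fun [set: T] fA.
  by apply: measurable_patch => //; apply: measurableT_comp => //; exact/measurable_EFinP.
have fA0 x : (0 <= fA x)%E by rewrite /fA /patch; case: ifPn => // _; exact: abse_ge0.
rewrite [X in (_ * X)%E]integral_mkcond -ge0_integralZl_EFin//.
apply: ge0_le_integral => //.
- by apply/measurable_EFinP/measurableT_comp => //; exact: measurable_funM.
- exact: measurable_funeM.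
- move=> x _; rewrite /fA /patch; case: ifPn => xA.
    by rewrite -EFinM lee_fin normrM mulrC ler_wpM2r.
  by rewrite g0 ?mulr0 ?normr0 ?mule0//; rewrite notin_setE in xA.
Qed.

(** Keeps the translated support of a test function inside the interval for small h. *)
Lemma nbhs_right_compact (O K : set R) (s : R) : open O -> compact K -> K `<=` O ->
  \forall h \near (0 : R)^'+, forall x, K x -> O (x + s * h).
Proof.
move=> oO /compact_near_coveringP cK KO.
apply: (cK R ((0 : R)^'+) (fun h x => O (x + s * h)) _) => x Kx.
have : (fun z : R * R => z.1 + s * z.2) z @[z --> (x, 0 : R)] --> x.
  rewrite -[X in _ --> X]addr0 -[in X in _ --> X](mulr0 s).
  by apply: cvgD; [exact: cvg_fst|apply: cvgM; [exact: cvg_cst|exact: cvg_snd]].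
move=> /(_ O); have nO : nbhs x O by apply: open_nbhs_nbhs; split => //; exact: KO.
move=> /(_ nO) [[A B] /= [nA nB] AB].
exists (A, B) => //=; split => //; exact: cvg_at_right_filter nB.
Qed.

(** Serves the bound e1 * k + e1^(1 - p) * e2 on an L^1 norm: e1 has to be fixed first, because its
    power may be large, and e2 is adapted to it. *)
Lemma small_constants (c : R -> R) (M k e : R) :
  (forall e : R, 0 < e -> 0 < c e) -> 0 <= M -> 0 <= k -> 0 < e ->
  exists2 e1, 0 < e1 & exists2 e2, 0 < e2 & M * (e1 * k + c e1 * e2) <= e.
Proof.
move=> c0 M0 k0 e0; have M1 : 0 < M + 1 by rewrite ltr_wpDl.
have k1 : 0 < k + 1 by rewrite ltr_wpDl.
pose t := e / 2 / (M + 1); have t0 : 0 < t by rewrite !divr_gt0.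
have tM : t * (M + 1) = e / 2 by rewrite /t divfK// gt_eqF.
exists (t / (k + 1)); first by rewrite divr_gt0.
have ce0 := c0 _ (divr_gt0 t0 k1); set e1 := t / (k + 1) in ce0 *.
exists (t / c e1); first by rewrite divr_gt0.
rewrite mulrC [c e1 * _]mulrC divfK ?gt_eqF//.
have e1k : e1 * k <= t.
  rewrite /e1 mulrAC ler_pdivrMr// ler_wpM2l ?(ltW t0)//; lra.
have : e1 * k * M <= t * M by rewrite ler_wpM2r.
rewrite mulrDl; rewrite mulrDr mulr1 in tM; move: (e1 * k * M) (t * M) tM t0 => y z.
by clear; lra.
Qed.

Variables (b : itv_bound R).
Hypothesis b_eq : unit_or_halfline b.
Local Notation i := (Interval (BRight 0) b).

(** A discrete integration by parts: a change of variable moves the difference quotient from E to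
    phi, where Taylor's formula turns it into - s phi'. For small h the translated support of phi is
    still in i, so the values of E outside i, where it may differ from U, do not enter. *)
Lemma difference_quotient_weak_derivative U E a (s : R) : `|s| = 1 ->
  in_Lp U -> in_Lp E -> in_Lp a ->
  {ae mu, forall x, [set` i] x -> E x = U x} ->
  (forall e : R, 0 < e -> \forall h \near (0 : R)^'+,
    (pint p [set` i] (fun x => (h^-1 * (E (x + s * h) - E x) - a x)%R) <= e%:E)%E) ->
  weak_derivative_on i U (fun x => s * a x).
Proof.
move=> s1 LU LE La EU lim phi [dphi [K [cK Ki phi0]]].
have clK : closed K by apply: compact_closed => //; exact: Rhausdorff.
have mK : measurable (K : set T) by exact: compact_measurable.
have d0 x : derivable phi x 1 by exact: (dphi 0%N x).
have d1 x : derivable (phi^`())%classic x 1 by have := dphi 1%N x; rewrite derive1n1.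
have cphi := derivable1_continuous d0; have cphi1 := derivable1_continuous d1.
have phi10 := derive1_support clK phi0.
have phi20 x : ~ K x -> (phi^`(2))%classic x = 0.
  by rewrite derive1nS derive1n1; exact: derive1_support.
have [M0 M0_ge0 phiM0] := continuous_support_bounded cphi cK phi0.
have [M1 M1_ge0 phiM1] := continuous_support_bounded cphi1 cK phi10.
have cphi2 := derivable1_continuous (dphi 2%N).
have [M2 M2_ge0 phiM2] := continuous_support_bounded cphi2 cK phi20.
have taylor := derive1_taylor d0 d1 phiM2.
have [B B0 KB] : exists2 B, 0 <= B & forall x, K x -> `|x| <= B.
  have [N [_ NP]] := compact_bounded cK.
  exists (`|N| + 1) => [|x Kx]; first by rewrite addr_ge0.
  by apply: NP => //; rewrite (le_lt_trans (ler_norm _))// ltrDl.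
have phiB x : B < `|x| -> phi x = 0.
  by move=> Bx; apply: phi0 => /KB; rewrite leNgt Bx.
have phi1B x : B < `|x| -> (phi^`())%classic x = 0.
  by move=> Bx; apply: phi10 => /KB; rewrite leNgt Bx.
have mphi : measurable_fun [set: T] phi by exact: continuous_measurable_fun.
have mphi1 : measurable_fun [set: T] (phi^`())%classic by exact: continuous_measurable_fun.
have iU := in_Lp_interval_integrable LU; have ia := in_Lp_interval_integrable La.
have toT f g : (forall x, ~ K x -> g x = 0) ->
    \int[mu]_(x in [set` i]) (f x * g x) = \int[mu]_x (f x * g x).
  move=> g0; apply/esym/Rintegral_support => // x _ ix.
  by rewrite g0 ?mulr0// => /Ki.
rewrite !toT//.
set I1 := \int[mu]_x (U x * _).
have sE : s * s = 1 by rewrite -expr2 -real_normK ?num_real// s1 expr1n.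
rewrite (_ : \int[mu]_x (s * a x * phi x) = s * \int[mu]_x (a x * phi x)); last first.
  rewrite -RintegralZl//; last exact: (integrable_support ia mphi phiM0 phiB).
  by apply: eq_Rintegral => x _; rewrite mulrA.
set I2 := \int[mu]_x (a x * phi x).
suff : s * I1 + I2 = 0.
  move=> /(congr1 ( *%R s)); rewrite mulrDr mulrA sE mul1r mulr0 => /eqP.
  by rewrite addr_eq0 => /eqP.
apply/eqP; rewrite -normr_le0; apply/ler_addgt0Pl => e e0; rewrite addr0.
(* One unit larger than the support of phi on each side, so that it also contains the support of the
   translate by s * h for h < 1. *)
pose J : set T := `[- (B + 1), B + 1]%classic.
have mJ : measurable J by exact: measurable_itv.
pose CU := fine (\int[mu]_(x in J) `|(U x)%:E|)%E.
have CUE : (\int[mu]_(x in J) `|(U x)%:E|)%E = CU%:E.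
  rewrite fineK//; apply: integrable_fin_num => //.
  by apply: integrable_abse; exact: iU.2.
have CU0 : 0 <= CU by rewrite fine_ge0// integral_ge0.
pose k := fine (mu K).
have kE : mu K = k%:E.
  by rewrite fineK// ge0_fin_numE ?measure_ge0//; exact: compact_finite_measure.
have k0 : 0 <= k by rewrite fine_ge0.
have e_half : 0 < e / 2 by rewrite divr_gt0.
have [e1 e10 [e2 e20 small_sum]] := small_constants
  (fun e : R => @powR_gt0 R e (1 - p)) M0_ge0 k0 e_half.
pose c1 := e1 `^ (1 - p); have c10 : 0 < c1 by rewrite powR_gt0.
near (0 : R)^'+ => h.
have h0 : 0 < h by near: h; exact: nbhs_right_gt.
have h1 : h < 1 by near: h; exact: nbhs_right_lt.
have hK x : K x -> [set` i] (x + s * h).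
  move: x; near: h; apply: nbhs_right_compact => //.
  exact: unit_or_halfline_open.
have hM2 : M2 * h * CU <= e / 2.
  have : h < e / 2 / (M2 * CU + 1).
    by near: h; apply: nbhs_right_lt; rewrite !divr_gt0// ltr_wpDl ?mulr_ge0.
  rewrite ltr_pdivlMr ?ltr_wpDl ?mulr_ge0// mulrDr mulr1 => hlt.
  rewrite (_ : M2 * h * CU = h * (M2 * CU)); last ring.
  by rewrite (le_trans _ (ltW hlt))// lerDl ltW.
have hq : (pint p [set` i] (fun x => (h^-1 * (E (x + s * h) - E x) - a x)%R) <= e2%:E)%E.
  by near: h; exact: lim.
pose q x := h^-1 * (E (x + s * h) - E x).
have Lq : in_Lp q.
  exact: (in_LpZ h^-1 (in_LpB (in_Lp_shift (s * h) LE) LE)).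
have iq := in_Lp_interval_integrable Lq.
have Lqa := in_LpB Lq La; have iqa := in_Lp_interval_integrable Lqa.
(* Q mediates between the two sides: Q - I2 is small by the L^p convergence, and s * I1 + Q is small
   by Taylor's formula. *)
set Q := \int[mu]_x (q x * phi x).
have QI2 : `|Q - I2| <= e / 2.
  rewrite /Q /I2 -RintegralB//; last 2 first.
  - exact: (integrable_support iq mphi phiM0 phiB).
  - exact: (integrable_support ia mphi phiM0 phiB).
  under eq_Rintegral do rewrite -mulrBl.
  rewrite -lee_fin.
  apply: (le_trans (le_normr_Rintegral_support mK Lqa.1 mphi _ phi0 phiM0)).
    exact: (integrable_support iqa mphi phiM0 phiB).
  apply: (@le_trans _ _ (M0 * (e1 * k + c1 * e2))%:E); last by rewrite lee_fin.
  rewrite EFinM lee_wpmul2l ?lee_fin//.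
  have mqaK : measurable_fun (K : set T) (fun x => q x - a x) by exact: measurable_funS Lqa.1.
  apply: (le_trans (le_integral_pint p1 e10 mK mqaK)).
  rewrite [X in (_ * X)%E]kE EFinD leeD// EFinM lee_wpmul2l ?lee_fin ?(ltW c10)//.
  by apply: le_trans hq; apply: pint_subset => //; exact: measurable_funS Lqa.1.
have shift_integral f : measurable_fun [set: T] f ->
    \int[mu]_x f (x + s * h) = \int[mu]_x f x.
  move=> mf; congr fine.
  have mf' : measurable_fun [set: T] (EFin \o f) by exact/measurable_EFinP.
  rewrite -[RHS](integral_affine (s * h) (normr1 _) mf').
  by apply: eq_integral => x _; rewrite mul1r.
pose g x := s * (phi^`())%classic x + h^-1 * (phi (x - s * h) - phi x).
have phish0 x : ~ J x -> phi (x - s * h) = 0.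
  rewrite /J /= in_itv /= -ler_norml => /negP; rewrite -ltNge => Bx.
  apply: phiB; have : `|x| - `|s * h| <= `|x - s * h| by exact: lerB_dist.
  by rewrite normrM s1 mul1r gtr0_norm//; clear -Bx h1; lra.
have phiJ x : ~ J x -> phi x = 0.
  rewrite /J /= in_itv /= -ler_norml => /negP; rewrite -ltNge => Bx.
  by apply: phiB; apply: lt_trans Bx; rewrite ltrDl.
have phi1J x : ~ J x -> (phi^`())%classic x = 0.
  rewrite /J /= in_itv /= -ler_norml => /negP; rewrite -ltNge => Bx.
  by apply: phi1B; apply: lt_trans Bx; rewrite ltrDl.
have mphish : measurable_fun [set: T] (fun x => phi (x - s * h)) by exact: measurable_shift.
have iUphish : mu.-integrable [set: T] (EFin \o (fun x => U x * phi (x - s * h))).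
  apply: (@integrable_support _ U _ (B + 1) M0) => // x Bx; apply: phish0.
  by rewrite /J /= in_itv /= -ler_norml; apply/negP; rewrite -ltNge.
have QE : s * I1 + Q = \int[mu]_x (U x * g x).
  have iUphi := integrable_support iU mphi phiM0 phiB.
  have iUphi1 := integrable_support iU mphi1 phiM1 phi1B.
  have LUs := in_Lp_shift (s * h) LU; have iUs := in_Lp_interval_integrable LUs.
  have iUsphi := integrable_support iUs mphi phiM0 phiB.
  have -> : Q = h^-1 * (\int[mu]_x (U x * phi (x - s * h)) - \int[mu]_x (U x * phi x)).
    have -> : \int[mu]_x (U x * phi (x - s * h)) = \int[mu]_x (U (x + s * h) * phi x).
      rewrite -(shift_integral (fun x => U x * phi (x - s * h))).
        by apply: eq_Rintegral => x _; rewrite addrK.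
      by apply: measurable_funM => //; exact: LU.1.
    rewrite -RintegralB// -RintegralZl//; last first.
    exact: integrable_realB.
    congr fine; apply: ae_eq_integral => //.
    - by apply/measurable_EFinP; apply: measurable_funM => //; exact: Lq.1.
    - apply/measurable_EFinP; apply: measurable_funM => //.
      by apply: measurable_funB; apply: measurable_funM => //; [exact: LUs.1|exact: LU.1].
    have := ae_affine (s * h) (normr1 _) EU.
    apply: lebesgue_ae2 EU => x EUx; rewrite mul1r => EUxs _ /=.
    have [Kx|Kx] := pselect (K x); last by rewrite phi0// !mulr0 subrr mulr0.
    by rewrite /q (EUxs (hK _ Kx)) (EUx (Ki _ Kx)); congr EFin; ring.
  rewrite -RintegralB// /I1 -!RintegralZl//; last first.
    exact: integrable_realB.
  rewrite -RintegralD//; last 2 first.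
  - exact: (integrableZl measurableT s iUphi1).
  - exact: (integrableZl measurableT h^-1 (integrable_realB measurableT iUphish iUphi)).
  by apply: eq_Rintegral => x _; rewrite /g; ring.
have sIQ : `|s * I1 + Q| <= e / 2.
  have mg : measurable_fun [set: T] g.
    apply: measurable_funD; first exact: measurable_funM.
    by apply: measurable_funM => //; exact: measurable_funB.
  have gJ x : ~ J x -> g x = 0.
    by move=> Jx; rewrite /g phish0// phiJ// phi1J// subrr !mulr0 addr0.
  have gM x : `|g x| <= M2 * h.
    have := taylor x (x - s * h); rewrite [x - s * h]addrC addrK -[s * h]/(s * h).
    have -> : g x = h^-1 * (phi (- (s * h) + x) - phi x - - (s * h) * (phi^`())%classic x).
      by rewrite /g [x - s * h]addrC; field; rewrite gt_eqF.
    rewrite normrN !normrM s1 mul1r [`|h|]gtr0_norm// gtr0_norm ?invr_gt0// => H.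
    by rewrite ler_pdivrMl// (le_trans H)// expr2 mulrCA.
  rewrite QE -lee_fin.
  apply: (le_trans (le_normr_Rintegral_support mJ LU.1 mg _ gJ gM)).
    apply: (@integrable_support _ U g (B + 1) (M2 * h)) => // x Bx; apply: gJ.
    by rewrite /J /= in_itv /= -ler_norml; apply/negP; rewrite -ltNge.
  by rewrite CUE -EFinM lee_fin.
have -> : s * I1 + I2 = (s * I1 + Q) - (Q - I2) by ring.
by rewrite (splitr e) (le_trans (ler_normB _ _))// lerD.
Unshelve. all: by end_near. Qed.

End difference_quotient_limit.

(** * Absence of jumps at the boundary *)

Section traces.
Context {R : realType}.
Local Notation mu := (@lebesgue_measure R).
Local Notation T := (measurableTypeR R).
Implicit Types (E a c l : R -> R) (x : R).
Variable p : R.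
Hypothesis p1 : 1 <= p.

Lemma small_integral_right a (e : R) : interval_integrable a -> 0 < e ->
  \forall h \near (0 : R)^'+, (\int[mu]_(x in `]0%R, h[) `|(a x)%:E| <= e%:E)%E.
Proof.
move=> [ma ia] e0; have ina : mu.-integrable `[0, 1] (EFin \o (Num.norm \o a)).
  exact: integrable_norm (ia 0 1).
have [r /= r0 rP] := @parameterized_integral_near_left R 0 1 e (Num.norm \o a) ltr01 e0 ina.
near=> h; have h0 : 0 < h by near: h; exact: nbhs_right_gt.
have hr : h < r by near: h; exact: nbhs_right_lt.
have := rP h; rewrite /= sub0r normrN gtr0_norm// => /(_ hr (ltW h0)) small.
apply: (@le_trans _ _ (\int[mu]_(x in `[0%R, h]) `|(a x)%:E|)%E).
  have mabs : measurable_fun [set: T] (fun x => `|(a x)%:E|%E).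
    by apply: measurableT_comp => //; exact/measurable_EFinP.
  by apply: ge0_subset_integral => //; [exact: measurable_funS mabs|exact: subset_itv_oo_cc].
have fin : (\int[mu]_(x in `[0%R, h]) `|(a x)%:E|)%E \is a fin_num.
  by apply: integrable_fin_num => //; apply: integrable_abse; exact: ia.
by rewrite -(fineK fin) lee_fin (le_trans (ler_norm _))// ltW.
Unshelve. all: by end_near. Qed.

Variables (b : itv_bound R).
Hypothesis b_eq : unit_or_halfline b.
Local Notation i := (Interval (BRight 0) b).

(* A jump of E across 0 would make the difference quotients of E at least
   h^-1 |l0 - c0| / 2 on ]0, h[, which is not compatible with an L^p limit, even
   when p = 1. *)
Lemma difference_quotient_no_jump E a c l (c0 l0 : R) :
  in_Lp p E -> in_Lp p a ->
  c x @[x --> (0 : R)^'+] --> c0 -> l x @[x --> (0 : R)^'-] --> l0 ->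
  {ae mu, forall x, [set` i] x -> E x = c x} ->
  {ae mu, forall x, -1 < x < 0 -> E x = l x} ->
  (forall e : R, 0 < e -> \forall h \near (0 : R)^'+,
    (pint p [set` i] (fun x => (h^-1 * (E (x - h) - E x) - a x)%R) <= e%:E)%E) ->
  l0 = c0.
Proof.
move=> LE La cc cl Ec El lim; apply/eqP; rewrite -subr_eq0 -normr_le0 leNgt.
apply/negP; set d := `|l0 - c0| => d0.
(* Each one-sided limit is approached up to d / 4, so that a gap of d / 2 remains across 0. *)
have d40 : 0 < d / 4 by rewrite divr_gt0.
have d80 : 0 < d / 8 by rewrite divr_gt0.
have d160 : 0 < d / 16 by rewrite divr_gt0.
have /cvgrPdist_lt/(_ _ d40)[r1 /= r10 cP] := cc.
have /cvgrPdist_lt/(_ _ d40)[r2 /= r20 lP] := cl.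
have [e1 e10 [e2 e20 small]] := small_constants
  (fun e : R => @powR_gt0 R e (1 - p)) (@ler01 R) (@ler01 R) d80.
near (0 : R)^'+ => h.
have h0 : 0 < h by near: h; exact: nbhs_right_gt.
have h1 : h < 1 by near: h; exact: nbhs_right_lt.
have hr1 : h < r1 by near: h; exact: nbhs_right_lt.
have hr2 : h < r2 by near: h; exact: nbhs_right_lt.
have ha : (\int[mu]_(x in `]0%R, h[) `|(a x)%:E| <= (d / 16)%:E)%E.
  by near: h; apply: small_integral_right => //; exact: in_Lp_interval_integrable La.
have hq : (pint p [set` i] (fun x => (h^-1 * (E (x - h) - E x) - a x)%R) <= e2%:E)%E.
  by near: h; exact: lim.
pose D : set T := `]0, h[%classic; have mD : measurable D by exact: measurable_itv.
have muD : mu D = h%:E by rewrite lebesgue_measure_itv/= lte_fin h0 oppr0 adde0.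
have Di : D `<=` [set` i].
  move=> x; rewrite /D /= !in_itv /= => /andP[-> xh] /=.
  by case: b_eq => -> //=; rewrite (lt_trans xh).
pose q x := h^-1 * (E (x - h) - E x).
have Lq : in_Lp p q := in_LpZ h^-1 (in_LpB p1 (in_Lp_shift (- h) LE) LE).
have Lqa := in_LpB p1 Lq La.
have mqa : measurable_fun D (fun x => q x - a x) by exact: measurable_funS Lqa.1.
have ma : measurable_fun D a by exact: measurable_funS La.1.
have qa_small : (\int[mu]_(x in D) `|(q x - a x)%:E| <= (d / 8)%:E)%E.
  apply: (le_trans (le_integral_pint p1 e10 mD mqa)).
  apply: (@le_trans _ _ (1 * (e1 * 1 + e1 `^ (1 - p) * e2))%:E); last by rewrite lee_fin.
  rewrite mul1r EFinD [X in (_ * X + _)%E]muD; apply: leeD.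
    by rewrite -EFinM lee_fin ler_wpM2l ?(ltW e10) ?(ltW h1).
  rewrite EFinM lee_wpmul2l ?lee_fin ?powR_ge0//.
  apply: le_trans hq; apply: pint_subset => //.
  exact: measurable_funS Lqa.1.
(* On ]0, h[, of measure h, |q| is at least d / (2 h), so its integral stays above d / 2 however
   small h is. This contradicts the bounds d / 8 and d / 16 on the integrals of |q - a| and |a|. *)
have : ((d / 2)%:E <= (d / 8)%:E + (d / 16)%:E)%E.
  apply: le_trans (leeD qa_small ha).
  rewrite -ge0_integralD//; last 2 first.
  - by apply: measurableT_comp => //; exact/measurable_EFinP.
  - by apply: measurableT_comp => //; exact/measurable_EFinP.
  have -> : (d / 2)%:E = (\int[mu]_(x in D) (h^-1 * (d / 2))%:E)%E.
    rewrite integral_cst// [X in (_ * X)%E]muD -EFinM; congr EFin.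
    by rewrite mulrAC mulVf ?mul1r// gt_eqF.
  apply: ae_ge0_le_integral => //.
  - by move=> x _; rewrite lee_fin mulr_ge0 ?invr_ge0 ?(ltW h0) ?divr_ge0 ?(ltW d0).
  - by move=> x _; exact: adde_ge0.
  - by apply: emeasurable_funD; apply: measurableT_comp => //; exact/measurable_EFinP.
  have El' := ae_affine (- h) (normr1 _) El.
  have := lebesgue_ae2 (fun x P Q => conj P Q) Ec El'.
  apply: lebesgue_aeS => x [Ecx]; rewrite mul1r => Elx Dx.
  have [x0 xh] : 0 < x /\ x < h by move: Dx; rewrite /D /= in_itv /= => /andP[].
  have Exh := Elx _; rewrite -EFinD lee_fin.
  have qx : h^-1 * (d / 2) <= `|q x|.
    rewrite normrM gtr0_norm ?invr_gt0// ler_wpM2l ?invr_ge0 ?(ltW h0)//.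
    rewrite (Ecx (Di _ Dx)) Elx; last by apply/andP; split; lra.
    have cx : `|c0 - c x| < d / 4.
      by apply: cP => //=; rewrite sub0r normrN gtr0_norm// (lt_trans xh).
    have lx : `|l0 - l (x - h)| < d / 4.
      apply: lP => /=; last by rewrite subr_lt0.
      by rewrite sub0r normrN ltr0_norm ?subr_lt0//; lra.
    have : d <= `|l0 - l (x - h)| + `|l (x - h) - c x| + `|c0 - c x|.
      rewrite (distrC c0) /d.
      rewrite (_ : l0 - c0 = (l0 - l (x - h)) + (l (x - h) - c x) + (c x - c0)); last ring.
      by rewrite (le_trans (ler_normD _ _))// lerD2r ler_normD.
    by lra.
  apply: (le_trans qx); rewrite -{1}(subrK (a x) (q x)); exact: ler_normD.
by rewrite -EFinD lee_fin; lra.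
Unshelve. all: by end_near. Qed.

End traces.

(** * Classes of p-integrable functions and their traces *)

Section Lp_functions.
Context {R : realType}.
Local Notation mu := (@lebesgue_measure R).
Local Notation T := (measurableTypeR R).
Variables (i : interval R) (p : R) (p1 : (1 <= p%:E)%E).
Implicit Types (f g : R -> R) (u v : Lp i p1).

Let p1R : 1 <= p. Proof. by rewrite -lee_fin. Qed.
Let p0 : 0 < p. Proof. exact: lt_le_trans p1R. Qed.

Lemma ae_lebesgue_on (P : R -> Prop) :
  {ae lebesgue_on i, forall x, P x} <-> {ae mu, forall x, [set` i] x -> P x}.
Proof.
split=> [[N [mN N0 PN]]|[N [mN N0 PN]]].
- exists (N `&` [set` i]); split => //; first exact: measurableI.
  move=> x /= /not_implyP[ix Px]; split=> //; exact: PN.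
- exists (N `|` ~` [set` i]); split => //.
  + by apply: measurableU => //; exact: measurableC.
  + apply: (@subset_measure0 _ _ _ mu _ N) => //.
      apply: measurableI => //; apply: measurableU => //; exact: measurableC.
    by move=> x [[//|]].
  + move=> x /= Px; have [ix|] := pselect ([set` i] x); last by right.
    by left; apply: PN => /= /(_ ix).
Qed.

Lemma ge0_integral_lebesgue_on (f : T -> \bar R) : measurable_fun [set: T] f ->
  (forall x, 0 <= f x)%E ->
  (\int[lebesgue_on i]_x f x = \int[mu]_(x in [set` i]) f x)%E.
Proof.
move=> mf f0; rewrite [RHS](@eq_measure_integral _ T R [set` i] (lebesgue_on i)); last first.
  by move=> A mA Ai; rewrite /= /mrestr setIidl.
rewrite [RHS]integral_mkcond; apply: ae_eq_integral => //.
  exact: measurable_patch.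
apply/ae_lebesgue_on; apply: aeW => x ix _.
by rewrite /patch mem_set.
Qed.

Lemma lebesgue_on_pint f : measurable_fun [set: T] f ->
  (\int[lebesgue_on i]_x (`|f x| `^ p)%:E)%E = pint p [set` i] f.
Proof.
by move=> mf; rewrite ge0_integral_lebesgue_on//; exact: measurable_fun_pint.
Qed.

Lemma Lnorm_lebesgue_on f : measurable_fun [set: T] f ->
  'N[lebesgue_on i]_(p%:E)[EFin \o f]%E = (pint p [set` i] f `^ p^-1)%E.
Proof. by move=> mf; rewrite unlock /Lnorm -lebesgue_on_pint. Qed.

(** A class leaves the values of its representative outside i arbitrary; setting them to 0 gives a
    function on the line whose translates and reflections are determined almost everywhere. *)
Definition ext u : R -> R := (u : R -> R) \_ [set` i].

Lemma measurable_Lp u : measurable_fun [set: T] (u : R -> R).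
Proof. exact: (measurable_funPT (repr (LebesgueSpace.sort u))). Qed.

Lemma ext_eq0 u x : ~ [set` i] x -> ext u x = 0.
Proof. by move=> ix; rewrite /ext /patch memNset. Qed.

Lemma extE u x : [set` i] x -> ext u x = u x.
Proof. by move=> ix; rewrite /ext /patch mem_set. Qed.

Lemma measurable_ext u : measurable_fun [set: T] (ext u).
Proof. exact: measurable_patch (measurable_Lp u). Qed.

Lemma Lp_norm u : (`|u| `^ p)%:E = pint p setT (ext u).
Proof.
rewrite -[`|u|]/(Lspace_norm u) /Lspace_norm -pint_mkcond//.
rewrite -poweR_EFin fineK; last first.
  rewrite ge0_fin_numE ?Lnorm_ge0//; case: u => u [[fin]]; exact: fin.
rewrite Lnorm_lebesgue_on; last exact: measurable_Lp.
by rewrite -poweRrM mulVf ?gt_eqF// poweRe1// pint_ge0.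
Qed.

Lemma in_Lp_ext u : in_Lp p (ext u).
Proof. by split; [exact: measurable_ext|rewrite -Lp_norm ltry]. Qed.

Lemma Lp_norm_le u (M : R) : 0 <= M -> (pint p setT (ext u) <= (M `^ p)%:E)%E -> `|u| <= M.
Proof.
move=> M0; rewrite -Lp_norm lee_fin => uM; rewrite leNgt; apply/negP => Mu.
by move: uM; rewrite leNgt gt0_ltr_powR// nnegrE.
Qed.

Lemma in_Lp_Lfun f : in_Lp p f -> f \in Lfun (lebesgue_on i) p%:E.
Proof.
move=> [mf foo]; rewrite inE; apply/andP; split; rewrite inE//=.
rewrite /finite_norm Lnorm_lebesgue_on//; apply: poweR_lty.
by apply: le_lt_trans foo; exact: pint_subset.
Qed.

(** Total, with default value 0, so that operators can be defined before integrability is proved. *)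
Definition Lp_class f : Lp i p1 :=
  if pselect (f \in Lfun (lebesgue_on i) p%:E) is left fL
  then Lspace_class (Lfun_Sub p1 fL) else 0.

Lemma ext_class f : in_Lp p f ->
  {ae mu, forall x, [set` i] x -> ext (Lp_class f) x = f x}.
Proof.
move=> /in_Lp_Lfun fL; rewrite /Lp_class; case: pselect => // fL'.
have /ae_lebesgue_on := repr_mfun_class (Lfun_Sub p1 fL').
by apply: lebesgue_aeS => x /[swap] ix /(_ ix I); rewrite extE.
Qed.

Lemma Lp_eq u v : {ae mu, forall x, [set` i] x -> ext u x = ext v x} -> u = v.
Proof.
move=> uv; apply: Lspace_eq; apply/ae_lebesgue_on.
by apply: lebesgue_aeS uv => x /[swap] ix /(_ ix) + _; rewrite !extE.
Qed.

(** Holds only almost everywhere, because the representatives of the three classes are chosen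
    independently. *)
Lemma ext_linear (a : R) u v :
  {ae mu, forall x, ext (a *: u + v) x = a * ext u x + ext v x}.
Proof.
have /ae_lebesgue_on uE := Lspace_classK (a *: Lspace_repr u).
have /ae_lebesgue_on vE := Lspace_classK (Lspace_repr (a *: u) + Lspace_repr v).
apply: lebesgue_ae2 uE vE => x; have [ix|ix] := pselect ([set` i] x); last first.
  by rewrite !ext_eq0// mulr0 addr0.
move=> /(_ ix I) uE /(_ ix I) vE; rewrite !extE//.
by rewrite [LHS]vE; congr (_ + _).
Qed.

Lemma ext_oppr u : {ae mu, forall x, ext (- u) x = - ext u x}.
Proof.
have := ext_linear (-1) u 0; rewrite addr0 scaleN1r.
(* Since 0 = -1 *: 0 + 0, this shows that [ext 0] vanishes almost everywhere. *)
have := ext_linear (-1) (0 : Lp i p1) 0; rewrite scaler0 addr0.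
by apply: lebesgue_ae2 => x z0 ->; lra.
Qed.

End Lp_functions.

(** * Traces of Sobolev functions *)

Section sobolev_representatives.
Context {R : realType}.
Local Notation mu := (@lebesgue_measure R).
Variables (b : itv_bound R) (p : R) (p1 : (1 <= p%:E)%E).
Hypothesis b_eq : unit_or_halfline b.
Local Notation i := (Interval (BRight (0 : R)) b).
Implicit Types (u g : Lp i p1) (c : R -> R).

Lemma is_weak_derivativeP u g :
  is_weak_derivative u g <-> weak_derivative_on i (ext u) (ext g).
Proof.
have E (h : Lp i p1) (f : R -> R) : \int[mu]_(x in [set` i]) (h x * f x) =
    \int[mu]_(x in [set` i]) (ext h x * f x).
  by apply: eq_Rintegral => x; rewrite inE => ix; rewrite extE.
by split=> H phi tphi; have := H phi tphi; rewrite !E.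
Qed.

Lemma ext_interval_integrable u : interval_integrable (ext u).
Proof. exact: in_Lp_interval_integrable (in_Lp_ext u). Qed.

Lemma closure_unit_or_halfline : closure [set` i] `<=` `[0, +oo[.
Proof.
have /closure_id -> : closed (`[(0 : R), +oo[%classic : set R).
  exact: interval_closed.
by apply: closure_subset => x /unit_or_halfline_gt0; rewrite /= in_itv /= andbT => /ltW.
Qed.

Lemma closure_unit_or_halfline0 : closure [set` i] 0.
Proof.
move=> N /nbhs_ballP[r /= r0 rN].
exists (Num.min (r / 2) (1 / 2)); split; last first.
  apply: rN; rewrite /ball /= sub0r normrN ger0_norm ?le_min ?divr_ge0 ?(ltW r0)//.
  by rewrite gt_min ltr_pdivrMr// ltr_pMr// ltr1n.
case: b_eq => ->; rewrite /= in_itv /= lt_min divr_gt0 //= ?andbT ?divr_gt0//=.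
by rewrite gt_min [X in _ || X]ltr_pdivrMr ?mul1r ?ltr1n// orbT.
Qed.

(** The primitive is a continuous representative, so [trace] is not a junk value, and whichever
    representative [xget] selects agrees with it up to the boundary. *)
Lemma trace_primitive u g : is_weak_derivative u g -> exists C : R,
  {ae mu, forall x, [set` i] x -> ext u x = C + \int[mu]_(t in `[0, x]) ext g t} /\
  forall x, closure [set` i] x -> trace u x = C + \int[mu]_(t in `[0, x]) ext g t.
Proof.
move=> /is_weak_derivativeP ug.
have iu := ext_interval_integrable u; have ig := ext_interval_integrable g.
have [C uC] := weak_derivative_primitive b_eq iu ig ug.
exists C; split => // x ix.
pose c x := C + \int[mu]_(t in `[0, x]) ext g t.
have cc : {within closure [set` i], continuous c}.
  exact: continuous_subspaceW closure_unit_or_halfline (@primitive_continuous _ _ C ig).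
have repr_c : is_continuous_representative u c.
  split => //; apply/ae_lebesgue_on; apply: lebesgue_aeS uC => y + iy _.
  by move=> /(_ iy); rewrite extE.
rewrite /trace; case: xgetP => [c' _ [cc' uc']|/(_ c)]; last by [].
apply: (within_continuous_ae_eq (unit_or_halfline_open b_eq) cc' cc) => //.
move/ae_lebesgue_on : uc'; apply: lebesgue_ae2 uC => y uy uc' iy.
by rewrite uc'// -extE// uy.
Qed.

End sobolev_representatives.

Lemma closure_unit1 (R : realType) : closure (`]0, 1[%classic : set R) 1.
Proof.
move=> N /nbhs_ballP[r /= r0 rN].
exists (1 - Num.min (r / 2) (1 / 2)).
have [mr m1] : Num.min (r / 2) (1 / 2) < r /\ Num.min (r / 2) (1 / 2) < 1.
  split; first by rewrite gt_min ltr_pdivrMr// ltr_pMr// ltr1n.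
  by rewrite gt_min [X in _ || X]ltr_pdivrMr ?mul1r ?ltr1n// orbT.
have m0 : 0 < Num.min (r / 2) (1 / 2) by rewrite lt_min !divr_gt0.
split; first by rewrite /= in_itv /=; apply/andP; split; lra.
by apply: rN; rewrite /ball /= opprB addrC subrK gtr0_norm.
Qed.

(** * Translations and reflections as operators between L^p spaces *)

Section shift_operators.
Context {R : realType}.
Local Notation mu := (@lebesgue_measure R).
Variables (i i' : interval R) (p : R) (p1 : (1 <= p%:E)%E) (s c : R).
Hypothesis s1 : `|s| = 1.
Implicit Types (u v : Lp i p1).

Let p1R : 1 <= p. Proof. by rewrite -lee_fin. Qed.

(** Source and target intervals may differ, since what leaves one component enters another. *)
Definition shift_op u : Lp i' p1 := Lp_class i' p1 (fun x => ext u (s * x + c)).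

Let in_Lp_shifted u : in_Lp p (fun x => ext u (s * x + c)).
Proof. exact: in_Lp_affine s1 (in_Lp_ext u). Qed.

Lemma ext_shift_op u :
  {ae mu, forall x, [set` i'] x -> ext (shift_op u) x = ext u (s * x + c)}.
Proof. exact: ext_class (in_Lp_shifted u). Qed.

Lemma shift_op_linear : linear shift_op.
Proof.
move=> a u v; apply: Lp_eq.
have H1 := ae_affine c s1 (ext_linear a u v).
have H2 := ext_linear a (shift_op u) (shift_op v).
have H3 := lebesgue_ae2 (fun x P Q => conj P Q) H1 H2.
have H4 := lebesgue_ae2 (fun x P Q => conj P Q) (ext_shift_op u) (ext_shift_op v).
have H5 := lebesgue_ae2 (fun x P Q => conj P Q) (ext_shift_op (a *: u + v)) H4.
apply: lebesgue_ae2 H3 H5 => x [E1 ->] [Euv [Eu Ev]] ix.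
by rewrite Euv// E1 Eu// Ev.
Qed.

Lemma shift_op_norm u : `|shift_op u| <= `|u|.
Proof.
apply: Lp_norm_le => //; rewrite Lp_norm -(pint_affine p c s1 (measurable_ext u)).
have mu' := (in_Lp_shifted u).1; have mL := measurable_Lp (shift_op u).
rewrite -(pint_mkcond p1R _ _).
rewrite (@ae_eq_pint R p _ _ (fun x => ext u (s * x + c)) (measurable_itv i')).
- exact: pint_subset.
- exact: measurable_funS mL.
- exact: measurable_funS mu'.
- by apply: lebesgue_aeS (ext_shift_op u) => x + ix; rewrite -extE//; apply.
Qed.

End shift_operators.

(** * Antiderivatives *)

Section antiderivatives.
Context {R : realType}.
Local Notation mu := (@lebesgue_measure R).
Local Notation T := (measurableTypeR R).
Implicit Types (f g F G : R -> R).

(* F and G are defined on the whole line, so that antiderivatives on the two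
   sides of a boundary point can be compared after a translation or a reflection. *)
Definition antiderivative F G := interval_integrable G /\
  forall x y, x <= y -> F y - F x = \int[mu]_(t in `[x, y]) G t.

Lemma antiderivative_cst (c : R) : antiderivative (cst c) (cst 0).
Proof.
split; first by split => // a b; exact: integrable0.
by move=> x y _; rewrite subrr /Rintegral integral0.
Qed.

Lemma antiderivativeD F G f g : antiderivative F G -> antiderivative f g ->
  antiderivative (fun x => F x + f x) (fun x => G x + g x).
Proof.
move=> [[mG iG] FG] [[mg ig] fg]; split.
  split; first exact: measurable_funD.
  by move=> a b; exact: integrableD (iG a b) (ig a b).
move=> x y xy; rewrite RintegralD; [|exact: measurable_itv|exact: iG|exact: ig].
by rewrite -FG// -fg//; ring.
Qed.

Lemma antiderivativeZ (c : R) F G : antiderivative F G ->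
  antiderivative (fun x => c * F x) (fun x => c * G x).
Proof.
move=> [[mG iG] FG]; split.
  split; first exact: measurable_funM.
  by move=> a b; exact: integrableZl (iG a b).
move=> x y xy; rewrite RintegralZl; [|exact: measurable_itv|exact: iG].
by rewrite -FG// mulrBr.
Qed.

Lemma antiderivative_sum (I : Type) (r : seq I) (F G : I -> R -> R) :
  (forall k, antiderivative (F k) (G k)) ->
  antiderivative (fun x => \sum_(k <- r) F k x) (fun x => \sum_(k <- r) G k x).
Proof.
move=> FG; elim: r => [|k r IH].
  rewrite (_ : (fun x => _) = cst 0); last by apply/funext => x; rewrite big_nil.
  rewrite (_ : (fun x => _) = cst 0); last by apply/funext => x; rewrite big_nil.
  exact: antiderivative_cst.
rewrite (_ : (fun x => _) = (fun x => F k x + \sum_(k <- r) F k x)); last first.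
  by apply/funext => x; rewrite big_cons.
rewrite (_ : (fun x => \sum_(k <- _ :: r) _) =
  (fun x => G k x + \sum_(k <- r) G k x)); last first.
  by apply/funext => x; rewrite big_cons.
exact: antiderivativeD.
Qed.

Lemma integral_affine_preimage (s c : R) (D : set T) (f : R -> \bar R) : `|s| = 1 ->
  measurable D -> measurable_fun [set: T] f ->
  (\int[mu]_(t in [set t | D (s * t + c)%R]) f (s * t + c)%R = \int[mu]_(t in D) f t)%E.
Proof.
move=> s1 mD mf; rewrite integral_mkcond [RHS]integral_mkcond.
rewrite -[RHS](integral_affine c s1); last exact: measurable_patch.
apply: eq_integral => t _; rewrite /patch.
by congr (if _ then _ else _); apply/idP/idP; rewrite !inE.
Qed.

Lemma affine_preimage_itv (s c x y : R) : `|s| = 1 -> exists x' y' : R,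
  [set t : R | `[x', y']%classic (s * t + c)] = `[x, y]%classic /\
  (s = 1 /\ x' = s * x + c /\ y' = s * y + c \/ s = -1 /\ x' = s * y + c /\ y' = s * x + c).
Proof.
have [s0|s0] := ger0P s => [->|/(congr1 -%R)].
  exists (1 * x + c), (1 * y + c); split; last by left.
  by apply/seteqP; split => t /=; rewrite !mul1r !in_itv/= !lerD2r.
rewrite opprK => ->; exists (- 1 * y + c), (- 1 * x + c); split; last by right.
by apply/seteqP; split => t /=; rewrite !mulN1r !in_itv/= !lerD2r !lerN2 andbC.
Qed.

Lemma interval_integrable_affine (s c : R) G : `|s| = 1 -> interval_integrable G ->
  interval_integrable (fun x => G (s * x + c)).
Proof.
move=> s1 [mG iG].
have mGa : measurable_fun [set: T] (fun x => G (s * x + c)).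
  exact: (measurableT_comp mG (@measurable_affine R s c)).
split=> // a b; have [a' [b' [ab _]]] := affine_preimage_itv c a b s1.
apply/integrableP; split.
  by apply/measurable_EFinP; exact: measurable_funS mGa.
have mE : measurable_fun [set: T] (fun x => `|(G x)%:E|%E).
  by apply: measurableT_comp => //; exact/measurable_EFinP.
rewrite -ab (integral_affine_preimage c s1 (measurable_itv _) mE).
by have /integrableP[] := iG a' b'.
Qed.

Lemma antiderivative_affine (s c : R) F G : `|s| = 1 -> antiderivative F G ->
  antiderivative (fun x => F (s * x + c)) (fun x => s * G (s * x + c)).
Proof.
move=> s1 [iG FG]; have [mGa iGa] := interval_integrable_affine c s1 iG.
split.
  split; first exact: measurable_funM.
  by move=> a b; exact: integrableZl (iGa a b).
move=> x y xy; rewrite RintegralZl; [|exact: measurable_itv|exact: iGa].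
have [x' [y' [xyE E]]] := affine_preimage_itv c x y s1.
have -> : \int[mu]_(t in `[x, y]) G (s * t + c) = \int[mu]_(t in `[x', y']) G t.
  rewrite /Rintegral -xyE; congr fine.
  apply: (integral_affine_preimage c s1 (measurable_itv _) (f := EFin \o G)).
  by apply/measurable_EFinP; exact: iG.1.
by case: E => -[sE [xE yE]]; rewrite -FG ?xE ?yE sE; lra.
Qed.

(** Presents a difference quotient of F as an average of translates of G, the form that
    [pint_average_le] requires. *)
Lemma antiderivative_increment (s x h : R) F G : `|s| = 1 -> 0 <= h ->
  antiderivative F G ->
  F (x + s * h) - F x = s * \int[mu]_(t in `[0, h]) G (x + s * t).
Proof.
move=> s1 h0 FG; have [_ /(_ 0 h h0)] := antiderivative_affine x s1 FG.
rewrite mulr0 add0r [x + _]addrC => ->.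
rewrite RintegralZl; [|exact: measurable_itv|].
  by under eq_Rintegral do rewrite addrC.
exact: (interval_integrable_affine x s1 FG.1).2.
Qed.

(** A translation by x - 1 brings the point x to 1, in the interior of the half-line where
    [primitive_continuous] applies. *)
Lemma antiderivative_continuous F G : antiderivative F G -> continuous F.
Proof.
move=> FG x; have iG' := interval_integrable_affine (x - 1) (normr1 R) FG.1.
have /continuous_within_itvcyP[+ _] := @primitive_continuous R _ (F (x - 1)) iG'.
move=> /(_ 1); rewrite in_itv /= ltr01 => /(_ isT) c1.
have cB : z - (x - 1) @[z --> x] --> (1 : R).
  rewrite [X in _ --> X](_ : 1 = x - (x - 1)); last by ring.
  by apply: cvgB; [exact: cvg_id|exact: cvg_cst].
rewrite /continuous_at -[in X in _ --> X](subrK (x - 1) x) (_ : x - (x - 1) = 1); last by ring.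
have FE z : 0 <= z -> F (z + (x - 1)) =
    F (x - 1) + \int[mu]_(t in `[0, z]) G (1 * t + (x - 1)).
  move=> z0; have := antiderivative_increment (x - 1) (normr1 R) z0 FG.
  rewrite !mul1r [x - 1 + z]addrC => /eqP; rewrite subr_eq addrC => /eqP ->.
  by rewrite addrC; congr (_ + _); apply: eq_Rintegral => t _; rewrite [x - 1 + _]addrC.
rewrite FE//; apply: cvg_trans (continuous_cvg _ c1 cB); apply: near_eq_cvg.
near=> z; rewrite /= -FE ?subrK// subr_ge0.
by near: z; apply: cvgr_ge; [exact: cvg_id|rewrite ltrBlDr ltrDl].
Unshelve. all: by end_near. Qed.

(** For negative x the interval [[0, x]] is empty and the integral is 0, which is the correct value
    because g vanishes there. *)
Lemma antiderivative_primitive (C : R) g : interval_integrable g ->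
  (forall x, x <= 0 -> g x = 0) ->
  antiderivative (fun x => C + \int[mu]_(t in `[0, x]) g t) g.
Proof.
move=> ig g0; split=> // x y xy; rewrite opprD addrACA subrr add0r.
have [x0|x0] := leP 0 x; first exact: Rintegral_chasles.
rewrite [X in _ - X](_ : _ = 0); last by rewrite set_itv_ge ?Rintegral_set0// bnd_simp -ltNge.
rewrite subr0; rewrite /Rintegral integral_mkcond [in RHS]integral_mkcond.
congr fine; apply: eq_integral => t _; rewrite /patch.
have [t0|t0] := leP t 0; first by rewrite /= g0//; case: ifP; case: ifP.
congr (if _ then _ else _); apply/idP/idP; rewrite !inE /= !in_itv /=.
- by move=> /andP[_ ->]; rewrite (ltW (lt_trans x0 t0)).
- by move=> /andP[_ ->]; rewrite ltW.
Qed.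

End antiderivatives.

(** * Convergence of translates and difference quotients in L^p *)

Section difference_quotient_convergence.
Context {R : realType}.
Local Notation mu := (@lebesgue_measure R).
Local Notation T := (measurableTypeR R).

Lemma antiderivative_quotient (p : R) (D : set T) (s e : R) (E F G a : R -> R) :
  1 <= p -> `|s| = 1 -> measurable D -> antiderivative F G ->
  in_Lp p G -> measurable_fun [set: T] E ->
  measurable_fun [set: T] a ->
  {ae mu, forall x, D x -> E x = F x} -> {ae mu, forall x, D x -> a x = s * G x} ->
  (forall h, 0 < h < 1 -> {ae mu, forall x, D x -> E (x + s * h) = F (x + s * h)}) ->
  0 < e -> \forall h \near (0 : R)^'+,
    (pint p D (fun x => (h^-1 * (E (x + s * h) - E x) - a x)%R) <= e%:E)%E.
Proof.
move=> p1 s1 mD FG [mG Goo] mE ma EF aG EFs e0.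
have k0 : 0 < 2 `^ p :> R by rewrite powR_gt0.
have [d /= d0 dP] := translation_pint_continuous p1 (divr_gt0 e0 k0) mG Goo.
have ss : s * s = 1 by rewrite -expr2 -real_normK ?num_real// s1 expr1n.
near=> h.
have h0 : 0 < h by near: h; exact: nbhs_right_gt.
have h1 : h < 1 by near: h; exact: nbhs_right_lt.
have hd : h < d by near: h; exact: nbhs_right_lt.
pose Q x := h^-1 * (E (x + s * h) - E x) - a x.
have mQ : measurable_fun [set: T] Q.
  apply: measurable_funB => //.
  apply: measurable_funM => //; apply: measurable_funB => //.
  have := measurableT_comp mE (@measurable_affine R 1 (s * h)).
  by under eq_fun do rewrite /= mul1r.
have -> : e = 2 `^ p * (e / 2 `^ p) by rewrite mulrCA divff ?mulr1// gt_eqF.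
(* Multiplication by s keeps the modulus and, as s * s = 1, makes s * Q the average of G (x + s * t)
   - G x over t. *)
apply: (@le_trans _ _ (pint p D (fun x => s * Q x))).
  apply: (le_pint p1 mD (measurable_funS measurableT (@subsetT _ D) mQ)).
    exact: measurable_funS (measurable_funM (measurable_cst s) mQ).
  by move=> x _; rewrite normrM s1 mul1r.
apply: (pint_average_le p1 s1 h0 (ltW (divr_gt0 e0 k0)) mD _ mG Goo).
- exact: measurable_funM.
- move=> t /andP[t0 th]; apply: dP => /=.
  by rewrite sub0r normrN normrM s1 mul1r ger0_norm// (le_lt_trans th).
- have h01 : 0 < h < 1 by rewrite h0.
  have EaF := lebesgue_ae2 (fun x P Q => conj P Q) EF aG.
  apply: lebesgue_ae2 EaF (EFs h h01) => x [Ex ax] Exh Dx.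
  rewrite /Q Ex// Exh// ax// (antiderivative_increment x s1 (ltW h0) FG).
  by rewrite mulrBr !mulrA ss mul1r [s * h^-1]mulrC -[_ * s * s]mulrA ss mulr1.
Unshelve. all: by end_near. Qed.

Variables (i : interval R) (p : R) (p1 : (1 <= p%:E)%E).
Implicit Types (u a : Lp i p1) (f : R -> Lp i p1).

Let p1R : 1 <= p. Proof. by rewrite -lee_fin. Qed.
Let p0 : 0 < p. Proof. exact: lt_le_trans p1R. Qed.

Lemma pint_ext_ae u (Q : R -> R) : measurable_fun [set: T] Q ->
  {ae mu, forall x, [set` i] x -> ext u x = Q x} ->
  pint p setT (ext u) = pint p [set` i] Q.
Proof.
move=> mQ uQ; rewrite -(pint_mkcond p1R).
apply: ae_eq_pint; first exact: measurable_itv.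
- exact: measurable_funS (measurable_Lp u).
- exact: measurable_funS mQ.
- by apply: lebesgue_aeS uQ => x + ix; rewrite extE//; apply.
Qed.

Lemma Lp_cvgP f u : f @ (0 : R)^'+ --> u <-> forall e : R, 0 < e ->
  \forall h \near (0 : R)^'+, (pint p setT (ext (f h - u)%R) <= e%:E)%E.
Proof.
split=> [/cvgrPdistC_le fu e e0|fu].
  have e'0 : 0 < e `^ p^-1 by rewrite powR_gt0.
  near=> h; rewrite -Lp_norm lee_fin.
  have -> : e = (e `^ p^-1) `^ p by rewrite -powRrM mulVf ?gt_eqF// powRr1// ltW.
  rewrite ge0_ler_powR ?nnegrE ?(ltW p0) ?(ltW e'0)//.
  by near: h; exact: fu.
apply/cvgrPdistC_le => e e0; near=> h.
apply: Lp_norm_le; first exact: ltW.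
by near: h; apply: fu; rewrite powR_gt0.
Unshelve. all: by end_near. Qed.

Variables (f : R -> Lp i p1) (u : Lp i p1) (E : R -> R) (s : R).
Hypothesis s1 : `|s| = 1.
Hypothesis fE : forall h, {ae mu, forall x, [set` i] x -> ext (f h) x = E (x + s * h)}.
Hypothesis uE : {ae mu, forall x, [set` i] x -> ext u x = E x}.
Hypothesis LE : in_Lp p E.

Let mEs h : measurable_fun [set: T] (fun x => E (x + s * h)).
Proof. exact: (in_Lp_shift (s * h) LE).1. Qed.

Lemma shift_cvg : f @ (0 : R)^'+ --> u.
Proof.
apply/Lp_cvgP => e e0; have [d /= d0 dP] := translation_pint_continuous p1R e0 LE.1 LE.2.
near=> h; have mQ : measurable_fun [set: T] (fun x => E (x + s * h) - E x).
  by apply: measurable_funB; [exact: mEs|exact: LE.1].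
rewrite (@pint_ext_ae _ (fun x => E (x + s * h) - E x))//.
  apply: (@le_trans _ _ (pint p setT (fun x => (E (x + s * h) - E x)%R))).
    by apply: pint_subset => //; exact: measurable_itv.
  apply: dP => /=; rewrite sub0r normrN normrM s1 mul1r gtr0_norm.
    by near: h; exact: nbhs_right_lt.
  by near: h; exact: nbhs_right_gt.
have H := ext_linear (-1) u (f h); rewrite scaleN1r addrC in H.
have H1 := lebesgue_ae2 (fun x P Q => conj P Q) (fE h) uE.
by apply: lebesgue_ae2 H H1 => x -> [fx ux] ix; rewrite fx// ux// mulN1r addrC.
Unshelve. all: by end_near. Qed.

Lemma quotient_cvgP a :
  h^-1 *: (f h - u) @[h --> (0 : R)^'+] --> a <->
  forall e : R, 0 < e -> \forall h \near (0 : R)^'+,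
    (pint p [set` i] (fun x => (h^-1 * (E (x + s * h) - E x) - ext a x)%R) <= e%:E)%E.
Proof.
have eqQ h : pint p setT (ext (h^-1 *: (f h - u) - a)) =
    pint p [set` i] (fun x => (h^-1 * (E (x + s * h) - E x) - ext a x)%R).
  apply: pint_ext_ae.
    apply: measurable_funB; last exact: measurable_ext.
    by apply: measurable_funM => //; apply: measurable_funB; [exact: mEs|exact: LE.1].
  have H := ext_linear (-1) u (f h); rewrite scaleN1r [- u + _]addrC in H.
  have H1 := lebesgue_ae2 (fun x P Q => conj P Q) (fE h) uE.
  have H2 := ext_linear h^-1 (f h - u) (- a).
  have H3 := lebesgue_ae2 (fun x P Q => conj P Q) (ext_oppr a) H2.
  have H4 := lebesgue_ae2 (fun x P Q => conj P Q) H H1.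
  apply: lebesgue_ae2 H3 H4 => x [E1 ->] [-> [fx ux]] ix.
  by rewrite E1 fx// ux// mulN1r [- _ + _]addrC.
split=> [/Lp_cvgP H e e0|H].
  by apply: filterS (H e e0) => h; rewrite eqQ.
by apply/Lp_cvgP => e e0; apply: filterS (H e e0) => h; rewrite -eqQ.
Qed.

End difference_quotient_convergence.

(** * The transport semigroup *)

Section inflows.
Context {R : realType} (m q r : nat) (B : 'M[R]_(m + q, m + r)).
Implicit Types (rho : 'I_(m + q)) (f : 'I_m -> R -> R) (g : 'I_r -> R -> R).

(* For x < 0, the value that row rho of the boundary condition prescribes at 0 at
   time -x: mass leaves ]0, 1[ at 1 and ]0, +oo[ at 0, at unit speed. *)
Definition inflow rho f g (x : R) : R :=
  \sum_k B rho (lshift r k) * f k (1 + x) + \sum_l B rho (rshift m l) * g l (- x).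

Lemma eq_inflow rho f f' g g' x x' :
  (forall k, f k (1 + x) = f' k (1 + x')) -> (forall l, g l (- x) = g' l (- x')) ->
  inflow rho f g x = inflow rho f' g' x'.
Proof.
by move=> ff gg; congr (_ + _); apply: eq_bigr => k _; rewrite ?ff ?gg.
Qed.

Lemma inflow_eq0 rho f g x :
  (forall k, f k (1 + x) = 0) -> (forall l, g l (- x) = 0) -> inflow rho f g x = 0.
Proof.
by move=> f0 g0; rewrite /inflow !big1 ?addr0// => k _; rewrite ?f0 ?g0 mulr0.
Qed.

Lemma antiderivative_inflow rho f g f' g' :
  (forall k, antiderivative (f k) (f' k)) -> (forall l, antiderivative (g l) (g' l)) ->
  antiderivative (inflow rho f g) (inflow rho f' (fun l x => - g' l x)).
Proof.
move=> ff gg; apply: antiderivativeD; apply: antiderivative_sum => k;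
  apply: antiderivativeZ.
- have := antiderivative_affine 1 (normr1 R) (ff k).
  congr antiderivative; apply/funext => x; by rewrite !mul1r addrC.
- have := antiderivative_affine 0 (normrN1 R) (gg k).
  congr antiderivative; apply/funext => x; by rewrite !mulN1r addr0.
Qed.

Lemma in_Lp_sum (p : R) (I : Type) (s : seq I) (F : I -> R -> R) : 1 <= p ->
  (forall k, in_Lp p (F k)) -> in_Lp p (fun x => \sum_(k <- s) F k x).
Proof.
move=> p1 LF; elim: s => [|k s IH].
  rewrite (_ : (fun x => _) = cst 0); last by apply/funext => x; rewrite big_nil.
  split; first exact: measurable_cst.
  rewrite /pint; under eq_integral do rewrite normr0 powR0 ?gt_eqF ?(lt_le_trans ltr01 p1)//.
  by rewrite integral0.
rewrite (_ : (fun x => _) = (fun x => F k x + \sum_(k <- s) F k x)); last first.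
  by apply/funext => x; rewrite big_cons.
exact: (in_LpD p1 (LF k) IH).
Qed.

Lemma in_Lp_inflow (p : R) rho f g : 1 <= p -> (forall k, in_Lp p (f k)) ->
  (forall l, in_Lp p (g l)) -> in_Lp p (inflow rho f g).
Proof.
move=> p1 Lf Lg; apply: (in_LpD p1); apply: (in_Lp_sum _ p1) => k; apply: in_LpZ.
- have := in_Lp_affine 1 (normr1 R) (Lf k).
  congr in_Lp; apply/funext => x; by rewrite mul1r addrC.
- have := in_Lp_affine 0 (normrN1 R) (Lg k).
  congr in_Lp; apply/funext => x; by rewrite mulN1r addr0.
Qed.

End inflows.

Lemma lebesgue_ae_finite (R : realType) (I : finType) (P : I -> R -> Prop) :
  (forall k, {ae @lebesgue_measure R, forall x, P k x}) ->
  {ae @lebesgue_measure R, forall x, forall k, P k x}.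
Proof.
move=> H; exact: (@filter_forall _ _ _ _ (ae_filter_ringOfSetsType _)).
Qed.

Lemma ext_sum (R : realType) (i : interval R) (p : R) (p1 : (1 <= p%:E)%E) (I : Type)
    (s : seq I) (c : I -> R) (u : I -> Lp i p1) :
  {ae @lebesgue_measure R, forall x,
    ext (\sum_(k <- s) c k *: u k) x = \sum_(k <- s) c k * ext (u k) x}.
Proof.
elim: s => [|k s IH].
  have := ext_linear (-1) (0 : Lp i p1) 0; rewrite addr0 scaler0 big_nil.
  by apply: lebesgue_aeS => x ->; rewrite mulN1r addNr big_nil.
rewrite big_cons.
apply: lebesgue_ae2 (ext_linear (c k) (u k) (\sum_(k <- s) c k *: u k)) IH => x -> ->.
by rewrite big_cons.
Qed.

(** * Evolution of one right-moving component *)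

Section evolution.
Context {R : realType} (m q r : nat) (B : 'M[R]_(m + q, m + r)).
Context (p : R) (p1 : (1 <= p%:E)%E) (b : itv_bound R).
Hypothesis b_eq : unit_or_halfline b.
Local Notation mu := (@lebesgue_measure R).
Local Notation i := (Interval (BRight (0 : R)) b).
Implicit Types (rho : 'I_(m + q)) (f : Lp i p1).
Implicit Types (u : {ffun 'I_m -> Lp `]0, 1[ p1}) (w : {ffun 'I_r -> Lp `]0, +oo[ p1}).

Let p1R : 1 <= p. Proof. by rewrite -lee_fin. Qed.

(* The initial datum f of a right-moving component, continued to the left of 0 by
   what the boundary condition will inject; for h <= 1 the solution at time h is
   its translate by h. *)
Definition profile rho f u w (x : R) : R :=
  ext f x + inflow B rho (fun k => ext (u k)) (fun l => ext (w l)) x.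

(** A sum of shift operators and not the class of a translated [profile], so that linearity and the
    norm bound are inherited from [shift_op]. *)
Definition evolve rho (h : R) f u w : Lp i p1 :=
  shift_op i 1 (- h) f +
  (\sum_k B rho (lshift r k) *: shift_op i 1 (1 - h) (u k) +
   \sum_l B rho (rshift m l) *: shift_op i (- 1) h (w l)).

(** For x > 0 the points 1 + x and - x are outside the domains of u and w, where the extensions are
    0. *)
Lemma inflow_ext_gt0 rho u w x : 0 < x ->
  inflow B rho (fun k => ext (u k)) (fun l => ext (w l)) x = 0.
Proof.
move=> x0; apply: inflow_eq0 => k; apply: ext_eq0; rewrite /= in_itv /=.
  by apply/negP; rewrite negb_and -!leNgt [X in _ || X]lerDl (ltW x0) orbT.
by apply/negP; rewrite negb_and -leNgt oppr_le0 (ltW x0).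
Qed.

Lemma profile_gt0 rho f u w x : 0 < x -> profile rho f u w x = ext f x.
Proof. by move=> x0; rewrite /profile inflow_ext_gt0// addr0. Qed.

Lemma profile_le0 rho f u w x : x <= 0 -> profile rho f u w x =
  inflow B rho (fun k => ext (u k)) (fun l => ext (w l)) x.
Proof.
move=> x0; rewrite /profile ext_eq0 ?add0r// => /unit_or_halfline_gt0.
by rewrite ltNge x0.
Qed.

Lemma in_Lp_profile rho f u w : in_Lp p (profile rho f u w).
Proof.
apply: (in_LpD p1R); first exact: in_Lp_ext.
by apply: (in_Lp_inflow _ _ p1R) => k; exact: in_Lp_ext.
Qed.

Lemma ext_evolve rho h f u w :
  {ae mu, forall x, [set` i] x -> ext (evolve rho h f u w) x = profile rho f u w (x - h)}.
Proof.
have H0 := ext_linear 1 (shift_op i 1 (- h) f)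
  (\sum_k B rho (lshift r k) *: shift_op i 1 (1 - h) (u k) +
   \sum_l B rho (rshift m l) *: shift_op i (- 1) h (w l)).
have H1 := ext_linear 1 (\sum_k B rho (lshift r k) *: shift_op i 1 (1 - h) (u k))
  (\sum_l B rho (rshift m l) *: shift_op i (- 1) h (w l)).
rewrite scale1r in H0; rewrite scale1r in H1.
have H2 := ext_sum (index_enum 'I_m) (fun k => B rho (lshift r k))
  (fun k => shift_op i 1 (1 - h) (u k)).
have H3 := ext_sum (index_enum 'I_r) (fun l => B rho (rshift m l))
  (fun l => shift_op i (- 1) h (w l)).
have H4 := ext_shift_op i (- h) (normr1 R) f.
have H5 := lebesgue_ae_finite (fun k => ext_shift_op i (1 - h) (normr1 R) (u k)).
have H6 := lebesgue_ae_finite (fun l => ext_shift_op i h (normrN1 R) (w l)).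
have H23 := lebesgue_ae2 (fun x P Q => conj P Q) H2 H3.
have H01 := lebesgue_ae2 (fun x P Q => conj P Q) H0 H1.
have H56 := lebesgue_ae2 (fun x P Q => conj P Q) H5 H6.
have H014 := lebesgue_ae2 (fun x P Q => conj P Q) H01 H4.
have H2356 := lebesgue_ae2 (fun x P Q => conj P Q) H23 H56.
apply: lebesgue_ae2 H014 H2356 => x [[-> ->] E4] [[-> ->] [E5 E6]] ix.
rewrite !mul1r E4// mul1r /profile; congr (_ + _); congr (_ + _); apply: eq_bigr => k _.
- by rewrite E5// mul1r addrCA addrA.
- by rewrite E6// mulN1r opprB addrC.
Qed.

Lemma evolve0 rho f u w : evolve rho 0 f u w = f.
Proof.
apply: Lp_eq; apply: lebesgue_aeS (ext_evolve rho 0 f u w) => x + ix.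
by move=> ->//; rewrite subr0 profile_gt0// (unit_or_halfline_gt0 ix).
Qed.

Lemma evolve_linear rho h (a : R) f u w f' u' w' :
  evolve rho h (a *: f + f') (a *: u + u') (a *: w + w') =
  a *: evolve rho h f u w + evolve rho h f' u' w'.
Proof.
rewrite /evolve (shift_op_linear _ _ (normr1 R)).
rewrite (eq_bigr (fun k => a *: (B rho (lshift r k) *: shift_op i 1 (1 - h) (u k)) +
   B rho (lshift r k) *: shift_op i 1 (1 - h) (u' k))); last first.
  move=> k _; rewrite !ffunE (shift_op_linear _ _ (normr1 R)).
  by rewrite scalerDr !scalerA [a * _]mulrC.
rewrite [X in _ + (_ + X)](eq_bigr (fun l =>
   a *: (B rho (rshift m l) *: shift_op i (-1) h (w l)) +
   B rho (rshift m l) *: shift_op i (-1) h (w' l))); last first.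
  move=> k _; rewrite !ffunE (shift_op_linear _ _ (normrN1 R)).
  by rewrite scalerDr !scalerA [a * _]mulrC.
rewrite !big_split/= -!scaler_sumr !scalerDr.
rewrite [X in _ + X = _]addrACA.
exact: addrACA.
Qed.

Lemma evolve_norm rho h f u w (N : R) : `|f| <= N -> (forall k, `|u k| <= N) ->
  (forall l, `|w l| <= N) -> `|evolve rho h f u w| <=
  (1 + (\sum_k `|B rho (lshift r k)| + \sum_l `|B rho (rshift m l)|)) * N.
Proof.
move=> fN uN wN; rewrite !mulrDl mul1r !mulr_suml.
apply: (le_trans (ler_normD _ _)); apply: lerD.
  exact: le_trans (shift_op_norm _ _ (normr1 R) _) fN.
apply: (le_trans (ler_normD _ _)); apply: lerD;
  apply: (le_trans (ler_norm_sum _ _ _)); apply: ler_sum => k _;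
  rewrite normrZ ler_wpM2l//.
- exact: le_trans (shift_op_norm _ _ (normr1 R) _) (uN k).
- exact: le_trans (shift_op_norm _ _ (normrN1 R) _) (wN k).
Qed.

End evolution.

Lemma lebesgue_ae_neq (R : realType) (s : R) :
  {ae @lebesgue_measure R, forall x, x <> s}.
Proof.
exists [set s]; split; [exact: measurable_set1|exact: lebesgue_measure_set1|].
by move=> x /contrapT.
Qed.

(** * Semigroup law and right continuity of the evolution *)

Section evolution_semigroup.
Context {R : realType} (m q r : nat) (B : 'M[R]_(m + q, m + r)).
Context (p : R) (p1 : (1 <= p%:E)%E) (b : itv_bound R).
Hypothesis b_eq : unit_or_halfline b.
Local Notation i := (Interval (BRight (0 : R)) b).
Implicit Types (rho : 'I_(m + q)) (f : Lp i p1).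
Implicit Types (u : {ffun 'I_m -> Lp `]0, 1[ p1}) (w : {ffun 'I_r -> Lp `]0, +oo[ p1}).

Definition evolve_u t u w : {ffun 'I_m -> Lp `]0, 1[ p1} :=
  [ffun k => evolve B (lshift q k) t (u k) u w].

Definition evolve_w t w : {ffun 'I_r -> Lp `]0, +oo[ p1} :=
  [ffun l => shift_op `]0, +oo[ 1 t (w l)].

Lemma itv_sub_lt x s : [set` i] x -> 0 <= s < x -> [set` i] (x - s).
Proof.
case: b_eq => ->; rewrite /= !in_itv/= => /andP[x0 x1] /andP[s0 sx].
  by rewrite subr_gt0 sx (le_lt_trans _ x1)// gerBl.
by rewrite andbT subr_gt0.
Qed.

(** For x > s, the point x - s lies in i and carries the state at time t. For x < s, the inflow at
    time s - x is read off from u and w at time t; since s + t <= 1, the point 1 + (x - s) - t is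
    positive, so that the value of u there is still an initial datum. *)
Lemma evolve_add rho s t f u w : 0 <= s -> 0 <= t -> s + t <= 1 ->
  evolve B rho (s + t) f u w =
  evolve B rho s (evolve B rho t f u w) (evolve_u t u w) (evolve_w t w).
Proof.
move=> s0 t0 st; have s1 : s <= 1 by rewrite (le_trans _ st)// lerDl.
have unit1 : unit_or_halfline (BLeft (1 : R)) by left.
apply: Lp_eq.
have HA := ext_evolve B rho (s + t) f u w.
have HB := ext_evolve B rho s (evolve B rho t f u w) (evolve_u t u w) (evolve_w t w).
have HC := ae_affine (- s) (normr1 R) (ext_evolve B rho t f u w).
have HD := lebesgue_ae_finite (fun k => ae_affine (1 - s) (normr1 R)
  (ext_evolve B (lshift q k) t (u k) u w)).
have HE := lebesgue_ae_finite (fun l => ae_affine s (normrN1 R)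
  (ext_shift_op `]0, +oo[ t (normr1 R) (w l))).
have HAB := lebesgue_ae2 (fun x P Q => conj P Q) HA HB.
have HDE := lebesgue_ae2 (fun x P Q => conj P Q) HD HE.
(* At x = s the point x - s is the boundary point 0, which is outside i; this null set is
   discarded. *)
have HCs := lebesgue_ae2 (fun x P Q => conj P Q) HC (lebesgue_ae_neq s).
have HCDE := lebesgue_ae2 (fun x P Q => conj P Q) HCs HDE.
apply: lebesgue_ae2 HAB HCDE => x [EA EB] [[EC xs] [ED EE]] ix.
rewrite EA// EB//; have x0 := unit_or_halfline_gt0 ix.
have [sx|sx|xs'] := ltgtP s x; last by case: xs.
  rewrite [RHS]profile_gt0 ?subr_gt0//.
  rewrite mul1r in EC; rewrite EC ?opprD ?addrA//.
  by apply: itv_sub_lt; rewrite ?s0.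
rewrite [RHS]profile_le0 ?subr_le0 ?(ltW sx)//.
rewrite [LHS]profile_le0; last by rewrite subr_le0 (le_trans (ltW sx))// lerDl.
apply: eq_inflow => k; rewrite ffunE.
- have Ek := ED k; rewrite mul1r [x + _]addrCA in Ek; rewrite Ek; last first.
    by rewrite /= in_itv/= gtrDl subr_lt0 sx andbT addrCA ltr_pwDl ?subr_ge0.
  rewrite profile_gt0; last first.
    have -> : 1 + (x - s) - t = x + (1 - (s + t)) by ring.
    by rewrite ltr_pwDl// subr_ge0.
  by rewrite opprD !addrA.
- have El := EE k; rewrite mulN1r in El; rewrite [- (x - s)]opprB [s - x]addrC El; last first.
    by rewrite /= in_itv/= andbT addrC subr_gt0.
  by rewrite mul1r opprB [s + t - x]addrC addrA.
Qed.

Lemma evolve_right_continuous rho f u w :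
  evolve B rho h f u w @[h --> (0 : R)^'+] --> f.
Proof.
have := in_Lp_profile B rho f u w; apply: (shift_cvg (normrN1 R)).
- move=> h; apply: lebesgue_aeS (ext_evolve B rho h f u w) => x + ix.
  by rewrite mulN1r; apply.
- by apply: aeW => x /unit_or_halfline_gt0 x0; rewrite profile_gt0.
Qed.

End evolution_semigroup.

(** * Sobolev representatives on the whole line *)

Section representatives.
Context {R : realType}.
Local Notation mu := (@lebesgue_measure R).
Local Notation T := (measurableTypeR R).
Implicit Types (F G V : R -> R).

Lemma antiderivative_eq F G x y : antiderivative F G -> x <= y ->
  (forall t, x <= t <= y -> G t = 0) -> F x = F y.
Proof.
move=> [_ FG] xy G0; apply/eqP; rewrite eq_sym -subr_eq0 FG//.
rewrite (@eq_Rintegral _ _ _ mu _ (cst 0)); first by rewrite /Rintegral integral0.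
by move=> t; rewrite inE /= in_itv /= => /G0.
Qed.

Variables (b : itv_bound R) (p : R) (p1 : (1 <= p%:E)%E).
Hypothesis b_eq : unit_or_halfline b.
Local Notation i := (Interval (BRight (0 : R)) b).
Implicit Types (u a : Lp i p1).

Let p1R : 1 <= p. Proof. by rewrite -lee_fin. Qed.

Lemma ext_scale (s : R) u : {ae mu, forall x, ext (s *: u) x = s * ext u x}.
Proof.
have := ext_linear s u 0; rewrite addr0.
have := ext_linear (-1) (0 : Lp i p1) 0; rewrite addr0 scaler0.
by apply: lebesgue_ae2 => x ->; rewrite mulN1r addNr addr0.
Qed.

Lemma weak_derivativeP u : sobolev u -> is_weak_derivative u (weak_derivative u).
Proof. by move=> [g ug]; apply: xgetPex; exists g. Qed.

(** Integrating the zero extension of the weak derivative gives a function that is constant to the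
    left of 0, equal there to the trace. *)
Lemma sobolev_representative u : sobolev u -> exists c : R -> R,
  [/\ antiderivative c (ext (weak_derivative u)),
      {ae mu, forall x, [set` i] x -> ext u x = c x},
      forall x, closure [set` i] x -> trace u x = c x &
      forall x, x <= 0 -> c x = trace u 0].
Proof.
move=> /weak_derivativeP ug; have [C [uC tC]] := trace_primitive b_eq ug.
have cg : antiderivative (fun x => C + \int[mu]_(t in `[0, x]) ext (weak_derivative u) t)
    (ext (weak_derivative u)).
  apply: antiderivative_primitive; first exact: ext_interval_integrable.
  by move=> x x0; apply: ext_eq0 => /unit_or_halfline_gt0; rewrite ltNge x0.
exists (fun x => C + \int[mu]_(t in `[0, x]) ext (weak_derivative u) t).
split=> // x x0; rewrite (tC 0 (closure_unit_or_halfline0 b_eq)).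
apply: (antiderivative_eq cg) => // t /andP[_ t0].
by apply: ext_eq0 => /unit_or_halfline_gt0; rewrite ltNge t0.
Qed.

Lemma weak_derivative_on_ae U V V' : interval_integrable V -> interval_integrable V' ->
  {ae mu, forall x, V x = V' x} -> weak_derivative_on i U V -> weak_derivative_on i U V'.
Proof.
move=> [mV _] [mV' _] VV' UV phi tphi; rewrite UV//; congr (- fine _).
have mphi : measurable_fun [set: T] phi.
  apply: continuous_measurable_fun; apply: derivable1_continuous.
  exact: tphi.1 0%N.
apply: ae_eq_integral; first exact: measurable_itv.
- by apply/measurable_EFinP; apply: measurable_funS (measurable_funM mV mphi).
- by apply/measurable_EFinP; apply: measurable_funS (measurable_funM mV' mphi).
- by apply: lebesgue_aeS VV' => x VVx _; rewrite /= VVx.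
Qed.

Lemma quotient_cvg_weak_derivative (f : R -> Lp i p1) u a (E : R -> R) (s : R) :
  `|s| = 1 ->
  (forall h, {ae mu, forall x, [set` i] x -> ext (f h) x = E (x + s * h)}) ->
  {ae mu, forall x, [set` i] x -> ext u x = E x} -> in_Lp p E ->
  h^-1 *: (f h - u) @[h --> (0 : R)^'+] --> a -> is_weak_derivative u (s *: a).
Proof.
move=> s1 fE uE LE /(quotient_cvgP fE uE LE) qa; apply/is_weak_derivativeP.
have Eu : {ae mu, forall x, [set` i] x -> E x = ext u x}.
  by apply: lebesgue_aeS uE => x + ix => ->.
have := difference_quotient_weak_derivative p1R b_eq s1 (in_Lp_ext u) LE (in_Lp_ext a) Eu qa.
apply: weak_derivative_on_ae.
- exact: (in_Lp_interval_integrable p1R (in_LpZ s (in_Lp_ext a))).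
- exact: ext_interval_integrable.
- by apply: lebesgue_aeS (ext_scale s a) => x ->.
Qed.

End representatives.

(** * Generator on the right-moving components *)

Section evolution_generator.
Context {R : realType} (m q r : nat) (B : 'M[R]_(m + q, m + r)).
Context (p : R) (p1 : (1 <= p%:E)%E).
Local Notation mu := (@lebesgue_measure R).
Variables (u : {ffun 'I_m -> Lp `]0, 1[ p1}) (w : {ffun 'I_r -> Lp `]0, +oo[ p1}).
Implicit Types (rho : 'I_(m + q)).

Let p1R : 1 <= p. Proof. by rewrite -lee_fin. Qed.

Definition boundary_inflow rho : R :=
  \sum_k B rho (lshift r k) * trace (u k) 1 + \sum_l B rho (rshift m l) * trace (w l) 0.

(** The minus sign comes from the reflection under which w enters the inflow. *)
Definition inflow_derivative rho : R -> R :=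
  inflow B rho (fun k => ext (weak_derivative (u k)))
    (fun l x => - ext (weak_derivative (w l)) x).

Hypothesis u_sobolev : forall k, sobolev (u k).
Hypothesis w_sobolev : forall l, sobolev (w l).

(** L is the inflow formed with whole-line representatives of u and w. These are constant beyond the
    exit points, 1 for u and 0 for w, hence L is constant to the right of 0. The condition -1 < x <
    0 puts 1 + x in ]0, 1[. *)
Lemma inflow_representative rho : exists L : R -> R,
  [/\ antiderivative L (inflow_derivative rho),
      {ae mu, forall x, -1 < x < 0 ->
        inflow B rho (fun k => ext (u k)) (fun l => ext (w l)) x = L x} &
      forall x, 0 <= x -> L x = boundary_inflow rho].
Proof.
have unit1 : unit_or_halfline (BLeft (1 : R)) by left.
have halfline : unit_or_halfline (+oo%O : itv_bound R) by right.
have [c cP] := choice (fun k => sobolev_representative unit1 (u_sobolev k)).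
have [d dP] := choice (fun l => sobolev_representative halfline (w_sobolev l)).
exists (inflow B rho c d); split.
- by apply: antiderivative_inflow => k; [have [] := cP k|have [] := dP k].
- have Hc := lebesgue_ae_finite (fun k => ae_affine 1 (normr1 R)
    (let: And4 _ P _ _ := cP k in P)).
  have Hd := lebesgue_ae_finite (fun l => ae_affine 0 (normrN1 R)
    (let: And4 _ P _ _ := dP l in P)).
  apply: lebesgue_ae2 Hc Hd => x Ec Ed /andP[x1 x0]; apply: eq_inflow => k.
    have := Ec k; rewrite mul1r addrC; apply.
    by rewrite /= in_itv /= gtrDl x0 andbT -ltrBlDl sub0r.
  have := Ed k; rewrite mulN1r addr0; apply.
  by rewrite /= in_itv /= andbT oppr_gt0.
- move=> x x0; congr (_ + _); apply: eq_bigr => k _; congr (_ * _).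
    have [cg _ tc _] := cP k; rewrite (tc 1 (@closure_unit1 R)); apply/esym.
    apply: (antiderivative_eq cg); first by rewrite lerDl.
    by move=> t /andP[t1 _]; apply: ext_eq0; rewrite /= in_itv /= [t < 1]ltNge t1 andbF.
  by have [_ _ _ ->] := dP k; rewrite ?oppr_le0.
Qed.

Lemma in_Lp_inflow_derivative rho : in_Lp p (inflow_derivative rho).
Proof.
apply: (in_Lp_inflow _ _ p1R) => k; first exact: in_Lp_ext.
have := in_LpZ (-1) (in_Lp_ext (weak_derivative (w k))).
by congr in_Lp; apply/funext => x; rewrite mulN1r.
Qed.

Lemma inflow_derivative_gt0 rho x : 0 < x -> inflow_derivative rho x = 0.
Proof.
move=> x0; apply: inflow_eq0 => k; rewrite ext_eq0 ?oppr0// /= in_itv /=.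
  by apply/negP; rewrite negb_and -!leNgt [X in _ || X]lerDl (ltW x0) orbT.
by apply/negP; rewrite negb_and -leNgt oppr_le0 (ltW x0).
Qed.

Variables (b : itv_bound R) (rho : 'I_(m + q)).
Hypothesis b_eq : unit_or_halfline b.
Local Notation i := (Interval (BRight (0 : R)) b).
Variable f : Lp i p1.

Let fE h : {ae mu, forall x, [set` i] x ->
  ext (evolve B rho h f u w) x = profile B rho f u w (x + - 1 * h)}.
Proof.
apply: lebesgue_aeS (ext_evolve B rho h f u w) => x + ix.
by rewrite mulN1r; apply.
Qed.

Let ext_profile : {ae mu, forall x, [set` i] x -> ext f x = profile B rho f u w x}.
Proof. by apply: aeW => x /unit_or_halfline_gt0 x0; rewrite profile_gt0. Qed.

Lemma evolve_quotient_sobolev (a : Lp i p1) :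
  h^-1 *: (evolve B rho h f u w - f) @[h --> (0 : R)^'+] --> a -> sobolev f.
Proof.
move=> qa; exists (- 1 *: a).
exact: (quotient_cvg_weak_derivative b_eq (normrN1 R) fE ext_profile
  (in_Lp_profile _ _ _ _ _)).
Qed.

Lemma evolve_quotient_boundary (a : Lp i p1) : sobolev f ->
  h^-1 *: (evolve B rho h f u w - f) @[h --> (0 : R)^'+] --> a ->
  trace f 0 = boundary_inflow rho.
Proof.
move=> /(sobolev_representative b_eq)[c [cg fc _ c0]].
have [L [Linflow inflowL L0]] := inflow_representative rho.
move=> /(quotient_cvgP fE ext_profile (in_Lp_profile _ _ _ _ _)) qa.
rewrite -(c0 0 (lexx 0)) -(L0 0 (lexx 0)); apply/esym.
apply: (@difference_quotient_no_jump R p p1R b b_eq (profile B rho f u w) (ext a) c L).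
- exact: in_Lp_profile.
- exact: in_Lp_ext.
- by apply: cvg_at_right_filter; exact: (antiderivative_continuous cg).
- by apply: cvg_at_left_filter; exact: (antiderivative_continuous Linflow).
- by apply: lebesgue_ae2 fc ext_profile => x + + ix => <-// ->.
- apply: lebesgue_aeS inflowL => x + x10.
  by case/andP: (x10) => _ /ltW x0; rewrite profile_le0//; apply.
- move=> e e0; apply: filterS (qa e e0) => h.
  by under eq_pint do rewrite mulN1r.
Qed.

(* By the boundary condition the continuous representatives of f and of the inflow
   match at 0, so that the profile is absolutely continuous across 0. *)
Lemma evolve_quotient_cvg : sobolev f -> trace f 0 = boundary_inflow rho ->
  h^-1 *: (evolve B rho h f u w - f) @[h --> (0 : R)^'+] --> - weak_derivative f.
Proof.
move=> /(sobolev_representative b_eq)[c [cg fc _ c0]] f0.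
have [L [Linflow inflowL L0]] := inflow_representative rho.
apply/(quotient_cvgP fE ext_profile (in_Lp_profile _ _ _ _ _)) => e.
pose G x := ext (weak_derivative f) x + inflow_derivative rho x.
(* A single formula for both sides of 0: to the left c equals c 0 and L remains, to the right L
   equals the boundary inflow, that is c 0, and c remains. *)
have FG : antiderivative (fun x => c x + L x + - c 0) G.
  have := antiderivativeD (antiderivativeD cg Linflow) (antiderivative_cst (- c 0)).
  by congr antiderivative; apply/funext => x; rewrite /G addr0.
have EF : {ae mu, forall x, -1 < x -> (x < 0 \/ [set` i] x) ->
    profile B rho f u w x = c x + L x + - c 0}.
  apply: lebesgue_ae2 fc inflowL => x fx Lx x1 [x0|ix].
    by rewrite profile_le0 ?(ltW x0)// Lx ?x1// !c0 ?(ltW x0)// addrAC subrr add0r.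
  rewrite profile_gt0 ?(unit_or_halfline_gt0 ix)// fx// L0 ?(ltW (unit_or_halfline_gt0 ix))//.
  by rewrite -f0 (c0 0)// addrK.
apply: (antiderivative_quotient p1R (normrN1 R) (measurable_itv i) FG).
- exact: (in_LpD p1R (in_Lp_ext _) (in_Lp_inflow_derivative rho)).
- exact: (in_Lp_profile B rho f u w).1.
- exact: measurable_ext.
- apply: lebesgue_aeS EF => x Ex ix; have x0 := unit_or_halfline_gt0 ix.
  apply: Ex; [by rewrite (lt_trans _ x0)// ltrN10|by right].
- apply: lebesgue_aeS (ext_oppr (weak_derivative f)) => x -> ix.
  by rewrite mulN1r /G inflow_derivative_gt0 ?(unit_or_halfline_gt0 ix)// addr0.
- move=> h /andP[h0 h1].
  have EFh := ae_affine (- 1 * h) (normr1 R) EF.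
  (* The value x = h is excluded because x - h = 0 lies neither in i nor to the left of 0. *)
  apply: lebesgue_ae2 EFh (lebesgue_ae_neq h) => x; rewrite !mul1r !mulN1r => Ex xh ix.
  have x0 := unit_or_halfline_gt0 ix.
  apply: Ex; first by rewrite ltrBrDr (lt_trans _ x0)// addrC subr_lt0.
  have [xh'|hx] := ltP x h; first by left; rewrite subr_lt0.
  right; apply: itv_sub_lt => //; rewrite (ltW h0) lt_neqAle hx andbT eq_sym.
  exact/eqP.
Qed.

End evolution_generator.

(** * Generator on the left-moving components *)

Section outgoing_shift.
Context {R : realType} (p : R) (p1 : (1 <= p%:E)%E).
Local Notation mu := (@lebesgue_measure R).
Local Notation Lp0 := (Lp (`]0, +oo[ : interval R) p1).
Implicit Types (v a : Lp0).

Let p1R : 1 <= p. Proof. by rewrite -lee_fin. Qed.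
Let halfline : unit_or_halfline (+oo%O : itv_bound R). Proof. by right. Qed.

Local Notation outgoing_shift h v := (shift_op (`]0, +oo[ : interval R) 1 h v : Lp0).

Let shiftE v h : {ae mu, forall x, `]0, +oo[%classic x ->
  ext (outgoing_shift h v) x = ext v (x + 1 * h)}.
Proof.
apply: lebesgue_aeS (ext_shift_op _ h (normr1 R) v) => x + x0.
by rewrite !mul1r; apply.
Qed.

(** Nothing enters a left-moving component, so the function E of the general lemmas is [ext v]
    itself. *)
Let ext_refl v : {ae mu, forall x, `]0, +oo[%classic x -> ext v x = ext v x}.
Proof. exact: aeW. Qed.

Lemma outgoing_shift0 v : outgoing_shift 0 v = v.
Proof.
apply: Lp_eq; apply: lebesgue_aeS (shiftE v 0) => x + x0.
by rewrite mulr0 addr0; apply.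
Qed.

Lemma outgoing_shiftD s t v : 0 <= s ->
  outgoing_shift (s + t) v = outgoing_shift s (outgoing_shift t v).
Proof.
move=> s0; apply: Lp_eq.
have H := lebesgue_ae2 (fun x P Q => conj P Q) (shiftE v (s + t))
  (shiftE (outgoing_shift t v) s).
apply: lebesgue_ae2 H (ae_affine s (normr1 R) (shiftE v t)) => x [Est Es] Et x0.
rewrite !mul1r in Est Es Et; rewrite Est// Es// Et; first by rewrite addrA.
by move: x0; rewrite /= !in_itv /= !andbT => x0; rewrite ltr_wpDr.
Qed.

Lemma outgoing_shift_right_continuous v :
  outgoing_shift h v @[h --> (0 : R)^'+] --> v.
Proof. exact: shift_cvg (normr1 R) (shiftE v) (ext_refl v) (in_Lp_ext v). Qed.

Lemma outgoing_quotient_sobolev v a :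
  h^-1 *: (outgoing_shift h v - v) @[h --> (0 : R)^'+] --> a -> sobolev v.
Proof.
move=> qa; exists (1 *: a).
exact: (quotient_cvg_weak_derivative halfline (normr1 R) (shiftE v) (ext_refl v)
  (in_Lp_ext v)).
Qed.

Lemma outgoing_quotient_cvg v : sobolev v ->
  h^-1 *: (outgoing_shift h v - v) @[h --> (0 : R)^'+] --> weak_derivative v.
Proof.
move=> /(sobolev_representative halfline)[c [cg vc _ _]].
apply/(quotient_cvgP (shiftE v) (ext_refl v) (in_Lp_ext v)) => e.
apply: (antiderivative_quotient p1R (normr1 R) (measurable_itv _) cg).
- exact: in_Lp_ext.
- exact: measurable_ext.
- exact: measurable_ext.
- exact: vc.
- by apply: aeW => x _; rewrite mul1r.
- move=> h /andP[h0 _]; apply: lebesgue_aeS (ae_affine h (normr1 R) vc) => x.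
  rewrite !mul1r => + x0; apply.
  by move: x0; rewrite /= !in_itv /= !andbT => x0; rewrite addr_gt0.
Qed.

End outgoing_shift.

(** * Convergence in products and finite powers *)

Section product_convergence.
Context {R : realType}.

Lemma ffun_norm_le (I : finType) (V : normedModType R) (f : {ffun I -> V}) (N : R) :
  0 <= N -> (`|f| <= N) <-> (forall k, `|f k| <= N).
Proof.
move=> N0; split=> [fN k|fN]; last exact: bigmax_le.
by apply: le_trans fN; exact: (@le_bigmax _ _ _ _ (fun k => `|f k|)).
Qed.

Lemma ffun_cvgP (I : finType) (V : normedModType R) (F : set_system R) {FF : Filter F}
    (g : R -> {ffun I -> V}) (l : {ffun I -> V}) :
  g @ F --> l <-> forall k, g h k @[h --> F] --> l k.
Proof.
split=> [/cvgrPdist_le gl k|gl]; apply/cvgrPdist_le => e e0.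
  apply: filterS (gl e e0) => h /(ffun_norm_le _ (ltW e0))/(_ k).
  by rewrite !ffunE.
have : \forall h \near F, forall k, `|l k - g h k| <= e.
  apply: filter_forall => k; have /cvgrPdist_le := gl k; exact.
apply: filterS => h gh; apply/ffun_norm_le; first exact: ltW.
by move=> k; rewrite !ffunE.
Qed.

Lemma prod_cvgP (U V : normedModType R) (F : set_system R) {FF : Filter F}
    (g : R -> U * V) (l : U * V) :
  g @ F --> l <-> (g h).1 @[h --> F] --> l.1 /\ (g h).2 @[h --> F] --> l.2.
Proof.
split=> [/cvgrPdist_le gl|[/cvgrPdist_le g1 /cvgrPdist_le g2]].
  by split; apply/cvgrPdist_le => e e0; apply: filterS (gl e e0) => h;
    rewrite prod_normE ge_max => /andP[].
apply/cvgrPdist_le => e e0; apply: filterS2 (g1 e e0) (g2 e e0) => h h1 h2.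
by rewrite prod_normE ge_max h1.
Qed.

End product_convergence.

(** * Semigroup and generator on the product space *)

Section transport.
Context {R : realType} (m q r : nat) (B : 'M[R]_(m + q, m + r)).
Context (p : R) (p1 : (1 <= p%:E)%E).
Local Notation X := (@Xp R m q r p p1).
Implicit Types (z : X).

Let unit1 : unit_or_halfline (BLeft (1 : R)). Proof. by left. Qed.
Let halfline : unit_or_halfline (+oo%O : itv_bound R). Proof. by right. Qed.

Definition transport (h : R) z : X :=
  ([ffun j => evolve B (lshift q j) h (z.1.1 j) z.1.1 z.2],
   [ffun j => evolve B (rshift m j) h (z.1.2 j) z.1.1 z.2],
   [ffun j => shift_op `]0, +oo[ 1 h (z.2 j)]).

(** The sum over all rows dominates the bound of each row, as the maximum norm of the product
    requires. *)
Definition transport_bound : R := 1 + \sum_rho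
  (\sum_k `|B rho (lshift r k)| + \sum_l `|B rho (rshift m l)|).

Lemma Xp_norm_le z (N : R) : 0 <= N -> (`|z| <= N) <->
  [/\ forall j, `|z.1.1 j| <= N, forall j, `|z.1.2 j| <= N & forall j, `|z.2 j| <= N].
Proof.
move=> N0; case: z => -[u v] w; rewrite prod_normE /= ge_max prod_normE /= ge_max.
split=> [/andP[/andP[] /(ffun_norm_le _ N0) uN /(ffun_norm_le _ N0) vN]|].
  by move=> /(ffun_norm_le _ N0) wN.
by case=> uN vN wN; apply/andP; split; [apply/andP; split|]; apply/(ffun_norm_le _ N0).
Qed.

Lemma Xp_cvgP (g : R -> X) z : g @ (0 : R)^'+ --> z <->
  [/\ forall j, (g h).1.1 j @[h --> (0 : R)^'+] --> z.1.1 j,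
      forall j, (g h).1.2 j @[h --> (0 : R)^'+] --> z.1.2 j &
      forall j, (g h).2 j @[h --> (0 : R)^'+] --> z.2 j].
Proof.
rewrite prod_cvgP prod_cvgP !ffun_cvgP.
by split=> [[[]]|[]].
Qed.

Lemma transport_linear h : linear (transport h).
Proof.
move=> a [[u v] w] [[u' v'] w']; congr (_, _, _); apply/ffunP => j;
  rewrite !ffunE.
- exact: evolve_linear.
- exact: evolve_linear.
- exact: shift_op_linear (normr1 R) _ _ _.
Qed.

Lemma transport_bounded h z : `|transport h z| <= transport_bound * `|z|.
Proof.
have S0 rho : 0 <= \sum_k `|B rho (lshift r k)| + \sum_l `|B rho (rshift m l)|.
  by rewrite addr_ge0// sumr_ge0.
have K1 : 1 <= transport_bound by rewrite lerDl sumr_ge0.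
have Krho rho : 1 + (\sum_k `|B rho (lshift r k)| + \sum_l `|B rho (rshift m l)|)
    <= transport_bound.
  by rewrite lerD2l (bigD1 rho)//= lerDl sumr_ge0.
have [uN vN wN] := (Xp_norm_le z (normr_ge0 z)).1 (lexx _).
apply/Xp_norm_le; first by rewrite mulr_ge0// (le_trans ler01).
split=> j; rewrite ffunE.
- by apply: (le_trans (evolve_norm B _ h (uN j) uN wN)); rewrite ler_wpM2r.
- by apply: (le_trans (evolve_norm B _ h (vN j) uN wN)); rewrite ler_wpM2r.
- apply: (le_trans (shift_op_norm _ h (normr1 R) _)).
  by apply: (le_trans (wN j)); rewrite ler_peMl.
Qed.

Lemma transport0 z : transport 0 z = z.
Proof.
case: z => -[u v] w; congr (_, _, _); apply/ffunP => j; rewrite !ffunE.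
- exact: evolve0.
- exact: evolve0.
- exact: outgoing_shift0.
Qed.

Lemma transportD s t z : 0 <= s -> 0 <= t -> s + t <= 1 ->
  transport (s + t) z = transport s (transport t z).
Proof.
move=> s0 t0 st; congr (_, _, _); apply/ffunP => j; rewrite !ffunE.
- exact: evolve_add.
- exact: evolve_add.
- exact: outgoing_shiftD.
Qed.

Lemma transport_right_continuous z : transport h z @[h --> (0 : R)^'+] --> z.
Proof.
apply/Xp_cvgP; split=> j /=; under eq_fun do rewrite ffunE.
- exact: evolve_right_continuous.
- exact: evolve_right_continuous.
- exact: outgoing_shift_right_continuous.
Qed.

Lemma transport_quotient_cvgP (z y : X) :
  h^-1 *: (transport h z - z) @[h --> (0 : R)^'+] --> y <->
  [/\ forall j, h^-1 *: (evolve B (lshift q j) h (z.1.1 j) z.1.1 z.2 - z.1.1 j)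
        @[h --> (0 : R)^'+] --> y.1.1 j,
      forall j, h^-1 *: (evolve B (rshift m j) h (z.1.2 j) z.1.1 z.2 - z.1.2 j)
        @[h --> (0 : R)^'+] --> y.1.2 j &
      forall j, h^-1 *: (shift_op `]0, +oo[ 1 h (z.2 j) - z.2 j)
        @[h --> (0 : R)^'+] --> y.2 j].
Proof.
have Eu j h : (h^-1 *: (transport h z - z)).1.1 j =
    h^-1 *: (evolve B (lshift q j) h (z.1.1 j) z.1.1 z.2 - z.1.1 j) by rewrite !ffunE.
have Ev j h : (h^-1 *: (transport h z - z)).1.2 j =
    h^-1 *: (evolve B (rshift m j) h (z.1.2 j) z.1.1 z.2 - z.1.2 j) by rewrite !ffunE.
have Ew j h : (h^-1 *: (transport h z - z)).2 j =
    h^-1 *: (shift_op `]0, +oo[ 1 h (z.2 j) - z.2 j) by rewrite !ffunE.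
rewrite Xp_cvgP; split=> -[yu yv yw]; split=> j.
- by under eq_fun do rewrite -Eu; exact: yu.
- by under eq_fun do rewrite -Ev; exact: yv.
- by under eq_fun do rewrite -Ew; exact: yw.
- by under eq_fun do rewrite Eu; exact: yu.
- by under eq_fun do rewrite Ev; exact: yv.
- by under eq_fun do rewrite Ew; exact: yw.
Qed.

Lemma Ap_domainP z : Ap_domain B z <->
  [/\ forall j, sobolev (z.1.1 j), forall j, sobolev (z.1.2 j), forall j, sobolev (z.2 j),
      forall j, trace (z.1.1 j) 0 = boundary_inflow B z.1.1 z.2 (lshift q j) &
      forall j, trace (z.1.2 j) 0 = boundary_inflow B z.1.1 z.2 (rshift m j)].
Proof.
case: z => -[u v] w /=.
have Brow rho : (B *m col_mx (\col_j trace (u j) 1) (\col_j trace (w j) 0)) rho ord0 =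
    boundary_inflow B u w rho.
  rewrite mxE big_split_ord; congr (_ + _); apply: eq_bigr => k _.
    by rewrite col_mxEu mxE.
  by rewrite col_mxEd mxE.
split=> [[su sv sw uvE]|[su sv sw uE vE]]; split=> //.
- by move=> j; rewrite -Brow -uvE col_mxEu mxE.
- by move=> j; rewrite -Brow -uvE col_mxEd mxE.
- apply/matrixP => rho k; rewrite ord1 Brow.
  have [j ->|j ->] := split_ordP rho.
    by rewrite col_mxEu mxE.
  by rewrite col_mxEd mxE.
Qed.

Lemma transport_quotient_domain z : Ap_domain B z ->
  h^-1 *: (transport h z - z) @[h --> (0 : R)^'+] --> Ap z.
Proof.
move=> /Ap_domainP; case: z => -[u v] w /= [su sv sw uE vE].
apply/transport_quotient_cvgP; split=> j /=; rewrite ffunE.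
- exact: evolve_quotient_cvg.
- exact: evolve_quotient_cvg.
- exact: outgoing_quotient_cvg.
Qed.

Lemma transport_quotient_cvg (z y : X) :
  h^-1 *: (transport h z - z) @[h --> (0 : R)^'+] --> y -> Ap_domain B z.
Proof.
move=> /transport_quotient_cvgP[yu yv yw].
have su j : sobolev (z.1.1 j) by exact: evolve_quotient_sobolev (yu j).
have sv j : sobolev (z.1.2 j) by exact: evolve_quotient_sobolev (yv j).
have sw j : sobolev (z.2 j) by exact: outgoing_quotient_sobolev (yw j).
apply/Ap_domainP; split=> // j.
- exact: evolve_quotient_boundary (yu j).
- exact: evolve_quotient_boundary (yv j).
Qed.

End transport.

Theorem proposition1p1 (R : realType) (m q r : nat)
    (B : 'M[R]_(m + q, m + r)) (p : R) (p1 : (1 <= p%:E)%E) :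
  generates_strongly_continuous_semigroup
    (@Ap R m q r p p1) (@Ap_domain R m q r p p1 B).
Proof.
pose S := semigroup_extension (@transport R m q r B p p1).
have tl t : 0 <= t <= 1 -> linear (@transport R m q r B p p1 t).
  by move=> _; exact: transport_linear.
have tb t (x : @Xp R m q r p p1) : 0 <= t <= 1 ->
    `|transport B t x| <= transport_bound B * `|x|.
  by move=> _; exact: transport_bounded.
have Slocal t x : 0 <= t < 1 -> S t x = transport B t x.
  exact: semigroup_extension_local.
exists S; split.
  exact: (semigroup_extension_strongly_continuous tl tb (@transport0 _ _ _ _ B _ p1)
    (@transportD _ _ _ _ B _ p1) (@transport_right_continuous _ _ _ _ B _ p1)).
(* A limit at 0+ only sees h < 1, where the extended semigroup coincides with [transport]. *)
have Squotient (z y : @Xp R m q r p p1) :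
    h^-1 *: (S h z - z) @[h --> (0 : R)^'+] --> y <->
    h^-1 *: (transport B h z - z) @[h --> (0 : R)^'+] --> y.
  have Seq : {near (0 : R)^'+,
      (fun h => h^-1 *: (S h z - z)) =1 (fun h => h^-1 *: (transport B h z - z))}.
    near=> h; rewrite Slocal//; apply/andP; split.
      by near: h; exact: nbhs_right_ge.
    by near: h; exact: nbhs_right_lt.
  have Seq' : {near (0 : R)^'+,
      (fun h => h^-1 *: (transport B h z - z)) =1 (fun h => h^-1 *: (S h z - z))}.
    by apply: filterS Seq => h ->.
  by split=> H; [exact: cvg_trans (near_eq_cvg Seq) H|exact: cvg_trans (near_eq_cvg Seq') H].
split=> z => [|Dz]; last by apply/Squotient; exact: transport_quotient_domain.
split=> [Dz|/cvg_ex[y /Squotient yE]]; last exact: transport_quotient_cvg yE.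
by apply/cvg_ex; exists (Ap z); apply/Squotient; exact: transport_quotient_domain.
Unshelve. all: by end_near. Qed.
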